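(* Let $W_0\in H^{\alpha+1}(\mathbb{T}^d)$ for some $\alpha>1+d/2$, and let $\phi\in H^\beta(\mathbb{T}^d)$ be a probability density, where $\beta\ge 3+d$ is an even integer. Assume $\phi$ is strictly positive, $\phi\ge\phi_{min}>0$ on $\mathbb{T}^d$, and that the Fourier coefficients $\hat\phi(k)=\int_{\mathbb{T}^d}\phi(x)e^{-2\pi i k\cdot x}dx$ satisfy, for some $c>0$ and some $\zeta>\beta+d/2$, $$|\hat\phi(k)|\ge c|k|^{-\zeta},\qquad 0\ne k\in\mathbb{Z}^d .$$ Let $W=\sum_{k\in\mathbb{Z}^d:|k|\le K}W_ke_k$ be band-limited by $K$ Fourier frequencies, where $e_k(x)=e^{2\pi i k\cdot x}$, and assume $\|W\|_{W^{2,\infty}}+\|W_0\|_{W^{2,\infty}}\le M$ as well as $\int_{\mathbb{T}^d}(W-W_0)\,dx=0$. Then there exists a constant $C=C(d,T,M,\|\phi\|_{H^\beta},\phi_{min})>0$ such that for any $0<t_0\le\frac{c}{2C}K^{-\zeta}$, $$\|W-W_0\|_{L^2}^2\le C\Big(K^{-2\alpha-2}+t_0^{-1}K^{2\zeta}\big(\|\rho_W-\rho_{W_0}\|^2_{H^1([0,t_0],H^{-1})}+\|\rho_W-\rho_{W_0}\|^2_{L^2([0,t_0],H^1)}\big)\Big).$$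
   Context: $\mathbb{T}^d=\mathbb{R}^d/\mathbb{Z}^d$ is the $d$-dimensional torus with Lebesgue (probability) measure, and $T>0$ is fixed. The potentials $W,W_0$ are real-valued functions on $\mathbb{T}^d$, and $K\ge 1$ is an integer. $H^s=H^s(\mathbb{T}^d)$, $s\in\mathbb{R}$, are the usual $L^2$-Sobolev spaces (for $s<0$ the dual of $H^{-s}$), and $L^2=L^2(\mathbb{T}^d)$. $W^{2,\infty}(\mathbb{T}^d)$ is the space of continuous functions whose weak partial derivatives up to order 2 are bounded, with its usual norm. The notation $C=C(\dots)$ means a constant depending on the listed quantities. For a normed space $B$ of functions on $\mathbb{T}^d$, $L^2([0,t_0],B)$ is the space of $H:[0,t_0]\times\mathbb{T}^d\to\mathbb{R}$ with norm $\big(\int_0^{t_0}\|H(t,\cdot)\|_B^2dt\big)^{1/2}$, and $H^1([0,t_0],B)$ is the space of $H\in L^2([0,t_0],B)$ whose weak time derivative also lies in $L^2([0,t_0],B)$, with squared norm $\|H\|^2_{L^2([0,t_0],B)}+\|\partial_tH\|^2_{L^2([0,t_0],B)}$. For $W\in W^{2,\infty}(\mathbb{T}^d)$ and a probability density $\phi\in H^{3+d}(\mathbb{T}^d)$, $\rho_W:[0,T]\times\mathbb{T}^d\to[0,\infty)$ denotes the unique classical periodic solution (a probability density in $x$ for each $t$; its existence and uniqueness is a known result) of the McKean-Vlasov equation $$\frac{\partial\rho}{\partial t}=\Delta\rho+\nabla\cdot\big(\rho\,\nabla(W\ast\rho)\big),\qquad \rho(0,\cdot)=\phi,$$ where $\ast$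 is convolution in the space variable on $\mathbb{T}^d$.
   Formalization: The constant C may also depend on c and on the norm of W_0 in H^{α+1}; with dependence only on d, T, M, the H^β norm of φ and φ_min, the claim fails (e.g. d=1, W_0=0, W a single frequency-K cosine, K large, then c small, t_0→0). *)

(* Defs.v *)
From HB Require Import structures.
From mathcomp Require Import all_boot all_order all_algebra.
From mathcomp Require Import complex.
From mathcomp Require Import all_classical all_reals all_analysis.

Set Implicit Arguments.
Unset Strict Implicit.
Unset Printing Implicit Defensive.
Import Order.TTheory GRing.Theory Num.Theory.
Import numFieldNormedType.Exports.

Local Open Scope classical_set_scope.
Local Open Scope ring_scope.

(* Functions on the torus R^d / Z^d are represented by their Z^d-periodic lifts
   'rV[R]_d -> R, and the measure of the torus is the Lebesgue measure of the
   unit cube [0, 1]^d. *)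

Definition row_display : measure_display. Proof. exact. Qed.

(* The sigma-algebra on 'rV[R]_n generated by the coordinates, i.e., the Borel
   sigma-algebra. *)
Section row_measurable.
Context {R : realType} {n : nat}.

Definition row_coord (i : 'I_n) (x : 'rV[R]_n) : R := x 0 i.

Let row_set0 : g_sigma_preimage row_coord set0.
Proof. exact: sigma_algebra0. Qed.

Let row_setC A : g_sigma_preimage row_coord A ->
  g_sigma_preimage row_coord (~` A).
Proof. exact: sigma_algebraC. Qed.

Let row_bigcup (F : _^nat) : (forall i, g_sigma_preimage row_coord (F i)) ->
  g_sigma_preimage row_coord (\bigcup_i (F i)).
Proof. exact: sigma_algebra_bigcup. Qed.

HB.instance Definition _ := @isMeasurable.Build row_display
  'rV[R]_n (g_sigma_preimage row_coord) row_set0 row_setC row_bigcup.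

End row_measurable.

(* measurableTypeR R is the copy of R on which lebesgue_measure is defined. *)
Definition row_cons {R : realType} {n : nat} 
    (p : measurableTypeR R * 'rV[R]_n) : 'rV[R]_n.+1 :=
  row_mx (const_mx (p.1 : R) : 'rV[R]_1) p.2.

Lemma measurable_row_coord {R : realType} {n : nat} (i : 'I_n) :
  measurable_fun setT (@row_coord R n i).
Proof.
move=> _ Y mY; rewrite setTI; apply: sub_sigma_algebra => /=.
rewrite -bigcup_seq/=; exists i => /=; first by rewrite mem_index_enum.
by exists Y => //; rewrite setTI.
Qed.

Lemma measurable_row_cons {R : realType} {n : nat} :
  measurable_fun setT (@row_cons R n).
Proof.
move=> _ Y mY; rewrite setTI.
have H : preimage_set_system setT row_cons measurable =
    g_sigma_preimage (fun i : 'I_n.+1 => row_coord i \o @row_cons R n).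
  by rewrite g_sigma_preimage_comp.
have : preimage_set_system setT (@row_cons R n) measurable (row_cons @^-1` Y).
  by exists Y => //; rewrite setTI.
rewrite H; apply: smallest_sub; first exact: sigma_algebra_measurable.
move=> A; rewrite -bigcup_seq/= => -[i _ [B mB <-]]; rewrite setTI.
rewrite -[X in measurable X]setTI.
suff : measurable_fun setT (row_coord i \o @row_cons R n) by exact.
have [j ->|j ->] := @split_ordP 1 n i.
  rewrite (_ : _ \o _ = fst); first exact: measurable_fst.
  apply/funext => x; apply: etrans (row_mxEl (const_mx (x.1 : R)) x.2 0 j) _.
  by rewrite mxE.
rewrite (_ : _ \o _ = row_coord j \o snd).
  by apply: measurableT_comp; [exact: measurable_row_coord|exact: measurable_snd].
by apply/funext => x; exact: (row_mxEr (const_mx (x.1 : R)) x.2 0 j).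
Qed.

HB.instance Definition _ (R : realType) (n : nat) :=
  isMeasurableFun.Build _ _ _ _ (@row_cons R n) measurable_row_cons.

Fixpoint torus_measure (R : realType) (n : nat) : probability 'rV[R]_n R :=
  match n with
  | 0 => \d_(0 : 'rV[R]_0)
  | m.+1 => distribution (uniform_prob (@ltr01 R) \x torus_measure R m)%E
              [the {mfun _ >-> _} of @row_cons R m]
  end.

Section torus.
Context {R : realType} {d : nat}.
Local Notation mu := (torus_measure R d).
Implicit Types (f g h : 'rV[R]_d -> R) (k : 'rV[int]_d) (i j : 'I_d).

Definition unit_row i : 'rV[R]_d := delta_mx 0 i.

Definition torus_periodic f := forall x i, f (x + unit_row i) = f x.

Definition prob_density f :=
  [/\ torus_periodic f, measurable_fun setT f, forall x, 0 <= f x &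
      (\int[mu]_x (f x)%:E = 1)%E].

Definition L2_norm f : \bar R := ('N[mu]_2%:E[EFin \o f])%E.

Definition Loo_norm f : \bar R := ('N[mu]_+oo[EFin \o f])%E.

Definition convolution f g : 'rV[R]_d -> R :=
  fun x => \int[mu]_y (f (x - y) * g y).

(* the Euclidean norm; `|k| would be the max norm *)
Definition freq_norm k : R := Num.sqrt (\sum_i (k 0 i)%:~R ^+ 2).

Definition phase k (x : 'rV[R]_d) : R :=
  2 * pi * \sum_i (k 0 i)%:~R * x 0 i.

Definition fourier_mode k (x : 'rV[R]_d) : R[i] :=
  Complex (cos (phase k x)) (sin (phase k x)).

(* \int f(x) e^(- 2 pi i k.x) dx, split into real and imaginary parts *)
Definition fourier_coef f k : R[i] :=
  Complex (\int[mu]_x (f x * cos (phase k x)))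
          (- \int[mu]_x (f x * sin (phase k x))).

Definition band_limited (K : nat) f := exists c : 'rV[int]_d -> R[i],
  forall x, Complex (f x) 0 =
    \sum_(k \in [set k | freq_norm k <= K%:R]) c k * fourier_mode k x.

(* ||f||_{H^s} = (sum_k (1 + |k|^2)^s |hat f(k)|^2)^(1/2), used for s >= 0 only;
   Sobolev spaces of negative order are the duals below. *)
Definition Hs_norm (s : R) f : \bar R :=
  ((\esum_(k in [set: 'rV[int]_d])
     ((1 + freq_norm k ^+ 2) `^ s * Normc.normc (fourier_coef f k) ^+ 2)%:E)
   `^ 2^-1)%E.

Definition Hs (s : R) : set ('rV[R]_d -> R) :=
  [set f | [/\ torus_periodic f, measurable_fun setT f,
    (L2_norm f < +oo)%E & (Hs_norm s f < +oo)%E]].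

Definition dual_norm (s : R) (F : ('rV[R]_d -> R) -> R) : \bar R :=
  ereal_sup [set (`|F h|)%:E | h in [set h | Hs s h /\ (Hs_norm s h <= 1)%E]].

(* H^(-s) as the dual of H^s; a functional is only meaningful on H^s. *)
Definition Hs_dual (s : R) : set (('rV[R]_d -> R) -> R) :=
  [set F | (forall (a : R) h1 h2, Hs s h1 -> Hs s h2 ->
              F (fun x => a * h1 x + h2 x) = a * F h1 + F h2) /\
           (dual_norm s F < +oo)%E].

(* the embedding of L^2 into H^(-s) *)
Definition pairing f : ('rV[R]_d -> R) -> R := fun h => \int[mu]_x (f x * h x).

Definition partial i f : 'rV[R]_d -> R := fun x => 'D_(unit_row i) f x.

Definition iter_partial (s : seq 'I_d) f := foldr partial f s.

Definition smooth_periodic f := torus_periodic f /\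
  forall s, continuous (iter_partial s f) /\
    forall i x, derivable (iter_partial s f) x (unit_row i).

Definition weak_partial (s : seq 'I_d) f : set ('rV[R]_d -> R) :=
  [set g | [/\ torus_periodic g, mu.-integrable setT (EFin \o g) &
    forall psi, smooth_periodic psi ->
      \int[mu]_x (f x * iter_partial s psi x) =
      (- 1) ^+ size s * \int[mu]_x (g x * psi x)]].

(* Weak derivatives are unique almost everywhere, so this is the sup norm of the
   weak derivative of f along s, and +oo if there is none. *)
Definition weak_partial_norm (s : seq 'I_d) f : \bar R :=
  ereal_inf [set Loo_norm g | g in weak_partial s f].

(* one term per multi-index of order <= 2 *)
Definition W2oo_norm f : \bar R :=
  (Loo_norm f + \sum_(i < d) weak_partial_norm [:: i] f +
   \sum_(i < d) \sum_(j < d | (i <= j)%N) weak_partial_norm [:: i; j] f)%E.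

Definition W2oo : set ('rV[R]_d -> R) :=
  [set f | [/\ torus_periodic f, continuous f & (W2oo_norm f < +oo)%E]].

(* squared norm of L^2([0, t0], B), for a space B with norm N *)
Definition L2t_sqnorm (B : Type) (N : B -> \bar R) (t0 : R) (H : R -> B) :
    \bar R :=
  (\int[lebesgue_measure]_(t in `[0%R, t0]) (N (H t) ^+ 2))%E.

Definition time_test (t0 : R) (eta : R -> R) :=
  (forall n t, derivable (derive1n n eta) t 1) /\
  exists a b : R, [/\ 0 < a, b < t0 & forall t, eta t != 0 -> a <= t <= b].

(* weak time derivatives in H^(-s) of F : [0, t0] -> H^(-s) *)
Definition weak_dt (s t0 : R) (F : R -> ('rV[R]_d -> R) -> R) :
    set (R -> ('rV[R]_d -> R) -> R) :=
  [set G | [/\ forall t, 0 < t < t0 -> Hs_dual s (G t),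
    forall h, Hs s h ->
      lebesgue_measure.-integrable `[0, t0] (fun t => (G t h)%:E) &
    forall h eta, Hs s h -> time_test t0 eta ->
      \int[lebesgue_measure]_(t in `[0, t0]) (F t h * derive1 eta t) =
      - \int[lebesgue_measure]_(t in `[0, t0]) (G t h * eta t)]].

(* squared norm of H^1([0, t0], H^(-s)); as above, the infimum is over the
   almost everywhere unique weak derivative, and is +oo if there is none. *)
Definition H1t_dual_sqnorm (s t0 : R) (u : R -> 'rV[R]_d -> R) : \bar R :=
  (L2t_sqnorm (dual_norm s) t0 (fun t => pairing (u t)) +
   ereal_inf [set L2t_sqnorm (dual_norm s) t0 G
             | G in weak_dt s t0 (fun t => pairing (u t))])%E.

(* classical solutions on [0, T]: continuous on [0, T] x R^d, and of class
   C^{1,2} on ]0, T[ x R^d where the equation holds pointwise *)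
Record McKean_Vlasov_solution (T : R) W phi (rho : R -> 'rV[R]_d -> R) : Prop :=
  McKeanVlasovSolution {
  mv_density : forall t, 0 <= t <= T -> prob_density (rho t) ;
  mv_continuous : {within [set p : R * 'rV[R]_d | 0 <= p.1 <= T],
    continuous (fun p => rho p.1 p.2)} ;
  mv_derivable_t : forall t x, 0 < t < T -> derivable (rho ^~ x) t 1 ;
  mv_derivable_x : forall t x i, 0 < t < T ->
    derivable (rho t) x (unit_row i) ;
  mv_derivable_xx : forall t x i j, 0 < t < T ->
    derivable (partial i (rho t)) x (unit_row j) ;
  mv_continuous_t : forall t x, 0 < t < T ->
    {for (t, x), continuous (fun p : R * 'rV[R]_d =>
      derive1 (rho ^~ p.2) p.1)} ;
  mv_continuous_x : forall t x i, 0 < t < T ->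
    {for (t, x), continuous (fun p : R * 'rV[R]_d =>
      partial i (rho p.1) p.2)} ;
  mv_continuous_xx : forall t x i j, 0 < t < T ->
    {for (t, x), continuous (fun p : R * 'rV[R]_d =>
      partial j (partial i (rho p.1)) p.2)} ;
  mv_equation : forall t x, 0 < t < T ->
    derive1 (rho ^~ x) t = \sum_i partial i (partial i (rho t)) x +
      \sum_i partial i
        (fun y => rho t y * partial i (convolution W (rho t)) y) x ;
  mv_initial : forall x, rho 0 x = phi x }.

End torus.

(* Main.v *)
(* Put g(t) = (W - W0) * rho_W0(t).  The difference u = rho_W - rho_W0 solves
   du/dt = Lap u + div (u grad (W * rho_W) + rho_W0 grad (W * u) + rho_W0 grad g),
   so testing with g and using rho_W0 >= phi_min / 2 on a short time interval
   bounds |grad g|_2^2 by a multiple of |du/dt|_{H^-1}^2 + |u|_{H^1}^2.  On the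
   Fourier side |grad g|_2^2 dominates |k|^2 |(W - W0)^(k)|^2 |rho_W0(t)^(k)|^2
   summed over 0 < |k| <= K.  For t <= t0 the coefficients of rho_W0(t) have moved
   by at most C t0 <= c K^(-zeta) / 2 (up to constants) away from those of phi,
   hence are still at least of order c K^(-zeta); integrating over [0, t0]
   controls the frequencies |k| <= K of W - W0.  The frequencies |k| > K are those
   of W0, and are bounded by its H^(alpha + 1) norm.

   Everything is done with real cosine and sine coefficients of continuous periodic
   functions: trigonometric polynomials are dense by convolution with Fejer-type
   kernels, and the functionals in H^-1 are only evaluated on trigonometric
   polynomials, where they are identified with du/dt for almost every t by the
   fundamental lemma of the calculus of variations. *)
Require Import Defs.
From HB Require Import structures.
From mathcomp Require Import all_boot all_order all_algebra.
From mathcomp Require Import finmap complex ring lra zify.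
From mathcomp Require Import all_classical all_reals all_analysis.
From mathcomp Require Import measurable_realfun ess_sup_inf.
Set Implicit Arguments.
Unset Strict Implicit.
Unset Printing Implicit Defensive.
Import Order.TTheory GRing.Theory Num.Theory.
Import numFieldNormedType.Exports.
Local Open Scope classical_set_scope.
Local Open Scope ring_scope.

(** * Periodic functions and their integrals *)

Section torus_basics.
Context {R : realType} {d : nat}.
Implicit Types (f g : 'rV[R]_d -> R) (x y : 'rV[R]_d) (i : 'I_d).

(** Little regularity is available near time 0: a solution is of class C^{1,2} only at positive
    times and merely continuous up to time 0, and no pointwise derivative of [phi] is at hand.
    Energy estimates starting from time 0 are therefore run against trigonometric projections of
    [phi], whose gradients are bounded through the coefficients of [phi], uniformly in the
    projection.

    The delicate point is that coefficients move by C t with C free of K. The Laplacian multiplies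
    the k-th coefficient of rho - phi by |k|^2, while the L^2 norm of rho - phi is only of order
    sqrt t; the product is bounded when K^4 t0 is, and this follows from zeta > beta >= 4. The
    potential enters through W * rho alone: since rho has mass one, the derivatives of the drift are
    bounded by M whatever K is.

    All smallness conditions on t0 come from the single bound t0 <= c / (2 C) K^(-zeta), because C
    is taken larger than c times the sum of the reciprocals of the required thresholds. *)

Definition int_row (k : 'rV[int]_d) : 'rV[R]_d := \row_i (k 0 i)%:~R.

Lemma periodic_int_row f : torus_periodic f ->
  forall k x, f (x + int_row k) = f x.
Proof.
move=> pf k x.
have pn (n : nat) i z : f (z + n%:R *: unit_row i) = f z.
  elim: n z => [|n IH] z; first by rewrite scale0r addr0.
  by rewrite -natr1 scalerDl scale1r addrA pf IH.
have pz (m : int) i z : f (z + m%:~R *: unit_row i) = f z.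
  case: m => n; first exact: pn.
  by rewrite NegzE mulrNz scaleNr -[LHS](pn n.+1 i) addrNK.
have -> : int_row k = \sum_i (k 0 i)%:~R *: unit_row i.
  apply/rowP => j; rewrite !mxE summxE (bigD1 j)//= big1 ?addr0.
    by rewrite !mxE !eqxx/= mulr1.
  by move=> i /negbTE ij; rewrite !mxE eq_sym ij andbF mulr0.
elim: (index_enum _) x => [|i s IH] x; first by rewrite big_nil addr0.
by rewrite big_cons addrA IH pz.
Qed.

Definition wrap x : 'rV[R]_d := \row_i (x 0 i - (Num.floor (x 0 i))%:~R).

Lemma periodic_wrap f x : torus_periodic f -> f (wrap x) = f x.
Proof.
move=> pf; rewrite -(periodic_int_row pf (\row_i Num.floor (x 0 i)) (wrap x)).
by congr f; apply/rowP => i; rewrite !mxE subrK.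
Qed.

Definition cube : set 'rV[R]_d := [set x | forall i, `[0, 1]%classic (x ord0 i)].

Lemma cube_compact : compact cube.
Proof. by apply: (@rV_compact _ _ (fun=> `[(0:R), 1]%classic)) => i; exact: segment_compact. Qed.

Lemma wrap_cube x : cube (wrap x).
Proof.
move=> i /=; rewrite in_itv/= mxE; apply/andP; split.
  by rewrite subr_ge0 ge_floor.
by have := floorD1_gt (x 0 i); rewrite intrD lerBlDr addrC => /ltW.
Qed.

(** Compactness of the cube upgrades joint local convergence to uniform convergence, and [wrap]
    carries it to the whole space. The filter is arbitrary so that the result serves translations,
    interior times and times restricted to [0, T]. *)
Lemma tube (T : Type) (FF : set_system T) (F : T -> 'rV[R]_d -> R) f :
  Filter FF -> continuous f -> torus_periodic f -> (\forall s \near FF, torus_periodic (F s)) ->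
  (forall x (e : R), 0 < e -> \forall y \near x & s \near FF, `|F s y - f x| < e) ->
  forall e : R, 0 < e -> \forall s \near FF, forall x, `|F s x - f x| < e.
Proof.
move=> FFF cf pf pF H e e0.
have := (iffLR (compact_near_coveringP cube) cube_compact) _ FF
  (fun s x => `|F s x - f x| < e) FFF.
have e2 : 0 < e / 2 by rewrite divr_gt0.
case/(_ _)/Wrap => [x _|].
  have H1 : \forall y \near x & s \near FF, `|F s y - f x| < e / 2 by exact: H.
  have /cvgrPdist_lt/(_ _ e2) H2 := cf x.
  have H3 : \forall y \near x & s \near FF, `|f x - f y| < e / 2.
    by exists ([set y | `|f x - f y| < e / 2], setT); [split => //; exact: filterT|case=> y s []].
  apply: filterS2 H1 H3 => -[y s] /= h1 h2.
  rewrite (_ : _ - _ = (F s y - f x) + (f x - f y)); last by ring.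
  by apply: le_lt_trans (ler_normD _ _) _; lra.
move=> K; apply: filterS2 K pF => s K pF x.
by rewrite -(periodic_wrap x pF) -(periodic_wrap x pf); apply: K; exact: wrap_cube.
Qed.

Lemma near_row x (e : R) : 0 < e ->
  nbhs x [set y : 'rV[R]_d | forall i, `|x 0 i - y 0 i| < e].
Proof.
move=> e0; exists (fun a b => ball (x a b) e) => [a b|y /= H i].
  exact: nbhsx_ballx.
by have := H 0 i.
Qed.

Lemma tube_at (F : R -> 'rV[R]_d -> R) (t : R) :
  (\forall s \near t, torus_periodic (F s)) ->
  (forall x, {for (t, x), continuous (fun p : R * 'rV[R]_d => F p.1 p.2)}) ->
  forall e : R, 0 < e -> \forall s \near t, forall x, `|F s x - F t x| < e.
Proof.
move=> pF cF; apply: (@tube _ (nbhs t) F (F t)) => //.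
- move=> x; apply: (@continuous_comp _ _ _ (fun y => (t, y)) (fun p : R * 'rV[R]_d => F p.1 p.2)).
    move=> A [[P Q] [/= Pt Qx] sPQ]; apply: filterS Qx => y Qy; apply: sPQ.
    by split => //; exact: nbhs_singleton Pt.
  exact: cF.
- exact: nbhs_singleton pF.
- move=> x e e0; have /cvgrPdist_lt/(_ _ e0) [[A B] [/= At Bx] sAB] := cF x.
  exists (B, A) => //= -[y s] [/= By As].
  by rewrite distrC; exact: (sAB (s, y)).
Qed.

End torus_basics.

Section torus_integral.
Context {R : realType} {d : nat}.
Implicit Types (f g : 'rV[R]_d -> R) (x y : 'rV[R]_d) (i : 'I_d).
Local Notation mu := (torus_measure R d).

(** The sigma-algebra is generated by the coordinates, so continuity has to be linked to it: f is
    the pointwise limit of its samples at the lower corners of the grid of mesh 1/(n+1), and each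
    sampled function is constant on countably many boxes. *)
Lemma continuous_row_measurable f : continuous f -> measurable_fun setT f.
Proof.
move=> cf.
pose r (n : nat) (x : 'rV[R]_d) : 'rV[int]_d := \row_i Num.floor (n.+1%:R * x 0 i).
pose q (n : nat) (k : 'rV[int]_d) : 'rV[R]_d := \row_i ((k 0 i)%:~R / n.+1%:R).
apply: (@measurable_realfun.measurable_fun_cvg _ _ _ setT (fun n x => f (q n (r n x)))).
  move=> n _ Y mY; rewrite setTI.
  rewrite (_ : _ @^-1` _ =
    \bigcup_(k : 'rV[int]_d) ([set x | r n x = k] `&` [set x | Y (f (q n k))])); last first.
    apply/seteqP; split=> [x /= Yx|x [k _ [/= <-//]]].
    by exists (r n x).
  apply: countable_bigcupT_measurable; first exact: countableP.
  move=> k; apply: measurableI; last first.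
    have [h|h] := pselect (Y (f (q n k))).
      by rewrite (_ : [set _ | _] = setT)//; apply/seteqP; split.
    by rewrite (_ : [set _ | _] = set0)//; apply/seteqP; split.
  rewrite (_ : [set x | r n x = k] =
    \bigcap_(i : 'I_d) (row_coord i @^-1` [set t : R | Num.floor (n.+1%:R * t) = k 0 i])); last first.
    apply/seteqP; split => [x /= <-|x].
      by move=> i _ /=; rewrite mxE.
    move=> H; apply/rowP => i; rewrite mxE; exact: (H i).
  apply: fin_bigcap_measurable => // i _.
  rewrite -[X in measurable X]setTI; apply: measurable_row_coord => //.
  rewrite (_ : [set _ | _] = `[(k 0 i)%:~R / n.+1%:R, (k 0 i + 1)%:~R / n.+1%:R[%classic).
    exact: measurable_itv.
  apply/seteqP; split => t /=; rewrite in_itv/= ler_pdivrMr// ltr_pdivlMr// [t * _]mulrC.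
    by move=> <-; rewrite ge_floor floorD1_gt.
  by move/floor_def.
move=> x _; apply/cvgrPdist_lt => e e0.
have /cvgrPdist_lt/(_ _ e0) := cf x.
move=> [P Px sP].
have H : \forall n \near \oo, forall i, P 0 i (q n (r n x) 0 i).
  apply: filter_forall => i.
  have /nbhs_ballP[d' /= d0 sd] := Px 0 i.
  near=> n; apply: sd; rewrite /ball/= !mxE.
  have n0 : (0 : R) < n.+1%:R by [].
  have := ge_floor (n.+1%:R * x 0 i); have := floorD1_gt (n.+1%:R * x 0 i).
  rewrite intrD; set k := (Num.floor _)%:~R => h1 h2.
  have h3 : x 0 i - k / n.+1%:R = (n.+1%:R * x 0 i - k) / n.+1%:R by field.
  rewrite h3 ger0_norm ?divr_ge0 ?subr_ge0// ltr_pdivrMr//.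
  have h4 : 1 < d' * n.+1%:R.
    rewrite -ltr_pdivrMr// div1r.
    by near: n; exact: near_infty_natSinv_lt (PosNum d0).
  by move: h1 h2 h4; set a := n.+1%:R * x 0 i; set b := d' * _; lra.
by apply: filterS H => n H; apply: sP => a b; rewrite [a]ord1; exact: H.
Unshelve. all: by end_near. Qed.

(** The working class of functions: boundedness comes from compactness of the cube, so membership
    alone gives integrability. *)
Definition cper f := torus_periodic f /\ continuous f.

Lemma cper_bounded f : cper f -> exists2 B, 0 < B & forall x, `|f x| <= B.
Proof.
move=> [pf cf].
have cK : compact (f @` cube).
  by apply: continuous_compact; [exact: continuous_subspaceT|exact: cube_compact].
have [B [_ HB]] := compact_bounded cK.
exists (`|B| + 1); first by rewrite ltr_wpDl.
move=> x; rewrite -(periodic_wrap x pf); apply: (HB (`|B| + 1)).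
  by rewrite ltr_pwDr// ler_norm.
by exists (wrap x) => //; exact: wrap_cube.
Qed.

Lemma cper_integrable f : cper f -> mu.-integrable setT (EFin \o f).
Proof.
move=> cf; apply: measurable_bounded_integrable => //.
- by rewrite (le_lt_trans (probability_le1 _ _))// ltry.
- exact: continuous_row_measurable cf.2.
- have [B _ HB] := cper_bounded cf.
  exists B; split; first exact: num_real.
  by move=> M BM x _; exact: le_trans (HB x) (ltW BM).
Qed.

Lemma cper_cst (c : R) : cper (fun=> c).
Proof. by split => // x; exact: cst_continuous. Qed.
Lemma cperD f g : cper f -> cper g -> cper (fun x => f x + g x).
Proof.
move=> [pf cf] [pg cg]; split=> [x i|x]; first by rewrite pf pg.
by apply: continuousD; [exact: cf|exact: cg].
Qed.
Lemma cperM f g : cper f -> cper g -> cper (fun x => f x * g x).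
Proof.
move=> [pf cf] [pg cg]; split=> [x i|x]; first by rewrite pf pg.
by apply: continuousM; [exact: cf|exact: cg].
Qed.
Lemma cperN f : cper f -> cper (fun x => - f x).
Proof.
move=> [pf cf]; split=> [x i|x]; first by rewrite pf.
by apply: continuousN; exact: cf.
Qed.
Lemma cperB f g : cper f -> cper g -> cper (fun x => f x - g x).
Proof. by move=> cf cg; exact: cperD cf (cperN cg). Qed.
Lemma cperZ (c : R) f : cper f -> cper (fun x => c * f x).
Proof. by move=> cf; exact: cperM (cper_cst c) cf. Qed.
Lemma cperX (n : nat) f : cper f -> cper (fun x => f x ^+ n).
Proof.
move=> cf; elim: n => [|n IH]; first exact: cper_cst.
by rewrite (_ : (fun _ => _) = (fun x => f x * f x ^+ n));
  [exact: cperM|apply/funext => x; rewrite exprS].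
Qed.
Lemma cper_norm f : cper f -> cper (fun x => `|f x|).
Proof.
move=> [pf cf]; split=> [x i|x]; first by rewrite pf.
by apply: (@continuous_comp _ _ _ f (fun t => `|t|)); [exact: cf|exact: norm_continuous].
Qed.
Lemma cper_sum (J : Type) (s : seq J) (F : J -> 'rV[R]_d -> R) :
  (forall j, cper (F j)) -> cper (fun x => \sum_(j <- s) F j x).
Proof.
move=> cF; elim: s => [|j s IH].
  by under eq_fun do rewrite big_nil; exact: cper_cst.
by under eq_fun do rewrite big_cons; exact: cperD.
Qed.
Lemma cper_shift a f : cper f -> cper (fun x => f (x + a)).
Proof.
move=> [pf cf]; split=> [x i|x]; first by rewrite addrAC pf.
apply: (@continuous_comp _ _ _ (fun x => x + a) f); last exact: cf.
by apply: (@continuousD R _ _ (fun x => x) (fun=> a) x (@cvg_id _ _) (@cst_continuous _ _ a x)).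
Qed.
Lemma cper_reflect a f : cper f -> cper (fun x => f (a - x)).
Proof.
move=> [pf cf]; split=> [x i|x].
  by rewrite -(pf _ i) opprD addrA subrK.
apply: (@continuous_comp _ _ _ (fun x => a - x) f); last exact: cf.
by apply: (@continuousB R _ _ (fun=> a) (fun x => x) x (@cst_continuous _ _ a x) (@cvg_id _ _)).
Qed.

Definition tint f : R := \int[mu]_x f x.

Lemma tintD f g : cper f -> cper g ->
  tint (fun x => f x + g x) = tint f + tint g.
Proof. by move=> cf cg; apply: RintegralD => //; exact: cper_integrable. Qed.
Lemma tintB f g : cper f -> cper g ->
  tint (fun x => f x - g x) = tint f - tint g.
Proof. by move=> cf cg; apply: RintegralB => //; exact: cper_integrable. Qed.
Lemma tintZ (c : R) f : cper f -> tint (fun x => c * f x) = c * tint f.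
Proof. by move=> cf; apply: RintegralZl => //; exact: cper_integrable. Qed.
Lemma tintN f : cper f -> tint (fun x => - f x) = - tint f.
Proof.
move=> cf; rewrite -mulN1r -tintZ//; congr tint.
by apply/funext => x; rewrite mulN1r.
Qed.
Lemma tint_cst (c : R) : tint (fun=> c) = c.
Proof. by rewrite /tint Rintegral_cst//; have /= -> := probability_setT mu; rewrite mulr1. Qed.
Lemma tint_sum (J : Type) (s : seq J) (F : J -> 'rV[R]_d -> R) :
  (forall j, cper (F j)) ->
  tint (fun x => \sum_(j <- s) F j x) = \sum_(j <- s) tint (F j).
Proof.
move=> cF; elim: s => [|j s IH].
  by rewrite big_nil; under [X in tint X]eq_fun do rewrite big_nil; exact: tint_cst.
rewrite big_cons -IH -tintD//; last exact: cper_sum.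
by under [X in tint X]eq_fun do rewrite big_cons.
Qed.
Lemma tint_le f g : cper f -> cper g -> (forall x, f x <= g x) ->
  tint f <= tint g.
Proof. by move=> cf cg fg; apply: le_Rintegral => //; exact: cper_integrable. Qed.
Lemma tint_ge0 f : (forall x, 0 <= f x) -> 0 <= tint f.
Proof. by move=> f0; apply: Rintegral_ge0 => x _; exact: f0. Qed.
Lemma tint_norm f : cper f -> `|tint f| <= tint (fun x => `|f x|).
Proof. by move=> cf; apply: le_normr_Rintegral => //; exact: cper_integrable. Qed.
Lemma tint_bound f (B : R) : cper f -> (forall x, `|f x| <= B) -> `|tint f| <= B.
Proof.
move=> cf fB; apply: le_trans (tint_norm cf) _; rewrite -[leRHS]tint_cst.
by apply: tint_le => //; [exact: cper_norm|exact: cper_cst].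
Qed.
Lemma eq_tint f g : f =1 g -> tint f = tint g.
Proof. by move=> fg; congr tint; exact/funext. Qed.
Lemma tint0 : tint (fun=> 0) = 0. Proof. exact: tint_cst. Qed.
End torus_integral.

(** * Differentiation under the integral and integration by parts *)

Section torus_derive.
Context {R : realType} {d : nat}.
Implicit Types (f g : 'rV[R]_d -> R) (x y : 'rV[R]_d) (i : 'I_d).
Local Notation mu := (torus_measure R d).

Definition line x i (s : R) : 'rV[R]_d := s *: unit_row i + x.

Lemma line_partial f i x s :
  derivable f (line x i s) (unit_row i) ->
  is_derive s 1 (fun s => f (line x i s)) (partial i f (line x i s)).
Proof.
move=> df; have E : (fun h : R => h^-1 *: (f (line x i (h *: (1:R) + s)) - f (line x i s))) =
   (fun h : R => h^-1 *: (f (h *: unit_row i + line x i s) - f (line x i s))).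
  apply/funext => h; congr (_ *: (f _ - _)).
  by rewrite /line scalerDl [_%:A]mulr1 addrA.
split; first by rewrite /derivable E; exact: df.
by rewrite /partial /derive E.
Qed.

Lemma derivable_line f i x (df : R) :
  is_derive (0 : R) 1 (fun s : R => f (line x i s)) df ->
  derivable f x (unit_row i) /\ partial i f x = df.
Proof.
move=> [].
have E : (fun h : R => h^-1 *: (f (line x i (h *: (1:R) + 0)) - f (line x i 0))) =
   (fun h : R => h^-1 *: (f (h *: unit_row i + x) - f x)).
  by apply/funext => h; rewrite /line !addr0 [_%:A]mulr1 scale0r add0r.
by rewrite /partial /derivable /derive E.
Qed.

Lemma line0 x i : line x i 0 = x.
Proof. by rewrite /line scale0r add0r. Qed.

Lemma partial_is_derive f i x : derivable f x (unit_row i) ->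
  is_derive (0 : R) 1 (fun s : R => f (line x i s)) (partial i f x).
Proof.
by move=> df; rewrite -{2}(line0 x i); apply: line_partial; rewrite line0.
Qed.

Lemma tint_cvg (T : Type) (FF : set_system T) (F : T -> 'rV[R]_d -> R) f :
  Filter FF -> cper f -> (\forall s \near FF, cper (F s)) ->
  (forall e : R, 0 < e -> \forall s \near FF, forall x, `|F s x - f x| < e) ->
  tint (F s) @[s --> FF] --> tint f.
Proof.
move=> FFF cf cF H; apply/cvgrPdist_le => e e0.
apply: filterS2 cF (H _ e0) => s cs hs.
rewrite distrC -tintB//; apply: tint_bound => [|x]; first exact: cperB.
exact: ltW.
Qed.

(** Continuity of [dF] is required on the slice s = t only: the tube lemma turns it into a bound B +
    1 of [dF], uniform in x for s near t, which is the dominating function. *)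
Lemma tint_derive (F dF : R -> 'rV[R]_d -> R) (t r : R) : 0 < r ->
  (forall s, `|t - s| < r -> cper (F s)) ->
  (forall s x, `|t - s| < r -> is_derive s 1 (F ^~ x) (dF s x)) ->
  (forall x, {for (t, x), continuous (fun p : R * 'rV[R]_d => dF p.1 p.2)}) ->
  is_derive t 1 (fun s => tint (F s)) (tint (dF t)).
Proof.
move=> r0 cF hF cdF.
have pdF s : `|t - s| < r -> torus_periodic (dF s).
  move=> sr x i; have [_ <-] := hF s (x + unit_row i) sr; have [_ <-] := hF s x sr.
  apply: near_eq_derive.
  have : \forall z \near s, `|t - z| < r.
    have : nbhs s (ball t r).
      by apply: open_nbhs_nbhs; split; [exact: ball_open|exact: sr].
    by [].
  by apply: filterS => z zr; have [] := cF z zr.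
have ct : cper (dF t).
  split; first by apply: pdF; rewrite subrr normr0.
  move=> x; apply: (@continuous_comp _ _ _ (fun y => (t, y)) (fun p : R * 'rV[R]_d => dF p.1 p.2)).
    move=> A [[P Q] [/= Pt Qx] sPQ]; apply: filterS Qx => y Qy; apply: sPQ.
    by split => //; exact: nbhs_singleton Pt.
  exact: cdF.
have [B B0 HB] := cper_bounded ct.
have [r1 r10 Hr1] : exists2 r1 : R, 0 < r1 <= r &
    forall s x, `|t - s| < r1 -> `|dF s x| <= B + 1.
  have /nbhs_ballP [r1 /= r10 H] : \forall s \near t, forall x, `|dF s x - dF t x| < 1.
    apply: tube_at => //; apply/nbhs_ballP; exists r => //= s; exact: pdF.
  exists (Num.min r r1); first by rewrite lt_min r0 r10 ge_min lexx.
  move=> s x; rewrite lt_min => /andP[_ /H/(_ x) h].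
  rewrite -[dF s x](subrK (dF t x)); apply: le_trans (ler_normD _ _) _.
  by rewrite addrC lerD// ltW.
have It : `]t - r1, t + r1[%classic t.
  by rewrite /= in_itv/= ltrBlDr ltrDl; case/andP: r10 => -> _.
have HI s : `]t - r1, t + r1[%classic s -> `|t - s| < r1.
  by rewrite /= in_itv/= => /andP[h1 h2]; rewrite ltr_norml; apply/andP; split; lra.
have HI' s : `]t - r1, t + r1[%classic s -> `|t - s| < r.
  by move/HI/lt_le_trans; apply; case/andP: r10.
have D1 s x : `]t - r1, t + r1[%classic s -> partial1of2 F s x = dF s x.
  by move=> Is; rewrite partial1of2E; have [_] := hF s x (HI' _ Is).
have A2 s : `]t - r1, t + r1[%classic s -> mu.-integrable setT (EFin \o F s).
  by move=> Is; apply: cper_integrable; apply: cF; exact: HI'.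
have A3 s x : `]t - r1, t + r1[%classic s -> setT x -> derivable (F ^~ x) s 1.
  by move=> Is _; have [] := hF s x (HI' _ Is).
have A4 x : 0 <= (fun _ : 'rV[R]_d => B + 1) x by rewrite addr_ge0 ?ler01 ?ltW.
have A5 : mu.-integrable setT (EFin \o (fun _ : 'rV[R]_d => B + 1)).
  by apply: cper_integrable; exact: cper_cst.
have A6 s x : `]t - r1, t + r1[%classic s -> setT x -> `|partial1of2 F s x| <= B + 1.
  by move=> Is _; rewrite D1//; apply: Hr1; exact: HI.
split; first exact: (derivable_under_integral measurableT It A2 A3 A4 A5 A6).
rewrite -derive1E (differentiation_under_integral measurableT It A2 A3 A4 A5 A6).
by apply: eq_Rintegral => x _; exact: D1.
Qed.

End torus_derive.

Lemma FTC_R {R : realType} (F f : R -> R) (a b : R) : a < b ->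
  (forall s, a <= s <= b -> is_derive s 1 F (f s)) ->
  {within `[a, b], continuous f} ->
  (\int[lebesgue_measure]_(s in `[a, b]) (f s)%:E = (F b - F a)%:E)%E.
Proof.
move=> ab dF cf; rewrite EFinB.
have cF s : a <= s <= b -> {for s, continuous F}.
  move=> sab; apply: differentiable_continuous; apply/derivable1_diffP.
  by have [] := dF s sab.
apply: continuous_FTC2 => //.
- split.
  + move=> s; rewrite in_itv/= => /andP[s1 s2].
    by have [] := dF s; rewrite ?(ltW s1) ?(ltW s2).
  + by apply: cvg_at_right_filter; apply: cF; rewrite lexx ltW.
  + by apply: cvg_at_left_filter; apply: cF; rewrite lexx ltW.
- move=> s; rewrite in_itv/= => /andP[s1 s2]; rewrite derive1E.
  by have /dF[_ ->] : a <= s <= b by rewrite !ltW.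
Qed.

Section tint_partial.
Context {R : realType}.

Lemma integral_uniform01 (g : R -> R) (B : R) :
  measurable_fun setT g -> (forall x, `|g x| <= B) ->
  (\int[uniform_prob (@ltr01 R)]_x (g x)%:E =
   \int[lebesgue_measure]_(x in `[0%R, 1%R]) (g x)%:E)%E.
Proof.
move=> mg gB.
have /measurable_EFinP mg' := mg.
rewrite integralE [RHS]integralE !integral_uniform//.
- by rewrite subr0 invr1 !mul1e.
- exact: measurable_funeneg.
- exact: measurable_funepos.
Qed.

Lemma row_cons_add (m : nat) (t s : R) (y z : 'rV[R]_m) :
  row_cons (t, y) + row_cons (s, z) = row_cons (t + s, y + z).
Proof.
apply: etrans (add_row_mx (const_mx t : 'rV[R]_1) y (const_mx s) z) _.
by congr row_mx; apply/rowP => j; rewrite !mxE.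
Qed.

Lemma row_cons_scale (m : nat) (a t : R) (y : 'rV[R]_m) :
  a *: row_cons (t, y) = row_cons (a * t, a *: y).
Proof.
apply: etrans (scale_row_mx a (const_mx t : 'rV[R]_1) y) _.
by congr row_mx; apply/rowP => j; rewrite !mxE.
Qed.

Lemma unit_row_lift (m : nat) (i : 'I_m) :
  unit_row (rshift 1 i) = row_cons (0 : R, unit_row i).
Proof.
apply/rowP => j; rewrite /row_cons /unit_row !mxE eqxx /=.
case: splitP => [a|a] ja; rewrite !mxE ?ja.
  by case: eqP => // /(congr1 val) /=; rewrite ja (ord1 a).
by congr (_%:R); rewrite -(inj_eq val_inj)/= ja eqn_add2l.
Qed.

Lemma unit_row_first (m : nat) :
  unit_row (lshift m (@ord0 0)) = row_cons (1 : R, (0 : 'rV[R]_m)).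
Proof.
apply/rowP => j; rewrite /row_cons /unit_row !mxE eqxx /=.
case: splitP => [a|a] ja; rewrite !mxE.
  by rewrite -(inj_eq val_inj)/= ja (ord1 a).
by rewrite -(inj_eq val_inj)/= ja.
Qed.

Lemma row_consl (m : nat) (t : R) (y : 'rV[R]_m) (j : 'I_1) :
  row_cons (t, y) 0 (lshift m j) = t.
Proof. by apply: etrans (row_mxEl (const_mx t : 'rV[R]_1) y 0 j) _; rewrite mxE. Qed.

Lemma row_consr (m : nat) (t : R) (y : 'rV[R]_m) (j : 'I_m) :
  row_cons (t, y) 0 (rshift 1 j) = y 0 j.
Proof. exact: row_mxEr (const_mx t : 'rV[R]_1) y 0 j. Qed.

Lemma row_cons_continuous2 (m : nat) (t : R) : continuous (fun y : 'rV[R]_m => row_cons (t, y)).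
Proof.
move=> y A [P Py sPA].
exists (fun a b => P 0 (rshift 1 b)).
  by move=> a b; have := Py 0 (rshift 1 b); rewrite row_consr (ord1 a).
move=> z /= H; apply: sPA => a b; rewrite (ord1 a).
have [j ->|j ->] := @split_ordP 1 m b.
  by rewrite row_consl -[t](row_consl t y j); apply: nbhs_singleton; exact: Py.
by rewrite row_consr; exact: H.
Qed.

(** Induction on d along the recursive product measure. A derivative in one of the last coordinates
    is killed by the induction hypothesis on each slice; for the first coordinate, Fubini integrates
    that coordinate first, and the fundamental theorem of calculus leaves a difference that vanishes
    by periodicity. *)
Lemma tint_partial (d : nat) (i : 'I_d) (f : 'rV[R]_d -> R) :
  cper f -> (forall x, derivable f x (unit_row i)) -> cper (partial i f) ->
  tint (partial i f) = 0.
Proof.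
elim: d i f => [[]//|m IH] i f cf df cdf.
have mrc := @measurable_row_cons R m.
pose mu2 := (uniform_prob (@ltr01 R) \x torus_measure R m)%E.
have [B _ HB] := cper_bounded cdf.
have mdf : measurable_fun setT (EFin \o partial i f).
  by apply/measurable_EFinP; exact: continuous_row_measurable cdf.2.
have mdf2 : measurable_fun setT ((EFin \o partial i f) \o @row_cons R m).
  exact: measurableT_comp.
have int2 : mu2.-integrable setT ((EFin \o partial i f) \o @row_cons R m).
  apply: (@measurable_bounded_integrable _ _ _ _ (partial i f \o @row_cons R m)) => //.
  - by rewrite (le_lt_trans (probability_le1 _ _))// ltry.
  - exact/measurable_EFinP.
  - exists B; split; first exact: num_real.
    by move=> M BM x _; exact: le_trans (HB _) (ltW BM).
rewrite /tint /Rintegral /= integral_distribution//.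
have cfs (g : 'rV[R]_m.+1 -> R) t : cper g -> cper (fun y => g (row_cons (t, y))).
  move=> [pg cg]; split.
    move=> y j /=; rewrite -(pg (row_cons (t, y)) (rshift 1 j)).
    by rewrite unit_row_lift row_cons_add addr0.
  by move=> y; apply: continuous_comp; [exact: row_cons_continuous2|exact: cg].
have [j ij|j ij] := @split_ordP 1 m i; rewrite ij in df cdf HB mdf mdf2 int2 *; last first.
  rewrite -integral12_prod_meas1// integral0_eq//= => t _.
  have E y : partial (rshift 1 j) f (row_cons (t, y)) =
      partial j (fun y => f (row_cons (t, y))) y /\
      derivable (fun y => f (row_cons (t, y))) y (unit_row j).
    have H := partial_is_derive (df (row_cons (t, y))).
    have [] // := @derivable_line _ _ (fun y => f (row_cons (t, y))) j y (partial (rshift 1 j) f (row_cons (t, y))).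
    congr (is_derive _ _ _ _) : H; apply/funext => s; congr f.
    by rewrite /line unit_row_lift row_cons_scale row_cons_add mulr0 add0r.
  have cpj : cper (partial j (fun y => f (row_cons (t, y)))).
    rewrite (_ : partial _ _ = (fun y => partial (rshift 1 j) f (row_cons (t, y)))).
      exact: cfs.
    by apply/funext => y; rewrite (E y).1.
  have H := IH j (fun y => f (row_cons (t, y))) (cfs _ t cf) (fun y => (E y).2) cpj.
  rewrite /fubini_F /=.
  under eq_integral do rewrite /= (E _).1.
  rewrite -[RHS](congr1 EFin H) /tint /Rintegral fineK//.
  by apply: integrable_fin_num => //; exact: (cper_integrable cpj).
rewrite -integral21_prod_meas1// integral0_eq//= => y _.
rewrite /fubini_G /=.
have cg : continuous (fun t : R => partial (lshift m j) f (row_cons (t, y))).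
  rewrite (_ : (fun t : R => _) = (fun t : R => partial (lshift m j) f (line (row_cons (0, y)) (lshift m j) t))); last first.
    apply/funext => t; congr partial.
    by rewrite /line (ord1 j) unit_row_first row_cons_scale row_cons_add mulr1 addr0 scaler0 add0r.
  move=> t; apply: (@continuous_comp _ _ _ (fun t => line _ _ t)); last exact: cdf.2.
  rewrite /line; apply: (@continuousD R _ _ (fun t : R => t *: _) (fun=> _) t); last exact: cst_continuous.
  exact: scalel_continuous.
rewrite (@integral_uniform01 _ B)//; last exact: continuous_measurable_fun.
apply: etrans (@FTC_R _ (fun t => f (row_cons (t, y))) (fun t => partial (lshift m j) f (row_cons (t, y))) 0 1 ltr01 _ _) _; last first.
- have <- := cf.1 (row_cons (0, y)) (lshift m j).
  by rewrite (ord1 j) unit_row_first row_cons_add add0r addr0 subrr.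
- exact: continuous_subspaceT.
- move=> t _.
  have E s : row_cons (s, y) = line (row_cons (0, y)) (lshift m j) s.
    by rewrite /line (ord1 j) unit_row_first row_cons_scale row_cons_add mulr1 addr0 scaler0 add0r.
  rewrite E (_ : (fun t : R => _) = (fun s => f (line (row_cons (0, y)) (lshift m j) s))).
    exact: line_partial.
  by apply/funext => s; rewrite E.
Qed.

End tint_partial.

Lemma is_derive_comp_R {R : realType} (f g : R -> R) (x df dg : R) :
  is_derive x 1 g dg -> is_derive (g x) 1 f df ->
  is_derive x 1 (fun s => f (g s)) (df * dg).
Proof. by move=> Dg Df; exact: is_derive1_comp. Qed.

Section C1_functions.
Context {R : realType} {d : nat}.
Implicit Types (f g : 'rV[R]_d -> R) (x y : 'rV[R]_d) (i : 'I_d).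

Definition C1 f := cper f /\
  forall i, (forall x, derivable f x (unit_row i)) /\ cper (partial i f).

Lemma partial_periodic f i : torus_periodic f -> torus_periodic (partial i f).
Proof.
move=> pf x j; rewrite /partial /derive.
suff -> : (fun h : R => h^-1 *: (f (h *: unit_row i + (x + unit_row j)) - f (x + unit_row j))) =
  (fun h : R => h^-1 *: (f (h *: unit_row i + x) - f x)) by [].
by apply/funext => h; rewrite /= addrA !pf.
Qed.

Lemma C1_of_derive f (df : 'I_d -> 'rV[R]_d -> R) : cper f ->
  (forall i, cper (df i)) ->
  (forall i x, is_derive x (unit_row i) f (df i x)) ->
  C1 f /\ forall i, partial i f = df i.
Proof.
move=> cf cdf H; have E i : partial i f = df i.
  by apply/funext => x; have [_ <-] := H i x.
by split=> //; split=> // i; split=> [x|]; [have [] := H i x|rewrite E].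
Qed.

Lemma C1_cper f : C1 f -> cper f. Proof. by case. Qed.

Lemma C1_is_derive f i x : C1 f -> is_derive x (unit_row i) f (partial i f x).
Proof. by move=> [_ /(_ i)[df _]]; split => //; exact: df. Qed.

Lemma C1_partial f i : C1 f -> cper (partial i f).
Proof. by move=> [_ /(_ i)[]]. Qed.

Lemma C1M f g : C1 f -> C1 g -> C1 (fun x => f x * g x) /\
  forall i, partial i (fun x => f x * g x) =
    fun x => partial i f x * g x + f x * partial i g x.
Proof.
move=> cf cg; apply: C1_of_derive.
- exact: cperM (C1_cper cf) (C1_cper cg).
- move=> i; apply: cperD; apply: cperM; first [exact: C1_partial|exact: C1_cper].
- move=> i x; apply: is_derive_eq.
    exact: is_deriveM (C1_is_derive i x cf) (C1_is_derive i x cg).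
  by rewrite addrC mulrC.
Qed.

Lemma C1D f g : C1 f -> C1 g -> C1 (fun x => f x + g x) /\
  forall i, partial i (fun x => f x + g x) = fun x => partial i f x + partial i g x.
Proof.
move=> cf cg; apply: C1_of_derive.
- exact: cperD (C1_cper cf) (C1_cper cg).
- move=> i; apply: cperD; exact: C1_partial.
- move=> i x; exact: is_deriveD (C1_is_derive i x cf) (C1_is_derive i x cg).
Qed.

Lemma C1_cst (c : R) : C1 (fun=> c) /\ forall i, partial i (fun=> c) = fun=> 0.
Proof. by apply: C1_of_derive => *; exact: cper_cst. Qed.

Lemma C1Z (c : R) f : C1 f -> C1 (fun x => c * f x) /\
  forall i, partial i (fun x => c * f x) = fun x => c * partial i f x.
Proof.
move=> cf; have [c0 p0] := C1_cst c; have [h p] := C1M c0 cf; split => // i.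
by rewrite p p0; apply/funext => x; rewrite mul0r add0r.
Qed.

Lemma C1B f g : C1 f -> C1 g -> C1 (fun x => f x - g x) /\
  forall i, partial i (fun x => f x - g x) = fun x => partial i f x - partial i g x.
Proof.
move=> cf cg; have [h p] := C1Z (-1) cg; have := C1D cf h.
by under [in X in X -> _]eq_fun do rewrite mulN1r; move=> [h1 p1]; split => // i;
  rewrite p1 p; apply/funext => x; rewrite mulN1r.
Qed.

Lemma C1_sum (J : Type) (s : seq J) (F : J -> 'rV[R]_d -> R) :
  (forall j, C1 (F j)) -> C1 (fun x => \sum_(j <- s) F j x) /\
  forall i, partial i (fun x => \sum_(j <- s) F j x) =
    fun x => \sum_(j <- s) partial i (F j) x.
Proof.
move=> cF; elim: s => [|j s [IH p]].
  have [h p0] := C1_cst 0.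
  under eq_fun do rewrite big_nil; split => // i; rewrite p0.
  by apply/funext => x; rewrite big_nil.
have [h p1] := C1D (cF j) IH.
under eq_fun do rewrite big_cons; split => // i; rewrite p1 p.
by apply/funext => x; rewrite big_cons.
Qed.

Lemma tint_by_parts i f g : C1 f -> C1 g ->
  tint (fun x => partial i f x * g x) = - tint (fun x => f x * partial i g x).
Proof.
move=> cf cg; have [cfg p] := C1M cf cg.
have := tint_partial (C1_cper cfg) (cfg.2 i).1 (cfg.2 i).2.
rewrite p tintD; first by move/eqP; rewrite addr_eq0 => /eqP.
  by apply: cperM; [exact: C1_partial|exact: C1_cper].
by apply: cperM; [exact: C1_cper|exact: C1_partial].
Qed.

End C1_functions.

(** * Trigonometric polynomials and Fourier series *)

Section trig.
Context {R : realType} {d : nat}.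
Implicit Types (f g : 'rV[R]_d -> R) (x y : 'rV[R]_d) (i : 'I_d) (k : 'rV[int]_d).

Definition cosk k x : R := cos (phase k x).
Definition sink k x : R := sin (phase k x).

Lemma phaseD k x y : phase k (x + y) = phase k x + phase k y.
Proof.
rewrite /phase -mulrDr -big_split/=; congr (_ * _).
by apply: eq_bigr => i _; rewrite !mxE mulrDr.
Qed.

Lemma phaseN k x : phase k (- x) = - phase k x.
Proof.
rewrite /phase -mulrN -sumrN; congr (_ * _).
by apply: eq_bigr => i _; rewrite !mxE mulrN.
Qed.

Lemma phaseZ k (a : R) x : phase k (a *: x) = a * phase k x.
Proof.
rewrite /phase mulrCA; congr (_ * _); rewrite mulr_sumr.
by apply: eq_bigr => i _; rewrite !mxE mulrCA.
Qed.

Lemma phase_unit k i : phase k (unit_row i) = 2 * pi * (k 0 i)%:~R :> R.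
Proof.
rewrite /phase; congr (_ * _); rewrite (bigD1 i)//= big1 ?addr0.
  by rewrite !mxE !eqxx mulr1.
by move=> j /negbTE ji; rewrite !mxE eqxx ji mulr0.
Qed.

Lemma phase_add k l x : phase (k + l) x = phase k x + phase l x.
Proof.
rewrite /phase -mulrDr -big_split/=; congr (_ * _).
by apply: eq_bigr => i _; rewrite !mxE intrD mulrDl.
Qed.

Lemma phase_opp k x : phase (- k) x = - phase k x.
Proof.
rewrite /phase -mulrN -sumrN; congr (_ * _).
by apply: eq_bigr => i _; rewrite !mxE mulrNz mulNr.
Qed.

Lemma phase0 x : phase 0 x = 0.
Proof. by rewrite /phase big1 ?mulr0// => i _; rewrite mxE mul0r. Qed.

Lemma cosk0 x : cosk 0 x = 1. Proof. by rewrite /cosk phase0 cos0. Qed.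
Lemma sink0 x : sink 0 x = 0. Proof. by rewrite /sink phase0 sin0. Qed.
Lemma coskN k x : cosk (- k) x = cosk k x.
Proof. by rewrite /cosk phase_opp cosN. Qed.
Lemma sinkN k x : sink (- k) x = - sink k x.
Proof. by rewrite /sink phase_opp sinN. Qed.

Lemma cosD2pin (a : R) (m : int) : cos (a + 2 * pi * m%:~R) = cos a.
Proof.
have E (n : nat) z : cos (z + 2 * pi * n%:R) = cos z :> R.
  have -> : 2 * pi * n%:R = (pi *+ 2) *+ n :> R by rewrite mulr_natl mulr_natr.
  by rewrite (periodicn (@cosD2pi R)).
case: m => n; first exact: E.
by rewrite NegzE mulrNz -[LHS](E n.+1) mulrN subrK.
Qed.
Lemma sinD2pin (a : R) (m : int) : sin (a + 2 * pi * m%:~R) = sin a.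
Proof.
have E (n : nat) z : sin (z + 2 * pi * n%:R) = sin z :> R.
  have -> : 2 * pi * n%:R = (pi *+ 2) *+ n :> R by rewrite mulr_natl mulr_natr.
  by rewrite (periodicn (@sinD2pi R)).
case: m => n; first exact: E.
by rewrite NegzE mulrNz -[LHS](E n.+1) mulrN subrK.
Qed.

Lemma phase_continuous k : continuous (@phase R d k).
Proof.
have H (s : seq 'I_d) : continuous (fun x : 'rV[R]_d => \sum_(i <- s) (k 0 i)%:~R * x 0 i).
  elim: s => [|i s IH].
    by under eq_fun do rewrite big_nil; exact: cst_continuous.
  under eq_fun do rewrite big_cons.
  move=> x; apply: (@continuousD R _ _ (fun x => (k 0 i)%:~R * x 0 i) _ x); last exact: IH.
  apply: (@continuousM R _ (fun=> (k 0 i)%:~R) (fun x => x 0 i) x).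
    exact: cst_continuous.
  exact: coord_continuous.
move=> x; apply: (@continuousM R _ (fun=> 2 * pi) _ x); last exact: H.
exact: cst_continuous.
Qed.

Lemma cper_cosk k : cper (cosk k).
Proof.
split=> [x i|x]; first by rewrite /cosk phaseD phase_unit cosD2pin.
apply: (@continuous_comp _ _ _ (phase k) cos); first exact: phase_continuous.
exact: continuous_cos.
Qed.
Lemma cper_sink k : cper (sink k).
Proof.
split=> [x i|x]; first by rewrite /sink phaseD phase_unit sinD2pin.
apply: (@continuous_comp _ _ _ (phase k) sin); first exact: phase_continuous.
exact: continuous_sin.
Qed.

Definition freq k i : R := 2 * pi * (k 0 i)%:~R.

Lemma freq_neq0 k i : k 0 i != 0 -> freq k i != 0.
Proof.
move=> ki; rewrite /freq mulf_neq0 ?intr_eq0// mulf_neq0//.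
by rewrite gt_eqF// pi_gt0.
Qed.

Lemma is_derive_phase_line k x i (s : R) :
  is_derive s 1 (fun s => phase k (line x i s)) (freq k i).
Proof.
rewrite (_ : (fun s => _) = (fun s => freq k i * s + phase k x)); last first.
  by apply/funext => t; rewrite /line phaseD phaseZ phase_unit mulrC.
apply: is_derive_eq.
by rewrite /= addr0 [_%:A]mulr1.
Qed.

Lemma C1_cosk k : C1 (cosk k) /\
  forall i, partial i (cosk k) = fun x => - freq k i * sink k x.
Proof.
apply: C1_of_derive => [|i|i x]; first exact: cper_cosk.
  by apply: cperZ; exact: cper_sink.
have := is_derive_comp_R (is_derive_phase_line k x i 0) (is_derive_cos _).
rewrite line0 => /(@derivable_line _ _ (cosk k)) [h1 h2]; split => //.
by rewrite -[LHS]/(partial i (cosk k) x) h2 mulNr mulrC mulNr.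
Qed.
Lemma C1_sink k : C1 (sink k) /\
  forall i, partial i (sink k) = fun x => freq k i * cosk k x.
Proof.
apply: C1_of_derive => [|i|i x]; first exact: cper_sink.
  by apply: cperZ; exact: cper_cosk.
have := is_derive_comp_R (is_derive_phase_line k x i 0) (is_derive_sin _).
rewrite line0 => /(@derivable_line _ _ (sink k)) [h1 h2]; split => //.
by rewrite -[LHS]/(partial i (sink k) x) h2 mulrC.
Qed.

(** For nonzero k the sine is a nonzero multiple of a partial derivative of the cosine, so
    [tint_partial] applies and no integral has to be evaluated. *)
Lemma tint_sink k : tint (sink k) = 0.
Proof.
have [->|k0] := eqVneq k 0.
  by rewrite -[RHS](@tint0 R d); apply: eq_tint => x; exact: sink0.
have [i ki] : exists i, k 0 i != 0.
  apply/existsP; apply: contraNT k0 => /existsPn H; apply/eqP/rowP => i.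
  by rewrite mxE; have := H i; rewrite negbK => /eqP.
have f0 := freq_neq0 ki.
have [h p] := C1_cosk k.
have := tint_partial (C1_cper h) (h.2 i).1 (h.2 i).2.
rewrite p tintZ; last exact: cper_sink.
by move/eqP; rewrite mulf_eq0 oppr_eq0 (negbTE f0) => /eqP.
Qed.
Lemma tint_cosk k : tint (cosk k) = (k == 0)%:R.
Proof.
have [->|k0] := eqVneq k 0.
  by rewrite -[RHS](@tint_cst R d); apply: eq_tint => x; exact: cosk0.
have [i ki] : exists i, k 0 i != 0.
  apply/existsP; apply: contraNT k0 => /existsPn H; apply/eqP/rowP => i.
  by rewrite mxE; have := H i; rewrite negbK => /eqP.
have f0 := freq_neq0 ki.
have [h p] := C1_sink k.
have := tint_partial (C1_cper h) (h.2 i).1 (h.2 i).2.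
rewrite p tintZ; last exact: cper_cosk.
by move/eqP; rewrite mulf_eq0 (negbTE f0) => /eqP.
Qed.

Lemma cosk_mul_cosk k l x :
  cosk k x * cosk l x = 2^-1 * (cosk (k - l) x + cosk (k + l) x).
Proof. by rewrite /cosk !phase_add phase_opp cosB cosD; field. Qed.
Lemma sink_mul_sink k l x :
  sink k x * sink l x = 2^-1 * (cosk (k - l) x - cosk (k + l) x).
Proof. by rewrite /sink /cosk !phase_add phase_opp cosB cosD; field. Qed.
Lemma sink_mul_cosk k l x :
  sink k x * cosk l x = 2^-1 * (sink (k + l) x + sink (k - l) x).
Proof. by rewrite /sink /cosk !phase_add phase_opp sinB sinD; field. Qed.

(** Closure under products, derivatives, reflections and convolutions is proved by induction on the
    construction, without bookkeeping of index sets. *)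
Inductive trig : ('rV[R]_d -> R) -> Prop :=
| trig_cos k : trig (cosk k)
| trig_sin k : trig (sink k)
| trigD f g : trig f -> trig g -> trig (fun x => f x + g x)
| trigZ (c : R) f : trig f -> trig (fun x => c * f x).

Lemma trig_cst (c : R) : trig (fun=> c).
Proof.
rewrite (_ : (fun=> c) = (fun x => c * cosk 0 x)); first exact/trigZ/trig_cos.
by apply/funext => x; rewrite cosk0 mulr1.
Qed.

Lemma trig_sum (J : Type) (s : seq J) (F : J -> 'rV[R]_d -> R) :
  (forall j, trig (F j)) -> trig (fun x => \sum_(j <- s) F j x).
Proof.
move=> cF; elim: s => [|j s IH].
  by under eq_fun do rewrite big_nil; exact: trig_cst.
by under eq_fun do rewrite big_cons; exact: trigD.
Qed.

Lemma trigM f g : trig f -> trig g -> trig (fun x => f x * g x).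
Proof.
have H f0 : (forall l, trig (fun x => f0 x * cosk l x)) ->
    (forall l, trig (fun x => f0 x * sink l x)) ->
    forall g, trig g -> trig (fun x => f0 x * g x).
  move=> h1 h2 g0; elim => // [g1 g2 _ H1 _ H2|c g1 _ H1].
    by under eq_fun do rewrite mulrDr; exact: trigD.
  by under eq_fun do rewrite mulrCA; exact: trigZ.
have N f0 : trig f0 -> trig (fun x => - f0 x).
  by move=> tf; under eq_fun do rewrite -mulN1r; exact: trigZ.
move=> tf tg; elim: tf g tg => [k|k|f1 f2 _ H1 _ H2|c f1 _ H1] g tg.
- apply: (H _ _ _ _ tg) => l.
    under eq_fun do rewrite cosk_mul_cosk.
    by apply: trigZ; apply: trigD; exact: trig_cos.
  under eq_fun do rewrite mulrC sink_mul_cosk.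
  by apply: trigZ; apply: trigD; exact: trig_sin.
- apply: (H _ _ _ _ tg) => l.
    under eq_fun do rewrite sink_mul_cosk.
    by apply: trigZ; apply: trigD; exact: trig_sin.
  under eq_fun do rewrite sink_mul_sink.
  by apply: trigZ; apply: trigD; [exact: trig_cos|apply: N; exact: trig_cos].
- under eq_fun do rewrite mulrDl.
  by apply: trigD; [exact: H1|exact: H2].
- under eq_fun do rewrite -mulrA.
  by apply: trigZ; exact: H1.
Qed.

Lemma trig_C1 f : trig f -> C1 f /\ forall i, trig (partial i f).
Proof.
elim => [k|k|f1 g1 _ [c1 t1] _ [c2 t2]|c f1 _ [c1 t1]].
- have [h p] := C1_cosk k; split => // i; rewrite p; exact/trigZ/trig_sin.
- have [h p] := C1_sink k; split => // i; rewrite p; exact/trigZ/trig_cos.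
- have [h p] := C1D c1 c2; split => // i; rewrite p; exact: trigD.
- have [h p] := C1Z c c1; split => // i; rewrite p; exact: trigZ.
Qed.

Lemma trig_cper f : trig f -> cper f.
Proof. by move/trig_C1 => [/C1_cper]. Qed.

Lemma trig_smooth f : trig f -> smooth_periodic f.
Proof.
move=> tf; split; first by have [] := trig_cper tf.
move=> s; have : trig (iter_partial s f).
  by elim: s => //= i s IH; have [_] := trig_C1 IH; apply.
move=> /[dup] /trig_cper [_ cs] /trig_C1 [[_ H] _]; split => // i x.
exact: (H i).1.
Qed.

Lemma trig_reflect a f : trig f -> trig (fun y => f (a - y)).
Proof.
elim => [k|k|f1 g1 _ t1 _ t2|c f1 _ t1]; last 2 first.
- exact: trigD.
- exact: trigZ.
- rewrite (_ : (fun _ => _) = (fun y => cosk k a * cosk k y + sink k a * sink k y)).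
    by apply: trigD; apply: trigZ; [exact: trig_cos|exact: trig_sin].
  by apply/funext => y; rewrite /cosk /sink phaseD phaseN cosB.
- rewrite (_ : (fun _ => _) = (fun y => sink k a * cosk k y + (- cosk k a) * sink k y)).
    by apply: trigD; apply: trigZ; [exact: trig_cos|exact: trig_sin].
  by apply/funext => y; rewrite /cosk /sink phaseD phaseN sinB mulNr.
Qed.

(** Reflections do not preserve the unit cube on which the measure is built, but on trigonometric
    polynomials invariance can be read off the coefficients. [tint_reflect] extends it by
    density. *)
Lemma tint_trig_reflect a f : trig f -> tint (fun y => f (a - y)) = tint f.
Proof.
elim => [k|k|f1 g1 t1 H1 t2 H2|c f1 t1 H1].
- rewrite (_ : (fun _ => _) = (fun y => cosk k a * cosk k y + sink k a * sink k y)); last first.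
    by apply/funext => y; rewrite /cosk /sink phaseD phaseN cosB.
  rewrite tintD ?tintZ; do ?by [exact: cper_cosk|exact: cper_sink|
    apply: cperZ; exact: cper_cosk|apply: cperZ; exact: cper_sink].
  rewrite tint_sink mulr0 addr0 tint_cosk.
  by have [->|_] := eqVneq k 0; rewrite ?mulr0// cosk0 mulr1.
- rewrite (_ : (fun _ => _) = (fun y => sink k a * cosk k y + (- cosk k a) * sink k y)); last first.
    by apply/funext => y; rewrite /cosk /sink phaseD phaseN sinB mulNr.
  rewrite tintD ?tintZ; do ?by [exact: cper_cosk|exact: cper_sink|
    apply: cperZ; exact: cper_cosk|apply: cperZ; exact: cper_sink].
  rewrite tint_sink mulr0 addr0 tint_cosk.
  by have [->|_] := eqVneq k 0; rewrite ?mulr0// sink0 mul0r.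
- rewrite !tintD ?H1 ?H2//; do ?exact: trig_cper.
    by apply: cper_reflect; exact: trig_cper.
  by apply: cper_reflect; exact: trig_cper.
- rewrite !tintZ ?H1//; first exact: trig_cper.
  by apply: cper_reflect; exact: trig_cper.
Qed.

End trig.

(** * Density of trigonometric polynomials *)

Section fejer.
Context {R : realType} {d : nat}.
Implicit Types (f g : 'rV[R]_d -> R) (x y : 'rV[R]_d) (i : 'I_d) (k : 'rV[int]_d).

(** Cosine polynomials with nonnegative coefficients. They are stable under multiplication by a
    cosine and have nonnegative mean, which is how the mass of the kernel is shown to be
    positive. *)
Inductive ptrig : ('rV[R]_d -> R) -> Prop :=
| ptrig_cos k : ptrig (cosk k)
| ptrigD f g : ptrig f -> ptrig g -> ptrig (fun x => f x + g x)
| ptrigZ (c : R) f : 0 <= c -> ptrig f -> ptrig (fun x => c * f x).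

Lemma ptrig_trig f : ptrig f -> trig f.
Proof.
by elim => *; [exact: trig_cos|exact: trigD|exact: trigZ].
Qed.

Lemma ptrig_cosM k f : ptrig f -> ptrig (fun x => cosk k x * f x).
Proof.
elim => [l|f1 g1 _ h1 _ h2|c f1 c0 _ h1].
- under eq_fun do rewrite cosk_mul_cosk.
  by apply: ptrigZ; [rewrite invr_ge0|apply: ptrigD; exact: ptrig_cos].
- by under eq_fun do rewrite mulrDr; exact: ptrigD.
- by under eq_fun do rewrite mulrCA; exact: ptrigZ.
Qed.

Lemma ptrig_tint f : ptrig f -> 0 <= tint f.
Proof.
elim => [l|f1 g1 t1 h1 t2 h2|c f1 c0 t1 h1]; first by rewrite tint_cosk.
- by rewrite tintD ?addr_ge0//; apply: trig_cper; exact: ptrig_trig.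
- by rewrite tintZ ?mulr_ge0//; apply: trig_cper; exact: ptrig_trig.
Qed.

Definition ek i : 'rV[int]_d := delta_mx 0 i.

Lemma phase_ek i x : phase (ek i) x = 2 * pi * x 0 i.
Proof.
rewrite /phase (bigD1 i)//= big1 ?addr0; first by rewrite !mxE !eqxx mul1r.
by move=> j /negbTE ji; rewrite !mxE eqxx ji mul0r.
Qed.

Lemma freq_ek i (j : 'I_d) : freq (ek i) j = 2 * pi * (j == i)%:R :> R.
Proof. by rewrite /freq !mxE eqxx; case: (j == i). Qed.

Definition hat1 i x : R := 1 + cosk (ek i) x.

Lemma hat1_ge0 i x : 0 <= hat1 i x.
Proof. by rewrite /hat1 addrC -lerBlDr sub0r cos_geN1. Qed.

Lemma trig_hat1 i : trig (hat1 i).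
Proof. by apply: trigD; [exact: trig_cst|exact: trig_cos]. Qed.

Lemma trig_prod (J : Type) (s : seq J) (P : pred J) (F : J -> 'rV[R]_d -> R) :
  (forall j, trig (F j)) -> trig (fun x => \prod_(j <- s | P j) F j x).
Proof.
move=> cF; elim: s => [|j s IH].
  by under eq_fun do rewrite big_nil; exact: trig_cst.
have [Pj|Pj] := boolP (P j); under eq_fun do rewrite big_cons ?Pj ?(negbTE Pj).
  exact: trigM.
exact: IH.
Qed.

Lemma trigX n f : trig f -> trig (fun x => f x ^+ n).
Proof.
move=> tf; elim: n => [|n IH]; first exact: trig_cst.
by under eq_fun do rewrite exprS; exact: trigM.
Qed.

(** Since 1 + cos a = 2 cos^2 (a/2), this is up to a factor the product of the cos^(2n) (pi x_i),
    the de la Vallee-Poussin kernel, which concentrates at the integer points. *)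
Definition fejer (n : nat) x : R := (\prod_i hat1 i x) ^+ n.

Lemma fejer_ge0 n x : 0 <= fejer n x.
Proof. by apply: exprn_ge0; apply: prodr_ge0 => i _; exact: hat1_ge0. Qed.

Lemma trig_fejer n : trig (fejer n).
Proof. by apply: trigX; apply: trig_prod; exact: trig_hat1. Qed.

(** Starting from the constant 1, each factor 1 + cos adds to the kernel a [ptrig] function, of
    nonnegative mean; so the mean never drops below 1. *)
Lemma fejer_tint_gt0 n : 0 < tint (fejer n).
Proof.
have H (s : seq 'I_d) g : ptrig g -> ptrig (fun x => (\prod_(i <- s) hat1 i x) * g x) /\
    tint g <= tint (fun x => (\prod_(i <- s) hat1 i x) * g x).
  move=> pg; elim: s => [|i s [h1 h2]].
    by under eq_fun do rewrite big_nil mul1r.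
  have E : (fun x => (\prod_(j <- i :: s) hat1 j x) * g x) =
    (fun x => (\prod_(j <- s) hat1 j x) * g x +
              cosk (ek i) x * ((\prod_(j <- s) hat1 j x) * g x)).
    by apply/funext => x; rewrite big_cons /hat1; ring.
  have h3 := ptrig_cosM (ek i) h1.
  rewrite E; split; first exact: ptrigD.
  rewrite tintD; do ?by apply: trig_cper; exact: ptrig_trig.
  by apply: le_trans h2 _; rewrite lerDl ptrig_tint.
have [_] : ptrig (fejer n) /\ 1 <= tint (fejer n).
  elim: n => [|n [h1 h2]].
    rewrite (_ : fejer 0 = cosk 0); last by apply/funext => x; rewrite cosk0 /fejer expr0.
    by split; [exact: ptrig_cos|rewrite tint_cosk eqxx].
  rewrite (_ : fejer n.+1 = fun x => (\prod_i hat1 i x) * fejer n x).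
    have [h3 h4] := H (index_enum _) _ h1; split => //.
    exact: le_trans h2 h4.
  by apply/funext => x; rewrite /fejer exprS.
exact: lt_le_trans.
Qed.

(* [hat1 i * partial i g = - n * 2 pi * sin_i * g] holds for powers of [hat1 i];
   integrating [partial i (sin_i * hat1 i * g)] over the torus then gives the
   second moment of the kernel without evaluating any integral. *)
Let hatder i (n : nat) g := C1 g /\ forall x,
  hat1 i x * partial i g x = - (n%:R * (2 * pi) * sink (ek i) x * g x).

Let hatderM i m n f g : hatder i m f -> hatder i n g ->
  hatder i (m + n) (fun x => f x * g x).
Proof.
move=> [cf pf] [cg pg]; have [cfg p] := C1M cf cg; split => // x.
rewrite p mulrDr mulrA pf [X in _ + X]mulrCA pg natrD; ring.
Qed.

Let hatderX i m n f : hatder i m f -> hatder i (m * n) (fun x => f x ^+ n).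
Proof.
move=> hf; elim: n => [|n IH].
  rewrite muln0; have [h p] := @C1_cst R d 1.
  by split => // x; rewrite /= p mulr0 !mul0r oppr0.
rewrite mulnS (_ : (fun _ => _) = (fun x => f x * f x ^+ n)).
  exact: hatderM.
by apply/funext => x; rewrite exprS.
Qed.

Let hatder_hat1 i (j : 'I_d) : hatder i (i == j) (hat1 j).
Proof.
have [c0 p0] := @C1_cst R d 1; have [c1 p1] := @C1_cosk R d (ek j).
have [c2 p2] := C1D c0 c1; split => // x.
rewrite -[X in partial i X]/(fun x => 1 + cosk (ek j) x) p2 p0 p1 freq_ek.
have [->|_] := eqVneq i j; last by rewrite !mulr0 !mul0r oppr0 mul0r addr0 mulr0.
by rewrite /hat1; ring.
Qed.

Lemma fejer_moment n i :
  tint (fun x => fejer n.+1 x * (1 - cosk (ek i) x)) = tint (fejer n.+1) / n.+2%:R.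
Proof.
pose B x := \prod_(j | j != i) hat1 j x.
have hB : hatder i 0 B.
  rewrite /B; elim: (index_enum _) => [|j s IH].
    have [h p] := @C1_cst R d 1; under [X in hatder _ _ X]eq_fun do rewrite big_nil.
    by split => // x; rewrite p mulr0 !mul0r oppr0.
  have [ji|ji] := boolP (j != i).
    rewrite (_ : (fun _ => _) = (fun x => hat1 j x * \prod_(j <- s | j != i) hat1 j x)).
      by have := @hatder_hat1 i j; rewrite eq_sym (negbTE ji) => h; have := hatderM h IH.
    by apply/funext => x; rewrite big_cons ji.
  rewrite (_ : (fun _ => _) = (fun x => \prod_(j <- s | j != i) hat1 j x))//.
  by apply/funext => x; rewrite big_cons (negbTE ji).
(* The kernel with one factor [hat1 i] removed. The remaining factor multiplies [partial i g], which
   gives a closed form without dividing by [hat1 i], a function with zeros. *)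
pose g x := hat1 i x ^+ n * B x ^+ n.+1.
have hg : hatder i n g.
  have := hatderM (hatderX n (@hatder_hat1 i i)) (hatderX n.+1 hB).
  by rewrite eqxx mul1n mul0n addn0.
have FE x : fejer n.+1 x = hat1 i x * g x.
  by rewrite /fejer (bigD1 i)//= -/(B x) /g exprMn exprS mulrA.
have [cs ps] := @C1_sink R d (ek i).
have [ch ph] := hatder_hat1 i i.
have [cg pg] := hg.
have [c1 p1] := C1M cs ch; have [c2 p2] := C1M c1 cg.
have := tint_partial (C1_cper c2) (c2.2 i).1 (c2.2 i).2.
rewrite p2 p1 ps freq_ek eqxx mulr1.
have -> : (fun x : 'rV[R]_d => (2 * pi * cosk (ek i) x * hat1 i x + sink (ek i) x * partial i (hat1 i) x) * g x +
     sink (ek i) x * hat1 i x * partial i g x) =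
   (fun x => (2 * pi) * (fejer n.+1 x - n.+2%:R * (fejer n.+1 x * (1 - cosk (ek i) x)))).
  apply/funext => x; rewrite -[X in _ + X]mulrA pg FE.
  have [_ p0] := @C1_cst R d 1; have [_ p3] := C1D (@C1_cst R d 1).1 (@C1_cosk R d (ek i)).1.
  rewrite [partial i (hat1 i)](_ : _ = partial i (fun x => 1 + cosk (ek i) x))// p3 p0.
  rewrite (C1_cosk (ek i)).2 freq_ek eqxx /hat1 /=.
  have S2 : sink (ek i) x ^+ 2 = 1 - cosk (ek i) x ^+ 2 by rewrite /sink /cosk sin2cos2.
  have -> : n.+2%:R = n%:R + 2 :> R by rewrite -natrD addn2.
  move: S2; set s := sink _ _; set c := cosk _ _; set G := g x; set N := n%:R => S2.
  apply/eqP; rewrite -subr_eq0; apply/eqP.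
  transitivity (- (2 * pi) * (1 + N) * G * (s ^+ 2 - (1 - c ^+ 2))); first by rewrite /=; ring.
  by rewrite S2 subrr mulr0.
have cF : cper (fejer n.+1) by apply: trig_cper; exact: trig_fejer.
have cFc : cper (fun x => fejer n.+1 x * (1 - cosk (ek i) x)).
  by apply: cperM => //; apply: cperB; [exact: cper_cst|exact: cper_cosk].
rewrite tintZ ?tintB ?tintZ//; do ?by [exact: cperZ|apply: cperB => //; exact: cperZ].
move/eqP; rewrite mulf_eq0 gt_eqF ?mulr_gt0 ?pi_gt0//= subr_eq0 => /eqP ->.
by rewrite mulrAC mulfV ?mul1r// pnatr_eq0.
Qed.

Lemma nbhs_row_box x (A : set 'rV[R]_d) : nbhs x A ->
  exists2 r : R, 0 < r & forall y, (forall i, `|x 0 i - y 0 i| < r) -> A y.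
Proof.
move=> /nbhs_ballP [r /= r0 H]; exists r => // y xy; apply: H.
by split => // a b; rewrite (ord1 a); exact: xy.
Qed.

(** A modulus of continuity in the form that the kernel can integrate: the sum of the 1 - cos is a
    periodic substitute for the squared distance. Nearby points are handled by uniform continuity;
    for the others some term is at least [eta], and the crude bound 2 B is absorbed in L. *)
Lemma cper_modulus f (e : R) : cper f -> 0 < e ->
  exists2 L : R, 0 <= L & forall x y,
    `|f x - f y| <= e + L * \sum_i (1 - cosk (ek i) (x - y)).
Proof.
move=> cf e0.
have [r r0 Hr] : exists2 r : R, 0 < r & forall h : 'rV[R]_d,
    (forall i, `|h 0 i| < r) -> forall x, `|f (x + h) - f x| < e.
  have : \forall h \near (0 : 'rV[R]_d), forall x, `|f (x + h) - f x| < e.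
    apply: (@tube _ _ _ (nbhs (0 : 'rV[R]_d)) (fun h x => f (x + h)) f) => //.
    - exact: cf.2.
    - exact: cf.1.
    - by apply: nearW => h; exact: (cper_shift h cf).1.
    - move=> x e1 e10; have /cvgrPdist_lt/(_ _ e10) := cf.2 x.
      move=> /nbhs_row_box [r r0 H].
      have r2 : 0 < r / 2 by rewrite divr_gt0.
      exists ([set y : 'rV[R]_d | forall i, `|x 0 i - y 0 i| < r / 2],
              [set h : 'rV[R]_d | forall i, `|(0 : 'rV[R]_d) 0 i - h 0 i| < r / 2]).
        by split; exact: near_row.
      move=> [y h] /= [h1 h2]; rewrite distrC; apply: H => i.
      have := h1 i; have := h2 i; rewrite !mxE => a1 a2.
      rewrite (_ : _ - _ = (x 0 i - y 0 i) + (0 - h 0 i)); last by ring.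
      by apply: le_lt_trans (ler_normD _ _) _; lra.
  move=> /nbhs_row_box [r r0 H]; exists r => // h hr; apply: H => i.
  by rewrite mxE sub0r normrN.
(* The cap 1/4 keeps 2 pi q in [0, pi], where the cosine decreases. *)
pose q : R := Num.min r (4^-1).
have q0 : 0 < q by rewrite lt_min r0 invr_gt0 ltr0n.
have q4 : q <= 4^-1 by rewrite ge_min lexx orbT.
have pi0 : 0 < pi :> R := pi_gt0 R.
pose eta : R := 1 - cos (2 * pi * q).
have qI : 2 * pi * q \in `[0, pi]%R.
  rewrite in_itv/=; apply/andP; split; first by rewrite !mulr_ge0// ltW.
  have : pi * q <= pi * 4^-1 by rewrite ler_pM2l.
  by move: pi0; set p := pi; lra.
have eta0 : 0 < eta.
  rewrite subr_gt0 -[ltRHS]cos0 ltr_cos//; first by rewrite !mulr_gt0.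
  by rewrite in_itv/= lexx ltW.
have [B B0 HB] := cper_bounded cf.
exists (2 * B / eta); first by rewrite divr_ge0 ?mulr_ge0// ltW.
move=> x y; pose h := x - y.
(* Rounding to the nearest integer: [h'] represents x - y modulo the lattice with coordinates in
   [-1/2, 1/2]. *)
pose m : 'rV[int]_d := \row_i Num.floor (h 0 i + 2^-1).
pose h' := h - int_row m.
have cosE i : cosk (ek i) (x - y) = cos (2 * pi * `|h' 0 i|).
  have -> : cos (2 * pi * `|h' 0 i|) = cos (2 * pi * h' 0 i).
    by have [z|z] := ger0P (h' 0 i); rewrite ?mulrN ?cosN.
  rewrite /cosk phase_ek -/h -[RHS](cosD2pin _ (m 0 i)); congr cos.
  by rewrite /h' !mxE; ring.
have h'2 i : `|h' 0 i| <= 2^-1.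
  rewrite /h' !mxE ler_norml.
  have := ge_floor (x 0 i - y 0 i + 2^-1); have := floorD1_gt (x 0 i - y 0 i + 2^-1).
  by rewrite intrD => h1 h2; apply/andP; split; lra.
have s0 i : 0 <= 1 - cosk (ek i) (x - y) by rewrite subr_ge0 cos_le1.
have fxy : f x = f (y + h').
  rewrite -(periodic_int_row cf.1 m (y + h')); congr f.
  by rewrite /h' /h -addrA subrK addrC subrK.
have [Hh|/existsNP[i /negP]] := pselect (forall i, `|h' 0 i| < q).
  rewrite fxy ltW//; apply: lt_le_trans (Hr _ _ y) _.
    by move=> i; apply: lt_le_trans (Hh i) _; rewrite ge_min lexx.
  rewrite lerDl mulr_ge0//; first by rewrite divr_ge0 ?mulr_ge0// ltW.
  by apply: sumr_ge0 => i _; exact: s0.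
rewrite -leNgt => qh.
apply: (@le_trans _ _ (2 * B)).
  apply: le_trans (ler_normB _ _) _; have := HB x; have := HB y; lra.
apply: (@le_trans _ _ (2 * B / eta * (1 - cosk (ek i) (x - y)))).
  rewrite -mulrA ler_peMr ?mulr_ge0 ?(ltW B0)//.
  rewrite mulrC ler_pdivlMr// mul1r /eta lerD2l lerN2 cosE.
  have [->//|qne] := eqVneq q `|h' 0 i|.
  have qlt : q < `|h' 0 i| by rewrite lt_neqAle qne.
  rewrite ltW// ltr_cos//; first by rewrite ltr_pM2l// mulr_gt0.
  rewrite in_itv/= !mulr_ge0//= ?(ltW pi0)//.
  have : pi * `|h' 0 i| <= pi * 2^-1 by rewrite ler_pM2l.
  by set p := pi; lra.
apply: (@le_trans _ _ (2 * B / eta * \sum_i (1 - cosk (ek i) (x - y)))); last by rewrite lerDr ltW.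
apply: ler_wpM2l; first by rewrite divr_ge0 ?mulr_ge0// ltW.
by rewrite (bigD1 i)//= lerDl sumr_ge0.
Qed.

Definition nfejer (n : nat) x : R := (tint (fejer n.+1))^-1 * fejer n.+1 x.

Lemma trig_nfejer n : trig (nfejer n).
Proof. exact/trigZ/trig_fejer. Qed.
Lemma nfejer_ge0 n x : 0 <= nfejer n x.
Proof. by rewrite mulr_ge0 ?invr_ge0 ?fejer_ge0// ltW// fejer_tint_gt0. Qed.
Lemma tint_nfejer n : tint (nfejer n) = 1.
Proof.
rewrite tintZ ?mulVf ?gt_eqF ?fejer_tint_gt0//.
by apply: trig_cper; exact: trig_fejer.
Qed.

Lemma trig_tint_conv g f : trig g -> cper f ->
  trig (fun x => tint (fun y => g (x - y) * f y)).
Proof.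
move=> tg cf.
have cfm g1 x : trig g1 -> cper (fun y => g1 (x - y) * f y).
  by move=> t1; apply: cperM => //; apply: cper_reflect; exact: trig_cper.
elim: tg => [k|k|f1 g1 t1 H1 t2 H2|c f1 t1 H1].
- rewrite (_ : (fun _ => _) = (fun x => tint (fun y => cosk k y * f y) * cosk k x +
     tint (fun y => sink k y * f y) * sink k x)).
    by apply: trigD; apply: trigZ; [exact: trig_cos|exact: trig_sin].
  apply/funext => x; rewrite ![_ * _ k x]mulrC -!tintZ -?tintD; do ?by
    [apply: cperM => //; exact: cper_cosk|apply: cperM => //; exact: cper_sink
    |apply: cperZ; apply: cperM => //; exact: cper_cosk
    |apply: cperZ; apply: cperM => //; exact: cper_sink].
  by apply: eq_tint => y; rewrite /cosk /sink phaseD phaseN cosB; ring.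
- rewrite (_ : (fun _ => _) = (fun x => tint (fun y => cosk k y * f y) * sink k x +
     (- tint (fun y => sink k y * f y)) * cosk k x)).
    by apply: trigD; apply: trigZ; [exact: trig_sin|exact: trig_cos].
  apply/funext => x; rewrite mulNr ![_ * _ k x]mulrC -!tintZ -?tintB; do ?by
    [apply: cperM => //; exact: cper_cosk|apply: cperM => //; exact: cper_sink
    |apply: cperZ; apply: cperM => //; exact: cper_cosk
    |apply: cperZ; apply: cperM => //; exact: cper_sink].
  by apply: eq_tint => y; rewrite /cosk /sink phaseD phaseN sinB; ring.
- rewrite (_ : (fun _ => _) = (fun x => tint (fun y => f1 (x - y) * f y) +
      tint (fun y => g1 (x - y) * f y))); first exact: trigD.
  apply/funext => x; rewrite -tintD; [|exact: cfm|exact: cfm].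
  by apply: eq_tint => y; rewrite mulrDl.
- rewrite (_ : (fun _ => _) = (fun x => c * tint (fun y => f1 (x - y) * f y))); first exact: trigZ.
  apply/funext => x; rewrite -tintZ; last exact: cfm.
  by apply: eq_tint => y; rewrite mulrA.
Qed.

(** Integrating [cper_modulus] against the kernel gives the error e/2 + L d / (n + 2), each
    direction contributing a moment 1 / (n + 2). *)
Lemma nfejer_cvg f (e : R) : cper f -> 0 < e ->
  \forall n \near \oo, forall x, `|f x - tint (fun y => nfejer n (x - y) * f y)| <= e.
Proof.
move=> cf e0; have e2 : 0 < e / 2 by rewrite divr_gt0.
have [L L0 HL] := cper_modulus cf e2.
have : \forall n \near \oo, 2 * L * d%:R / e < n%:R.
  exact: nbhs_infty_gtr.
apply: filterS => n hn x.
have cK : cper (fun y => nfejer n (x - y)).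
  by apply: cper_reflect; apply: trig_cper; exact: trig_nfejer.
have K1 : tint (fun y => nfejer n (x - y)) = 1.
  by rewrite tint_trig_reflect ?tint_nfejer//; exact: trig_nfejer.
have -> : f x = tint (fun y => f x * nfejer n (x - y)).
  by rewrite tintZ// K1 mulr1.
rewrite -tintB; [|exact: cperZ|exact: cperM].
have cc i : cper (fun y => 1 - cosk (ek i) (x - y)).
  apply: cperB; first exact: cper_cst.
  by apply: cper_reflect; exact: cper_cosk.
have -> : tint (fun y => f x * nfejer n (x - y) - nfejer n (x - y) * f y) =
   tint (fun y => nfejer n (x - y) * (f x - f y)).
  by apply: eq_tint => y; ring.
have c1 : cper (fun y => nfejer n (x - y) * (f x - f y)).
  by apply: cperM => //; apply: cperB => //; exact: cper_cst.
apply: le_trans (tint_norm c1) _.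
pose G y := (e / 2) * nfejer n (x - y) + L * \sum_i (nfejer n (x - y) * (1 - cosk (ek i) (x - y))).
have cNi i : cper (fun y => nfejer n (x - y) * (1 - cosk (ek i) (x - y))) by exact: cperM.
have cS : cper (fun y => \sum_i (nfejer n (x - y) * (1 - cosk (ek i) (x - y)))).
  exact: cper_sum.
apply: (@le_trans _ _ (tint G)).
  apply: tint_le; first exact: cper_norm.
    by apply: cperD; exact: cperZ.
  move=> y; rewrite normrM ger0_norm ?nfejer_ge0// /G -mulr_sumr.
  rewrite (_ : _ + _ = nfejer n (x - y) * (e / 2 + L * \sum_i (1 - cosk (ek i) (x - y)))); last by ring.
  by apply: ler_wpM2l; [exact: nfejer_ge0|exact: HL].
rewrite /G tintD; [|exact: cperZ|exact: cperZ].
rewrite (tintZ _ cK) K1 mulr1 (tintZ _ cS) tint_sum//.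
rewrite (eq_bigr (fun=> n.+2%:R^-1)); last first.
  move=> i _.
  have -> : tint (fun y => nfejer n (x - y) * (1 - cosk (ek i) (x - y))) =
      tint (fun y => nfejer n y * (1 - cosk (ek i) y)).
    apply: (@tint_trig_reflect _ _ _ (fun y => nfejer n y * (1 - cosk (ek i) y))).
    apply: trigM; first exact: trig_nfejer.
    rewrite (_ : (fun _ => _) = (fun y => 1 + (-1) * cosk (ek i) y)).
      by apply: trigD; [exact: trig_cst|apply: trigZ; exact: trig_cos].
    by apply/funext => y; rewrite mulN1r.
  have := fejer_moment n i.
  rewrite /nfejer; under [in X in _ -> X = _]eq_tint do rewrite -mulrA.
  rewrite tintZ => [->|]; last first.
    apply: cperM; first by apply: trig_cper; exact: trig_fejer.
    by apply: cperB; [exact: cper_cst|exact: cper_cosk].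
  by rewrite mulrA mulVf ?mul1r// gt_eqF// fejer_tint_gt0.
rewrite sumr_const card_ord -[_ *+ d]mulr_natr.
have n0 : (0 : R) < n.+2%:R by [].
have : L * (n.+2%:R^-1 * d%:R) <= e / 2.
  rewrite mulrCA mulrC ler_pdivrMr//.
  move: hn; rewrite ltr_pdivrMr// => hn.
  have : n%:R * e <= n.+2%:R * e by rewrite ler_pM2r// ler_nat -addn2 leq_addr.
  by move: hn; set m := n.+2%:R; lra.
by move=> h; rewrite [leRHS](splitr e) lerD2l.
Qed.

(** Linear identities for continuous periodic functions are reduced to cosines and sines, the last
    premise being closure under uniform limits. Reflection invariance and the exchange of integrals
    in a convolution are obtained this way. *)
Lemma cper_ind (P : ('rV[R]_d -> R) -> Prop) :
  (forall k, P (cosk k)) -> (forall k, P (sink k)) ->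
  (forall f g, cper f -> cper g -> P f -> P g -> P (fun x => f x + g x)) ->
  (forall (c : R) f, cper f -> P f -> P (fun x => c * f x)) ->
  (forall f, cper f -> (forall e : R, 0 < e -> exists g, [/\ cper g, P g & forall x, `|f x - g x| <= e]) -> P f) ->
  forall f, cper f -> P f.
Proof.
move=> Pc Ps PD PZ Plim f cf.
have Pt g : trig g -> P g.
  elim => // [f1 g1 /trig_cper c1 h1 /trig_cper c2 h2|c f1 /trig_cper c1 h1]; first exact: PD.
  exact: PZ.
apply: Plim => // e e0.
have [N _ /(_ N (leqnn N)) H] := nfejer_cvg cf e0.
have tt : trig (fun x => tint (fun y => nfejer N (x - y) * f y)).
  by apply: trig_tint_conv => //; exact: trig_nfejer.
by exists (fun x => tint (fun y => nfejer N (x - y) * f y)); split; [exact: trig_cper|exact: Pt|].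
Qed.

Lemma tint_reflect a f : cper f -> tint (fun y => f (a - y)) = tint f.
Proof.
move: f; apply: cper_ind => [k|k|f g cf cg hf hg|c f cf hf|f cf H].
- by apply: tint_trig_reflect; exact: trig_cos.
- by apply: tint_trig_reflect; exact: trig_sin.
- by rewrite !tintD ?hf ?hg//; exact: cper_reflect.
- by rewrite !tintZ ?hf//; exact: cper_reflect.
- apply/eqP; rewrite -subr_eq0 -normr_le0; apply/ler_addgt0Pr => e e0.
  have [|g [cg hg H1]] := H (e / 2); first by rewrite divr_gt0.
  rewrite add0r (_ : _ - _ = tint (fun y => f (a - y) - g (a - y)) + tint (fun y => g y - f y)).
    apply: le_trans (ler_normD _ _) _.
    have : `|tint (fun y => f (a - y) - g (a - y))| <= e / 2.
      by apply: tint_bound => //; apply: cperB; exact: cper_reflect.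
    have : `|tint (fun y => g y - f y)| <= e / 2.
      by apply: tint_bound => [|x]; [exact: cperB|rewrite distrC].
    lra.
  by rewrite !tintB ?hg//; do ?exact: cper_reflect; ring.
Qed.

(** A translation is the composition of two reflections. *)
Lemma tint_shift a f : cper f -> tint (fun y => f (y + a)) = tint f.
Proof.
move=> cf; rewrite -[RHS](tint_reflect a)//.
rewrite -[LHS](tint_reflect 0); last exact: cper_shift.
by apply: eq_tint => y; rewrite add0r addrC.
Qed.

End fejer.

Section L2.
Context {R : realType} {d : nat}.
Implicit Types (f g : 'rV[R]_d -> R) (x y : 'rV[R]_d).

Definition sqint f : R := tint (fun x => f x ^+ 2).

Lemma sqint_ge0 f : 0 <= sqint f.
Proof. by apply: tint_ge0 => x; exact: sqr_ge0. Qed.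

Lemma cauchy_schwarz f g : cper f -> cper g ->
  tint (fun x => f x * g x) ^+ 2 <= sqint f * sqint g.
Proof.
move=> cf cg; set b := tint _; set c := sqint f; set a := sqint g.
have cfg := cperM cf cg; have cf2 := cperX 2 cf; have cg2 := cperX 2 cg.
have H (s t : R) : 0 <= s ^+ 2 * c - 2 * s * t * b + t ^+ 2 * a.
  rewrite (_ : _ + _ = tint (fun x => (s * f x - t * g x) ^+ 2)).
    by apply: tint_ge0 => x; exact: sqr_ge0.
  rewrite (@eq_tint _ _ _ (fun x => (s ^+ 2 * f x ^+ 2 - (2 * s * t) * (f x * g x)) + t ^+ 2 * g x ^+ 2)).
    rewrite tintD ?tintB ?tintZ//; do ?exact: cperZ.
    by apply: cperB; exact: cperZ.
  by move=> x; ring.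
have a0 : 0 <= a := sqint_ge0 g.
have [a1|a1] := eqVneq a 0; last first.
  have ap : 0 < a by rewrite lt_neqAle eq_sym a1.
  have := H a b; rewrite (_ : _ + _ = a * (c * a - b ^+ 2)); last by ring.
  by rewrite pmulr_rge0// subr_ge0.
rewrite a1 mulr0.
have [->|b0] := eqVneq b 0; first by rewrite expr0n.
(* When [sqint g] vanishes the form is affine in its second argument; this choice would give it the
   value -1. *)
have := H 1 ((c + 1) / (2 * b)); rewrite a1.
rewrite (_ : _ + _ = - 1); first by rewrite oppr_ge0 ler10.
by rewrite mulr0 addr0; field.
Qed.

Definition nrm f : R := Num.sqrt (sqint f).

Lemma nrm_ge0 f : 0 <= nrm f. Proof. exact: sqrtr_ge0. Qed.

Lemma nrm_sq f : nrm f ^+ 2 = sqint f.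
Proof. by rewrite sqr_sqrtr// sqint_ge0. Qed.

Lemma tint_le_nrm f g : cper f -> cper g ->
  `|tint (fun x => f x * g x)| <= nrm f * nrm g.
Proof.
move=> cf cg; rewrite -sqrtrM ?sqint_ge0// -sqrtr_sqr ler_sqrt ?cauchy_schwarz//.
by rewrite mulr_ge0 ?sqint_ge0.
Qed.

Lemma tint_norm_le_nrm f : cper f -> tint (fun x => `|f x|) <= nrm f.
Proof.
move=> cf; have cn := cper_norm cf.
have := tint_le_nrm cn (cper_cst 1).
rewrite (@eq_tint _ _ (fun x => `|f x| * 1) (fun x => `|f x|)); last by move=> x; rewrite mulr1.
rewrite ger0_norm; last by apply: tint_ge0.
congr (_ <= _); rewrite /nrm /sqint.
rewrite (@eq_tint _ _ (fun x => 1 ^+ 2) (fun=> 1)); last by move=> x; rewrite expr1n.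
rewrite tint_cst sqrtr1 mulr1; congr Num.sqrt.
by apply: eq_tint => x; rewrite real_normK// num_real.
Qed.

Lemma sqintD_le f g : cper f -> cper g ->
  sqint (fun x => f x + g x) <= 2 * sqint f + 2 * sqint g.
Proof.
move=> cf cg; have cf2 := cperX 2 cf; have cg2 := cperX 2 cg.
rewrite /sqint -!tintZ// -tintD; [|exact: cperZ|exact: cperZ].
apply: tint_le => [||x]; [exact/cperX/cperD|by apply: cperD; exact: cperZ|].
rewrite -subr_ge0 (_ : _ - _ = (f x - g x) ^+ 2); first exact: sqr_ge0.
by ring.
Qed.

Lemma sqint_bound f (B : R) : cper f -> (forall x, `|f x| <= B) -> sqint f <= B ^+ 2.
Proof.
move=> cf H; have B0 : 0 <= B := le_trans (normr_ge0 _) (H 0).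
apply: le_trans (ler_norm _) _; apply: tint_bound; first exact: cperX.
by move=> x; rewrite normrX ler_pXn2r// nnegrE.
Qed.

Lemma sqintM_le f g (B : R) : cper f -> cper g -> (forall x, `|g x| <= B) ->
  sqint (fun x => f x * g x) <= B ^+ 2 * sqint f.
Proof.
move=> cf cg H; have B0 : 0 <= B := le_trans (normr_ge0 _) (H 0).
rewrite /sqint -tintZ; last exact: cperX.
apply: tint_le => [||x]; [exact/cperX/cperM|exact/cperZ/cperX|].
rewrite exprMn mulrC ler_wpM2r ?sqr_ge0// -[g x ^+ 2]real_normK ?num_real//.
by rewrite ler_pXn2r ?nnegrE.
Qed.

End L2.

(** * Fourier coefficients, Bessel and Parseval *)

Section fourier.
Context {R : realType} {d : nat}.
Implicit Types (f g : 'rV[R]_d -> R) (x y : 'rV[R]_d) (i : 'I_d)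
  (k l : 'rV[int]_d) (S : {fset 'rV[int]_d}) (a b : 'rV[int]_d -> R).

Definition ccoef f k : R := tint (fun x => f x * cosk k x).
Definition scoef f k : R := tint (fun x => f x * sink k x).
Definition fsq f k : R := ccoef f k ^+ 2 + scoef f k ^+ 2.

Lemma fsq_ge0 f k : 0 <= fsq f k.
Proof. by rewrite addr_ge0 ?sqr_ge0. Qed.

Lemma ccoefN f k : ccoef f (- k) = ccoef f k.
Proof. by apply: eq_tint => x; rewrite coskN. Qed.
Lemma cper_fc f k : cper f -> cper (fun x => f x * cosk k x).
Proof. by move=> cf; apply: cperM => //; exact: cper_cosk. Qed.
Lemma cper_fs f k : cper f -> cper (fun x => f x * sink k x).
Proof. by move=> cf; apply: cperM => //; exact: cper_sink. Qed.

Lemma scoefN f k : cper f -> scoef f (- k) = - scoef f k.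
Proof.
move=> cf; rewrite /scoef -tintN; last exact: cper_fs.
by apply: eq_tint => x; rewrite sinkN mulrN.
Qed.

Lemma ccoefD f g k : cper f -> cper g ->
  ccoef (fun x => f x + g x) k = ccoef f k + ccoef g k.
Proof.
move=> cf cg; rewrite /ccoef -tintD; [|exact: cper_fc|exact: cper_fc].
by apply: eq_tint => x; rewrite mulrDl.
Qed.
Lemma scoefD f g k : cper f -> cper g ->
  scoef (fun x => f x + g x) k = scoef f k + scoef g k.
Proof.
move=> cf cg; rewrite /scoef -tintD; [|exact: cper_fs|exact: cper_fs].
by apply: eq_tint => x; rewrite mulrDl.
Qed.
Lemma ccoefZ (c : R) f k : cper f -> ccoef (fun x => c * f x) k = c * ccoef f k.
Proof.
by move=> cf; rewrite /ccoef -tintZ; [apply: eq_tint => x; rewrite mulrA|exact: cper_fc].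
Qed.
Lemma scoefZ (c : R) f k : cper f -> scoef (fun x => c * f x) k = c * scoef f k.
Proof.
by move=> cf; rewrite /scoef -tintZ; [apply: eq_tint => x; rewrite mulrA|exact: cper_fs].
Qed.
Lemma ccoefB f g k : cper f -> cper g ->
  ccoef (fun x => f x - g x) k = ccoef f k - ccoef g k.
Proof.
move=> cf cg; rewrite /ccoef -tintB; [|exact: cper_fc|exact: cper_fc].
by apply: eq_tint => x; rewrite mulrBl.
Qed.
Lemma scoefB f g k : cper f -> cper g ->
  scoef (fun x => f x - g x) k = scoef f k - scoef g k.
Proof.
move=> cf cg; rewrite /scoef -tintB; [|exact: cper_fs|exact: cper_fs].
by apply: eq_tint => x; rewrite mulrBl.
Qed.

Lemma ccoef_partial f i k : C1 f -> ccoef (partial i f) k = freq k i * scoef f k.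
Proof.
move=> cf; have [ck pk] := @C1_cosk R d k.
rewrite /ccoef (tint_by_parts i cf ck) pk /scoef -tintZ; last exact/cper_fs/C1_cper.
rewrite -tintN; last first.
  apply: cperM; first exact: C1_cper.
  by apply: cperZ; exact: cper_sink.
by apply: eq_tint => x; ring.
Qed.
Lemma scoef_partial f i k : C1 f -> scoef (partial i f) k = - (freq k i * ccoef f k).
Proof.
move=> cf; have [ck pk] := @C1_sink R d k.
rewrite /scoef (tint_by_parts i cf ck) pk /ccoef -tintZ; last exact/cper_fc/C1_cper.
by congr (- _); apply: eq_tint => x; ring.
Qed.
Lemma fsq_partial f i k : C1 f -> fsq (partial i f) k = freq k i ^+ 2 * fsq f k.
Proof. by move=> cf; rewrite /fsq ccoef_partial// scoef_partial//; ring. Qed.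

Lemma tint_cosk_cosk k l :
  tint (fun x => cosk k x * cosk l x) = 2^-1 * ((k == l)%:R + (k == - l)%:R) :> R.
Proof.
under eq_tint do rewrite cosk_mul_cosk.
rewrite tintZ; last by apply: cperD; exact: cper_cosk.
rewrite tintD ?tint_cosk; [|exact: cper_cosk|exact: cper_cosk].
by rewrite subr_eq0 addr_eq0.
Qed.
Lemma tint_sink_sink k l :
  tint (fun x => sink k x * sink l x) = 2^-1 * ((k == l)%:R - (k == - l)%:R) :> R.
Proof.
under eq_tint do rewrite sink_mul_sink.
rewrite tintZ; last by apply: cperB; exact: cper_cosk.
rewrite tintB ?tint_cosk; [|exact: cper_cosk|exact: cper_cosk].
by rewrite subr_eq0 addr_eq0.
Qed.
Lemma tint_sink_cosk k l : tint (fun x => sink k x * cosk l x) = 0 :> R.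
Proof.
under eq_tint do rewrite sink_mul_cosk.
rewrite tintZ; last by apply: cperD; exact: cper_sink.
by rewrite tintD ?tint_sink ?addr0 ?mulr0//; exact: cper_sink.
Qed.

Definition symm S := forall k, (- k \in S) = (k \in S).

(** Over a symmetric S, with a even and b odd, the terms at k and -k coincide. The two halves then
    add up so that a and b are exactly the coefficients, without a factor 2 or a special case at k =
    0. *)
Definition synth S a b x : R :=
  \sum_(k <- enum_fset S) (a k * cosk k x + b k * sink k x).

Lemma trig_synth S a b : trig (synth S a b).
Proof.
apply: trig_sum => k; apply: trigD; apply: trigZ; [exact: trig_cos|exact: trig_sin].
Qed.

Lemma cper_synth S a b : cper (synth S a b).
Proof. exact/trig_cper/trig_synth. Qed.

Lemma partial_synth S a b i :
  partial i (synth S a b) = synth S (fun k => freq k i * b k) (fun k => - (freq k i * a k)).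
Proof.
have H k : C1 (fun x => a k * cosk k x + b k * sink k x) /\
    partial i (fun x => a k * cosk k x + b k * sink k x) =
    fun x => (freq k i * b k) * cosk k x + (- (freq k i * a k)) * sink k x.
  have [c1 p1] := @C1_cosk R d k; have [c2 p2] := @C1_sink R d k.
  have [c3 p3] := C1Z (a k) c1; have [c4 p4] := C1Z (b k) c2.
  have [c5 p5] := C1D c3 c4; split => //.
  by rewrite p5 p3 p4 p1 p2; apply/funext => x; ring.
have [_ ->] := C1_sum (enum_fset S) (fun k => (H k).1).
by apply/funext => x; apply: eq_bigr => k _; rewrite (H k).2.
Qed.

Lemma sum_pick S (F : 'rV[int]_d -> R) l :
  \sum_(k <- enum_fset S) (k == l)%:R * F k = if l \in S then F l else 0.
Proof.
case: ifPn => lS; last first.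
  rewrite big1_seq// => k /andP[_ kS]; case: eqP => [kl|_]; last by rewrite mul0r.
  by move: lS; rewrite -kl kS.
rewrite (bigD1_seq l)//= ?fset_uniq// eqxx mul1r big1 ?addr0// => k /negbTE ->.
by rewrite mul0r.
Qed.

Lemma tint_synth S a b f : cper f ->
  tint (fun x => synth S a b x * f x) =
  \sum_(k <- enum_fset S) (a k * ccoef f k + b k * scoef f k).
Proof.
move=> cf; rewrite /synth; under eq_tint do rewrite mulr_suml.
have c1 k : cper (fun x => a k * cosk k x + b k * sink k x).
  by apply: cperD; apply: cperZ; [exact: cper_cosk|exact: cper_sink].
rewrite tint_sum; last by move=> k; exact: cperM.
apply: eq_bigr => k _; rewrite /ccoef /scoef -!tintZ; [|exact: cper_fs|exact: cper_fc].
rewrite -tintD; [|exact/cperZ/cper_fc|exact/cperZ/cper_fs].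
by apply: eq_tint => x; ring.
Qed.

Section parity.
Variables (S : {fset 'rV[int]_d}) (a b : 'rV[int]_d -> R).
Hypothesis (sS : symm S) (pa : forall k, a (- k) = a k) (pb : forall k, b (- k) = - b k).

Lemma ccoef_synth l : ccoef (synth S a b) l = if l \in S then a l else 0.
Proof.
rewrite /ccoef tint_synth; last exact: cper_cosk.
rewrite (eq_bigr (fun k => 2^-1 * ((k == l)%:R * a k + (k == - l)%:R * a k))).
  rewrite -mulr_sumr big_split/= !sum_pick sS pa; case: ifP => _; first by field.
  by rewrite addr0 mulr0.
move=> k _; rewrite /ccoef /scoef.
have -> : tint (fun x => cosk l x * cosk k x) = tint (fun x => cosk k x * cosk l x) :> R.
  by apply: eq_tint => x; rewrite mulrC.
have -> : tint (fun x => cosk l x * sink k x) = tint (fun x => sink k x * cosk l x) :> R.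
  by apply: eq_tint => x; rewrite mulrC.
by rewrite tint_cosk_cosk tint_sink_cosk; ring.
Qed.

Lemma scoef_synth l : scoef (synth S a b) l = if l \in S then b l else 0.
Proof.
rewrite /scoef tint_synth; last exact: cper_sink.
rewrite (eq_bigr (fun k => 2^-1 * ((k == l)%:R * b k - (k == - l)%:R * b k))).
  rewrite -mulr_sumr big_split/= sumrN !sum_pick sS pb; case: ifP => _; first by field.
  by rewrite subr0 mulr0.
move=> k _; rewrite /ccoef /scoef.
have -> : tint (fun x => sink l x * sink k x) = tint (fun x => sink k x * sink l x) :> R.
  by apply: eq_tint => x; rewrite mulrC.
by rewrite tint_sink_sink tint_sink_cosk; ring.
Qed.

Lemma sqint_synth : sqint (synth S a b) = \sum_(k <- enum_fset S) (a k ^+ 2 + b k ^+ 2).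
Proof.
rewrite /sqint; under eq_tint do rewrite expr2.
rewrite tint_synth; last exact: cper_synth.
rewrite big_seq [RHS]big_seq; apply: eq_bigr => k kS.
by rewrite ccoef_synth scoef_synth kS !expr2.
Qed.

End parity.

Definition proj S f := synth S (ccoef f) (scoef f).

Lemma proj_dist S f : symm S -> cper f ->
  sqint (fun x => f x - proj S f x) = sqint f - \sum_(k <- enum_fset S) fsq f k.
Proof.
move=> sS cf; have cp := cper_synth S (ccoef f) (scoef f).
have E : sqint (proj S f) = \sum_(k <- enum_fset S) fsq f k.
  by rewrite sqint_synth// => k; [exact: ccoefN|exact: scoefN].
have E2 : tint (fun x => proj S f x * f x) = \sum_(k <- enum_fset S) fsq f k.
  by rewrite tint_synth//; apply: eq_bigr => k _; rewrite /fsq !expr2.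
rewrite {1}/sqint (@eq_tint _ _ _ (fun x => (f x ^+ 2 - 2 * (proj S f x * f x)) + proj S f x ^+ 2)); last first.
  by move=> x; ring.
have cpf := cperM cp cf; have c2 := cperX 2 cf; have c3 := cperX 2 cp.
rewrite tintD ?tintB ?tintZ//; do ?by [exact: cperZ|apply: cperB => //; exact: cperZ].
by rewrite E2 -/(sqint f) -/(sqint (proj S f)) E; ring.
Qed.

Definition symmz S : {fset 'rV[int]_d} := (S `|` [fset - k | k in S])%fset.

Lemma symm_symmz S : symm (symmz S).
Proof.
move=> k; rewrite /symmz !in_fsetU; apply/orP/orP => -[h|/imfsetP[l /= lS kl]].
- by right; apply/imfsetP; exists (- k) => //; rewrite opprK.
- by left; rewrite (oppr_inj kl).
- by right; apply/imfsetP; exists k.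
- by left; rewrite kl opprK.
Qed.

Lemma symmz_sub S : (S `<=` symmz S)%fset.
Proof. exact: fsubsetUl. Qed.

Lemma sum_fset_le S S' (F : 'rV[int]_d -> R) : (S `<=` S')%fset ->
  (forall k, 0 <= F k) ->
  \sum_(k <- enum_fset S) F k <= \sum_(k <- enum_fset S') F k.
Proof.
move=> SS F0; rewrite [leRHS](big_fsetID _ (mem S))/= .
rewrite (_ : [fset x | x in S' & x \in S]%fset = S); first by rewrite lerDl sumr_ge0.
by apply/fsetP => k; rewrite !inE andbC; apply: andb_idr => kS; exact: (fsubsetP SS).
Qed.

Lemma bessel S f : cper f -> \sum_(k <- enum_fset S) fsq f k <= sqint f.
Proof.
move=> cf; apply: (le_trans (sum_fset_le (symmz_sub S) (fsq_ge0 f))).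
by have := sqint_ge0 (fun x => f x - proj (symmz S) f x);
  rewrite proj_dist ?subr_ge0//; exact: symm_symmz.
Qed.

Lemma trig_spectrum g : trig g -> exists S0, forall S, symm S -> (S0 `<=` S)%fset ->
  forall x, proj S g x = g x.
Proof.
elim => [k|k|f1 g1 t1 [S1 H1] t2 [S2 H2]|c f1 t1 [S1 H1]].
- exists [fset k]%fset => S sS; rewrite fsub1set => kS x; rewrite /proj /synth.
  rewrite (eq_bigr (fun l => 2^-1 * ((l == k)%:R * cosk l x + (l == - k)%:R * cosk l x))).
    by rewrite -mulr_sumr big_split/= !sum_pick sS kS coskN; field.
  move=> l _; rewrite /ccoef /scoef tint_cosk_cosk.
  have -> : tint (fun x => cosk k x * sink l x) = tint (fun x => sink l x * cosk k x) :> R.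
    by apply: eq_tint => z; rewrite mulrC.
  by rewrite tint_sink_cosk eq_sym [k == - l]eq_sym eqr_oppLR; ring.
- exists [fset k]%fset => S sS; rewrite fsub1set => kS x; rewrite /proj /synth.
  rewrite (eq_bigr (fun l => 2^-1 * ((l == k)%:R * sink l x - (l == - k)%:R * sink l x))).
    by rewrite -mulr_sumr big_split/= sumrN !sum_pick sS kS sinkN; field.
  move=> l _; rewrite /ccoef /scoef tint_sink_sink tint_sink_cosk.
  by rewrite eq_sym [k == - l]eq_sym eqr_oppLR; ring.
- exists (S1 `|` S2)%fset => S sS; rewrite fsubUset => /andP[h1 h2] x.
  rewrite -[in RHS](H1 S)// -[in RHS](H2 S)// /proj /synth -big_split/=.
  apply: eq_bigr => k _; have c1 := trig_cper t1; have c2 := trig_cper t2.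
  by rewrite ccoefD// scoefD//; ring.
- exists S1 => S sS h1 x; rewrite -[in RHS](H1 S)// /proj /synth mulr_sumr.
  apply: eq_bigr => k _; have c1 := trig_cper t1.
  by rewrite ccoefZ// scoefZ//; ring.
Qed.

(** Compare with a trigonometric polynomial g uniformly close to f: once S contains the spectrum of
    g, the projection fixes g, so the error for f is the error for f - g, which is at most the norm
    of f - g. *)
Lemma proj_cvg f (e : R) : cper f -> 0 < e -> exists S0, forall S, symm S ->
  (S0 `<=` S)%fset -> sqint (fun x => f x - proj S f x) <= e.
Proof.
(* The minimum with 1 ensures h^2 <= h <= e. *)
move=> cf e0; pose h := Num.min 1 e.
have h0 : 0 < h by rewrite lt_min ltr01.
have [N _ /(_ N (leqnn N)) HN] := nfejer_cvg cf h0.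
pose g := fun x => tint (fun y => nfejer N (x - y) * f y).
have tg : trig g by apply: trig_tint_conv => //; exact: trig_nfejer.
have cg := trig_cper tg.
have [S0 H0] := trig_spectrum tg; exists S0 => S sS SS.
have cfg := cperB cf cg.
rewrite (_ : (fun x => f x - _) = (fun x => (f x - g x) - proj S (fun x => f x - g x) x)); last first.
  apply/funext => x; rewrite -{1}[g x](H0 S)//.
  have -> : proj S (fun x => f x - g x) x = proj S f x - proj S g x.
    rewrite /proj /synth -sumrB; apply: eq_bigr => k _.
    by rewrite ccoefB// scoefB//; ring.
  ring.
rewrite proj_dist//; apply: (@le_trans _ _ (sqint (fun x => f x - g x))).
  by rewrite lerBlDr lerDl sumr_ge0// => k _; exact: fsq_ge0.
apply: le_trans (sqint_bound cfg HN) _.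
apply: (@le_trans _ _ h); last by rewrite ge_min lexx orbT.
by rewrite expr2 ler_piMl ?(ltW h0)// ge_min lexx.
Qed.

Lemma parseval f (e : R) : cper f -> 0 < e ->
  exists S, sqint f <= e + \sum_(k <- enum_fset S) fsq f k.
Proof.
move=> cf e0; have [S0 /(_ _ (symm_symmz S0) (symmz_sub S0))] := proj_cvg cf e0.
by rewrite proj_dist//; [rewrite lerBlDr; exists (symmz S0)|exact: symm_symmz].
Qed.

Lemma parseval_le f (B : R) : cper f ->
  (forall S, \sum_(k <- enum_fset S) fsq f k <= B) -> sqint f <= B.
Proof.
move=> cf H; apply/ler_addgt0Pr => e e0; have [S hS] := parseval cf e0.
by apply: le_trans hS _; rewrite addrC lerD2r.
Qed.

Lemma proj_partial S f i : C1 f -> partial i (proj S f) = proj S (partial i f).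
Proof.
move=> cf; rewrite /proj partial_synth; congr (synth S _ _); apply/funext => k.
  by rewrite ccoef_partial.
by rewrite scoef_partial.
Qed.

Lemma sqint_proj_le S f : symm S -> cper f -> sqint (proj S f) <= sqint f.
Proof.
move=> sS cf; rewrite sqint_synth//; first exact: bessel.
  by move=> k; exact: ccoefN.
by move=> k; exact: scoefN.
Qed.

(* [phi] is only assumed continuous; its [H^1] regularity is carried by [A]. *)
Lemma H1_duality phi f i (A : R) : cper phi -> C1 f -> 0 <= A ->
  (forall S, \sum_(k <- enum_fset S) freq k i ^+ 2 * fsq phi k <= A ^+ 2) ->
  `|tint (fun x => phi x * partial i f x)| <= A * nrm f.
Proof.
move=> cp cf A0 HA; have cdf := C1_partial i cf.
apply/ler_addgt0Pr => e e0.
pose q := e / (nrm (partial i f) + 1).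
have n1 : 0 < nrm (partial i f) + 1 by rewrite ltr_wpDl ?nrm_ge0.
have q0 : 0 < q by rewrite divr_gt0.
have [S0 /(_ _ (symm_symmz S0) (symmz_sub S0))] := proj_cvg cp (exprn_gt0 2 q0).
set S := symmz S0; have sS : symm S := symm_symmz S0.
set p := proj S phi => hp; have tp : trig p := trig_synth S _ _.
have cpp := trig_cper tp; have c1p := (trig_C1 tp).1.
have cB := cperB cp cpp.
have -> : tint (fun x => phi x * partial i f x) =
    tint (fun x => (phi x - p x) * partial i f x) + tint (fun x => p x * partial i f x).
  rewrite -tintD; [|exact: cperM|exact: cperM].
  by apply: eq_tint => x; ring.
rewrite addrC; apply: le_trans (ler_normD _ _) _; apply: lerD; last first.
  apply: le_trans (tint_le_nrm cB cdf) _.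
  apply: (@le_trans _ _ (q * nrm (partial i f))).
    apply: ler_wpM2r; first exact: nrm_ge0.
    by rewrite -(ler_pXn2r (ltn0Sn 1)) ?nnegrE ?nrm_ge0 ?(ltW q0)// nrm_sq.
  rewrite /q mulrAC ler_pdivrMr// ler_wpM2l ?(ltW e0)//.
  by rewrite lerDl.
have -> : tint (fun x => p x * partial i f x) = - tint (fun x => partial i p x * f x).
  by rewrite tint_by_parts// opprK.
rewrite normrN; apply: le_trans (tint_le_nrm (C1_partial i c1p) (C1_cper cf)) _.
apply: ler_wpM2r; first exact: nrm_ge0.
rewrite -(ler_pXn2r (ltn0Sn 1)) ?nnegrE ?nrm_ge0// nrm_sq /p partial_synth.
rewrite sqint_synth//.
- apply: le_trans (HA S); rewrite le_eqVlt; apply/orP; left; apply/eqP.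
  by apply: eq_bigr => k _; rewrite /fsq; ring.
- by move=> k; rewrite scoefN// /freq mxE mulrNz; ring.
- by move=> k; rewrite ccoefN// /freq mxE mulrNz; ring.
Qed.

End fourier.

(** * Convolutions and weak derivatives of the potential *)

Section conv.
Context {R : realType} {d : nat}.
Implicit Types (f g W : 'rV[R]_d -> R) (x y : 'rV[R]_d) (i : 'I_d) (k : 'rV[int]_d).

Lemma convE W f x : convolution W f x = tint (fun y => W (x - y) * f y).
Proof. by []. Qed.

Lemma cper_conv_integrand W f x : cper W -> cper f -> cper (fun y => W (x - y) * f y).
Proof. by move=> cW cf; apply: cperM => //; exact: cper_reflect. Qed.

Lemma convC W f : cper W -> cper f -> convolution W f = convolution f W.
Proof.
move=> cW cf; apply/funext => x; rewrite !convE -(tint_reflect x); last exact: cper_conv_integrand.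
by apply: eq_tint => y; rewrite opprB addrC subrK mulrC.
Qed.

Lemma cper_lim f : (forall e : R, 0 < e -> exists2 g, cper g & forall x, `|f x - g x| <= e) ->
  cper f.
Proof.
move=> H; split.
  move=> x i; apply/eqP; rewrite -subr_eq0 -normr_le0; apply/ler_addgt0Pr => e e0.
  have [|g cg hg] := H (e / 2); first by rewrite divr_gt0.
  rewrite add0r (_ : _ - _ = (f (x + unit_row i) - g (x + unit_row i)) - (f x - g x)); last first.
    by rewrite cg.1; ring.
  by apply: le_trans (ler_normB _ _) _; have := hg x; have := hg (x + unit_row i); lra.
move=> x; apply: (iffRL (@cvgrPdist_le _ _ _ (nbhs x) _ f (f x))) => e e0.
have e3 : 0 < e / 3 by rewrite divr_gt0.
have [g cg hg] := H _ e3.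
have /cvgrPdist_le/(_ _ e3) := cg.2 x; apply: filterS => y hy.
rewrite (_ : _ - _ = (f x - g x) - (f y - g y) + (g x - g y)); last by ring.
apply: le_trans (ler_normD _ _) _.
have := ler_normB (f x - g x) (f y - g y).
by have := hg x; have := hg y; lra.
Qed.

Lemma conv_le W f x (B : R) : cper W -> cper f -> (forall x, `|W x| <= B) ->
  `|convolution W f x| <= B * tint (fun y => `|f y|).
Proof.
move=> cW cf HB; rewrite convE; have ci := cper_conv_integrand x cW cf.
apply: le_trans (tint_norm ci) _; rewrite -tintZ; last exact: cper_norm.
apply: tint_le => [||y]; [exact: cper_norm|exact/cperZ/cper_norm|].
by rewrite normrM ler_wpM2r.
Qed.

Lemma convBl V W f x : cper V -> cper W -> cper f ->
  convolution (fun x => V x - W x) f x = convolution V f x - convolution W f x.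
Proof.
move=> cV cW cf; rewrite !convE -tintB; [|exact: cper_conv_integrand..].
by apply: eq_tint => y; rewrite mulrBl.
Qed.

Lemma convBr W f g x : cper W -> cper f -> cper g ->
  convolution W (fun x => f x - g x) x = convolution W f x - convolution W g x.
Proof.
move=> cW cf cg; rewrite !convE -tintB; [|exact: cper_conv_integrand..].
by apply: eq_tint => y; rewrite mulrBr.
Qed.

Lemma cper_conv W f : cper W -> cper f -> cper (convolution W f).
Proof.
move=> cW cf; apply: cper_lim => e e0.
pose q := e / (tint (fun y => `|f y|) + 1).
have I0 : 0 <= tint (fun y => `|f y|) by apply: tint_ge0.
have q0 : 0 < q by rewrite divr_gt0// ltr_wpDl.
have [N _ /(_ N (leqnn N)) HN] := nfejer_cvg cW q0.
pose V x := tint (fun y => nfejer N (x - y) * W y).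
have tV : trig V by apply: trig_tint_conv => //; exact: trig_nfejer.
exists (convolution V f); first by apply: trig_cper; exact: trig_tint_conv.
move=> x; rewrite -convBl//; last exact: trig_cper.
have cB := cperB cW (trig_cper tV).
apply: le_trans (conv_le x cB cf HN) _.
by rewrite /q mulrAC ler_pdivrMr ?ltr_wpDl// ler_wpM2l ?(ltW e0)// lerDl.
Qed.

(** The derivative is made to fall on f, so that W need only be continuous; commutativity first
    moves the parameter into the argument of f. *)
Lemma C1_conv W f : cper W -> C1 f -> C1 (convolution W f) /\
  forall i, partial i (convolution W f) = convolution W (partial i f).
Proof.
move=> cW cf; apply: C1_of_derive.
- exact: cper_conv cW (C1_cper cf).
- by move=> i; apply: cper_conv => //; exact: C1_partial.
- move=> i x.
  have cdf := C1_partial i cf.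
  pose F (s : R) y := W y * f (line x i s - y).
  pose dF (s : R) y := W y * partial i f (line x i s - y).
  have H : is_derive (0 : R) 1 (fun s => tint (F s)) (tint (dF 0)).
    apply: (@tint_derive _ _ F dF 0 1 ltr01).
    + move=> s _; apply: cperM => //; apply: cper_reflect; exact: C1_cper.
    + move=> s y _.
      have E : (fun s => F s y) = (fun s => W y * f (line (x - y) i s)).
        by apply/funext => t; rewrite /F /line addrA.
      rewrite E /dF (_ : line x i s - y = line (x - y) i s); last by rewrite /line addrA.
      have H := line_partial ((cf.2 i).1 (line (x - y) i s)).
      exact: (is_deriveZ (W y) H).
    + move=> y.
      apply: (@continuousM R _ (fun p : R * 'rV[R]_d => W p.2) (fun p => partial i f (line x i p.1 - p.2)) (0, y)).
        apply: (@continuous_comp _ _ _ (fun p : R * 'rV[R]_d => p.2) W); last exact: cW.2.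
        exact: cvg_snd.
      apply: (@continuous_comp _ _ _ (fun p : R * 'rV[R]_d => line x i p.1 - p.2) (partial i f)); last exact: cdf.2.
      apply: (@continuousB R _ _ (fun p : R * 'rV[R]_d => line x i p.1) (fun p => p.2) (0, y)); last exact: cvg_snd.
      apply: (@continuousD R _ _ (fun p : R * 'rV[R]_d => p.1 *: unit_row i) (fun p => x) (0, y)); last exact: cst_continuous.
      apply: (@continuous_comp _ _ _ (fun p : R * 'rV[R]_d => p.1) (fun s : R => s *: unit_row i)); first exact: cvg_fst.
      exact: scalel_continuous.
  have E s : convolution W f (line x i s) = tint (F s).
    rewrite convC//; last exact: C1_cper.
    by rewrite convE; apply: eq_tint => y; rewrite /F mulrC.
  have E0 : convolution W (partial i f) x = tint (dF 0).
    rewrite convC// convE; apply: eq_tint => y; rewrite /dF mulrC line0; congr (_ * _).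
  rewrite E0; move: H; rewrite -(funext E) => /(@derivable_line _ _ (convolution W f)) [h1 h2].
  by split => //; exact: h2.
Qed.

(** Fubini for the kernel W (x - y), by [cper_ind] on W: for a cosine or a sine the addition formula
    splits the kernel into products of functions of x and of y, and both sides become sums of
    products of coefficients. *)
Lemma conv_exchange (a : 'rV[R]_d -> R) W f : cper a -> cper W -> cper f ->
  tint (fun x => a x * convolution W f x) =
  tint (fun y => f y * tint (fun x => a x * W (x - y))).
Proof.
move=> ca + cf; move: W.
have cper_in W y : cper W -> cper (fun x => a x * W (x - y)).
  by move=> cW; apply: cperM => //; exact: cper_shift.
have bound W (B : R) : cper W -> (forall x, `|W x| <= B) ->
    forall y, `|tint (fun x => a x * W (x - y))| <= B * tint (fun x => `|a x|).
  move=> cW HB y; apply: le_trans (tint_norm (cper_in _ y cW)) _.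
  rewrite -tintZ; last exact: cper_norm.
  apply: tint_le => [||x]; [exact/cper_norm/cper_in|exact/cperZ/cper_norm|].
  by rewrite normrM mulrC ler_wpM2r.
have cper_out W : cper W -> cper (fun y => tint (fun x => a x * W (x - y))).
  move=> cW; rewrite (_ : (fun _ => _) = convolution (fun z => W (0 - z)) a).
    by apply: cper_conv => //; exact: cper_reflect.
  by apply/funext => y; rewrite convE; apply: eq_tint => x; rewrite sub0r opprB mulrC.
apply: cper_ind => [k|k|V W cV cW hV hW|c W cW hW|W cW H].
- rewrite (@eq_tint _ _ (fun x => a x * _) (fun x => ccoef f k * (a x * cosk k x) + scoef f k * (a x * sink k x))); last first.
    move=> x; rewrite convE /ccoef /scoef.
    rewrite (@eq_tint _ _ _ (fun y => cosk k x * (f y * cosk k y) + sink k x * (f y * sink k y))); last first.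
      by move=> y; rewrite /cosk /sink phaseD phaseN cosB; ring.
    rewrite tintD ?tintZ; do ?by [exact: cper_fc|exact: cper_fs|exact/cperZ/cper_fc|exact/cperZ/cper_fs].
    by ring.
  rewrite (@eq_tint _ _ (fun y => f y * _) (fun y => ccoef a k * (f y * cosk k y) + scoef a k * (f y * sink k y))); last first.
    move=> y; rewrite /ccoef /scoef.
    rewrite (@eq_tint _ _ _ (fun x => cosk k y * (a x * cosk k x) + sink k y * (a x * sink k x))); last first.
      by move=> x; rewrite /cosk /sink phaseD phaseN cosB; ring.
    rewrite tintD ?tintZ; do ?by [exact: cper_fc|exact: cper_fs|exact/cperZ/cper_fc|exact/cperZ/cper_fs].
    by ring.
  rewrite !tintD ?tintZ; do ?by [exact: cper_fc|exact: cper_fs|exact/cperZ/cper_fc|exact/cperZ/cper_fs].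
  by rewrite /ccoef /scoef; ring.
- rewrite (@eq_tint _ _ (fun x => a x * _) (fun x => ccoef f k * (a x * sink k x) - scoef f k * (a x * cosk k x))); last first.
    move=> x; rewrite convE /ccoef /scoef.
    rewrite (@eq_tint _ _ _ (fun y => sink k x * (f y * cosk k y) - cosk k x * (f y * sink k y))); last first.
      by move=> y; rewrite /cosk /sink phaseD phaseN sinB; ring.
    rewrite tintB ?tintZ; do ?by [exact: cper_fc|exact: cper_fs|exact/cperZ/cper_fc|exact/cperZ/cper_fs].
    by ring.
  rewrite (@eq_tint _ _ (fun y => f y * _) (fun y => scoef a k * (f y * cosk k y) - ccoef a k * (f y * sink k y))); last first.
    move=> y; rewrite /ccoef /scoef.
    rewrite (@eq_tint _ _ _ (fun x => cosk k y * (a x * sink k x) - sink k y * (a x * cosk k x))); last first.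
      by move=> x; rewrite /cosk /sink phaseD phaseN sinB; ring.
    rewrite tintB ?tintZ; do ?by [exact: cper_fc|exact: cper_fs|exact/cperZ/cper_fc|exact/cperZ/cper_fs].
    by ring.
  rewrite !tintB ?tintZ; do ?by [exact: cper_fc|exact: cper_fs|exact/cperZ/cper_fc|exact/cperZ/cper_fs].
  by rewrite /ccoef /scoef; ring.
- rewrite (@eq_tint _ _ (fun x => a x * convolution _ _ x) (fun x => a x * convolution V f x + a x * convolution W f x)); last first.
    move=> x; rewrite -mulrDr; congr (_ * _); rewrite !convE -tintD; [|exact: cper_conv_integrand..].
    by apply: eq_tint => y; rewrite mulrDl.
  rewrite (@eq_tint _ _ (fun y => f y * _) (fun y => f y * tint (fun x => a x * V (x - y)) + f y * tint (fun x => a x * W (x - y)))); last first.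
    move=> y; rewrite -mulrDr; congr (_ * _); rewrite -tintD; [|exact: cper_in..].
    by apply: eq_tint => x; rewrite mulrDr.
  rewrite (tintD (cperM ca (cper_conv cV cf)) (cperM ca (cper_conv cW cf))).
  by rewrite (tintD (cperM cf (cper_out _ cV)) (cperM cf (cper_out _ cW))) hV hW.
- rewrite (@eq_tint _ _ (fun x => a x * convolution _ _ x) (fun x => c * (a x * convolution W f x))); last first.
    move=> x; rewrite mulrCA; congr (_ * _); rewrite !convE -tintZ; last exact: cper_conv_integrand.
    by apply: eq_tint => y; rewrite mulrA.
  rewrite (@eq_tint _ _ (fun y => f y * _) (fun y => c * (f y * tint (fun x => a x * W (x - y))))); last first.
    move=> y; rewrite mulrCA; congr (_ * _); rewrite -tintZ; last exact: cper_in.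
    by apply: eq_tint => x; rewrite mulrCA.
  by rewrite (tintZ _ (cperM ca (cper_conv cW cf))) (tintZ _ (cperM cf (cper_out _ cW))) hW.
- apply/eqP; rewrite -subr_eq0 -normr_le0; apply/ler_addgt0Pr => e e0; rewrite add0r.
  set A := tint (fun x => `|a x|); set B := tint (fun y => `|f y|).
  have A0 : 0 <= A by apply: tint_ge0.
  have B0 : 0 <= B by apply: tint_ge0.
  (* Replacing W by V costs at most q A B on each side, and 2 q A B <= e; the added 1 covers A B =
     0. *)
  have [|V [cV hV HV]] := H (e / (2 * (A * B + 1))).
    by rewrite divr_gt0// mulr_gt0// ltr_wpDl// mulr_ge0.
  set q := e / _ in HV.
  have cWV := cperB cW cV.
  have h1 : `|tint (fun x => a x * convolution (fun z => W z - V z) f x)| <= q * (A * B).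
    have cc := cper_conv cWV cf.
    apply: le_trans (tint_norm (cperM ca cc)) _.
    rewrite mulrCA mulrC -tintZ; last exact: cper_norm.
    apply: tint_le => [||x]; [exact/cper_norm/cperM|exact/cperZ/cper_norm|].
    by rewrite normrM mulrC ler_wpM2r//; exact: conv_le.
  have h2 : `|tint (fun y => f y * tint (fun x => a x * (W (x - y) - V (x - y))))| <= q * (A * B).
    have cc := cper_out _ cWV.
    apply: le_trans (tint_norm (cperM cf cc)) _.
    rewrite mulrA -tintZ; last exact: cper_norm.
    apply: tint_le => [||y]; [exact/cper_norm/cperM|exact/cperZ/cper_norm|].
    by rewrite normrM mulrC ler_wpM2r//; exact: (bound _ _ cWV HV).
  have E1 : tint (fun x => a x * convolution (fun z => W z - V z) f x) =
      tint (fun x => a x * convolution W f x) - tint (fun x => a x * convolution V f x).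
    rewrite -(tintB (cperM ca (cper_conv cW cf)) (cperM ca (cper_conv cV cf))).
    by apply: eq_tint => x; rewrite convBl// mulrBr.
  have E2 : tint (fun y => f y * tint (fun x => a x * (W (x - y) - V (x - y)))) =
      tint (fun y => f y * tint (fun x => a x * W (x - y))) -
      tint (fun y => f y * tint (fun x => a x * V (x - y))).
    rewrite -(tintB (cperM cf (cper_out _ cW)) (cperM cf (cper_out _ cV))).
    apply: eq_tint => y; rewrite -mulrBr -tintB; [|exact: cper_in..].
    by congr (_ * _); apply: eq_tint => x; rewrite mulrBr.
  rewrite E1 in h1; rewrite E2 -hV in h2; move: h1 h2.
  move: (tint (fun x => a x * convolution W f x)) (tint (fun x => a x * convolution V f x))
    (tint (fun y => f y * tint (fun x => a x * W (x - y)))) => X Y Z h1 h2.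
  have AB0 : 0 <= A * B by rewrite mulr_ge0.
  rewrite (_ : X - Z = (X - Y) - (Z - Y)); last by ring.
  apply: le_trans (ler_normB _ _) _; apply: le_trans (lerD h1 h2) _.
  rewrite /q; move: (A * B) AB0 => AB AB0.
  have p0 : 0 < 2 * (AB + 1) by rewrite mulr_gt0// ltr_wpDl.
  rewrite -mulrDl -mulrDl mulrAC ler_pdivrMr//.
  rewrite -subr_ge0 (_ : _ - _ = 2 * e); last by ring.
  by rewrite mulr_ge0// ltW.
Qed.

(** Real part of the product of the complex coefficients [ccoef - i scoef] of W and f; [scoef_conv]
    is the imaginary part up to sign. *)
Lemma ccoef_conv W f k : cper W -> cper f ->
  ccoef (convolution W f) k = ccoef W k * ccoef f k - scoef W k * scoef f k.
Proof.
move=> cW cf; have cc := @cper_cosk R d k.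
rewrite /ccoef (@eq_tint _ _ _ (fun x => cosk k x * convolution W f x)); last by move=> x; rewrite mulrC.
rewrite conv_exchange// (@eq_tint _ _ _ (fun y => ccoef W k * (f y * cosk k y) - scoef W k * (f y * sink k y))).
  rewrite tintB ?tintZ//; by [exact: cper_fc|exact: cper_fs|exact/cperZ/cper_fc|exact/cperZ/cper_fs].
move=> y; rewrite -(@tint_shift _ _ y (fun x => cosk k x * W (x - y))); last first.
  by apply: cperM => //; exact: cper_shift.
rewrite (@eq_tint _ _ _ (fun x => cosk k y * (W x * cosk k x) - sink k y * (W x * sink k x))); last first.
  by move=> x; rewrite addrK /cosk /sink phaseD cosD; ring.
rewrite tintB ?tintZ; do ?by [exact: cper_fc|exact: cper_fs|exact/cperZ/cper_fc|exact/cperZ/cper_fs].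
by rewrite /ccoef /scoef; ring.
Qed.

Lemma scoef_conv W f k : cper W -> cper f ->
  scoef (convolution W f) k = scoef W k * ccoef f k + ccoef W k * scoef f k.
Proof.
move=> cW cf; have cc := @cper_sink R d k.
rewrite /scoef (@eq_tint _ _ _ (fun x => sink k x * convolution W f x)); last by move=> x; rewrite mulrC.
rewrite conv_exchange// (@eq_tint _ _ _ (fun y => scoef W k * (f y * cosk k y) + ccoef W k * (f y * sink k y))).
  rewrite tintD ?tintZ//; by [exact: cper_fc|exact: cper_fs|exact/cperZ/cper_fc|exact/cperZ/cper_fs].
move=> y; rewrite -(@tint_shift _ _ y (fun x => sink k x * W (x - y))); last first.
  by apply: cperM => //; exact: cper_shift.
rewrite (@eq_tint _ _ _ (fun x => cosk k y * (W x * sink k x) + sink k y * (W x * cosk k x))); last first.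
  by move=> x; rewrite addrK /cosk /sink phaseD sinD; ring.
rewrite tintD ?tintZ; do ?by [exact: cper_fc|exact: cper_fs|exact/cperZ/cper_fc|exact/cperZ/cper_fs].
by rewrite /ccoef /scoef; ring.
Qed.

Lemma fsq_conv W f k : cper W -> cper f -> fsq (convolution W f) k = fsq W k * fsq f k.
Proof. by move=> cW cf; rewrite /fsq ccoef_conv// scoef_conv//; ring. Qed.

End conv.

(** * Consequences of bounds on weak derivatives *)

Section weak.
Context {R : realType} {d : nat}.
Implicit Types (f g W psi : 'rV[R]_d -> R) (x y : 'rV[R]_d) (i : 'I_d) (k : 'rV[int]_d).
Local Notation mu := (torus_measure R d).

Lemma Loo_norm_tint g psi (m : R) : mu.-integrable setT (EFin \o g) ->
  (Loo_norm g <= m%:E)%E -> cper psi -> (forall x, 0 <= psi x) ->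
  `|\int[mu]_x (g x * psi x)| <= m * tint psi.
Proof.
move=> ig Lg cpsi psi0.
have ae : {ae mu, forall x, (`|(g x)%:E| <= m%:E)%E}.
  have : (ess_sup mu (abse \o (EFin \o g)) <= m%:E)%E.
    have -> : ess_sup mu (abse \o (EFin \o g)) = Loo_norm g.
      rewrite /Loo_norm unlock /=; case: ifPn => //.
      by have /= -> := probability_setT mu; rewrite lte01.
    by [].
  by move/ess_supP; apply: filterS => x.
have igp : mu.-integrable setT (EFin \o (fun x => g x * psi x)).
  rewrite (_ : EFin \o _ = ((EFin \o g) \* (EFin \o psi))%E); last first.
    by apply/funext => x /=; rewrite EFinM.
  apply: integrableMl => //; first exact: continuous_row_measurable cpsi.2.
  have [B _ HB] := cper_bounded cpsi.
  exists B; split; first exact: num_real.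
  by move=> M BM x _; exact: le_trans (HB x) (ltW BM).
have ip := cper_integrable (cperZ m cpsi).
rewrite -tintZ//; apply: le_trans (le_normr_Rintegral _ igp) _ => //.
have /integrableP [mgp _] := igp.
have ign : mu.-integrable setT (EFin \o (fun x => `|g x * psi x|)).
  by have := integrable_abse igp; apply: eq_integrable.
rewrite -lee_fin /tint /Rintegral !fineK//; do ?exact: integrable_fin_num.
(* The sign of m is first obtained almost everywhere; being independent of x it then holds outright,
   since the torus has nonzero measure. *)
have m0 : {ae mu, forall x, 0 <= m}.
  move: ae; apply: filterS => x; rewrite lee_fin; exact: le_trans.
apply: ae_ge0_le_integral => //.
- exact: (measurable_int _ ign).
- move=> x _; rewrite lee_fin mulr_ge0//.
  suff : mu (setT : set 'rV[R]_d) != 0%E.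
    move=> h; rewrite leNgt; apply/negP => mn; move: h; apply/negP; rewrite negbK.
    have [N [mN N0 sN]] := m0; apply/eqP; apply: (subset_measure0 _ _ _ N0) => //.
    by move=> z _; apply: sN => /= H; move: H; rewrite leNgt mn.
  by have /= -> := probability_setT mu; rewrite onee_eq0.
- exact: (measurable_int _ ip).
- move: ae; apply: filterS => x; rewrite !lee_fin => h _.
  by rewrite normrM (ger0_norm (psi0 x)) ler_wpM2r.
Qed.

Lemma sub_conv_trig_partial (s : seq 'I_d) n x :
  iter_partial s (fun y => nfejer n (x - y)) =
  fun y => (-1) ^+ size s * iter_partial s (@nfejer R d n) (x - y).
Proof.
have H g i : C1 g -> partial i (fun y => g (x - y)) = fun y => - partial i g (x - y).
  move=> cg; apply/funext => y.
  have H : is_derive (0 : R) 1 (fun s => g (x - line y i s)) (- partial i g (x - y)).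
    rewrite (_ : (fun s => _) = (fun s => (fun t => g (line (x - y) i t)) (- s))); last first.
      by apply/funext => t; rewrite /line scaleNr opprD addrCA.
    rewrite -mulrN1.
    apply: (@is_derive_comp_R _ (fun t => g (line (x - y) i t)) (fun t => - t) 0 (partial i g (x - y)) (-1)).
    by rewrite oppr0 -{2}[x - y](line0 _ i); apply: line_partial; exact: (cg.2 i).1.
  by have [_ ->] := @derivable_line _ _ (fun y => g (x - y)) i y _ H.
elim: s => [|i s IH]; first by apply/funext => y; rewrite expr0 mul1r.
have ts : trig (iter_partial s (@nfejer R d n)).
  by elim: (s) => [|j t IHt] /=; [exact: trig_nfejer|exact: (trig_C1 IHt).2].
rewrite [LHS]/= IH.
have [c1 _] := trig_C1 ts.
have [c2 p2] := C1Z ((-1) ^+ size s) (trig_C1 (trig_reflect x ts)).1.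
by rewrite p2 H//; apply/funext => y /=; rewrite exprS; ring.
Qed.

Definition mollify n W : 'rV[R]_d -> R := convolution (nfejer n) W.

Lemma trig_mollify n W : cper W -> trig (mollify n W).
Proof. by move=> cW; apply: trig_tint_conv => //; exact: trig_nfejer. Qed.

Lemma iter_partial_mollify n W (s : seq 'I_d) : cper W ->
  iter_partial s (mollify n W) = convolution (iter_partial s (@nfejer R d n)) W.
Proof.
move=> cW; have ts (t : seq 'I_d) : trig (iter_partial t (@nfejer R d n)).
  by elim: t => [|j t IHt] /=; [exact: trig_nfejer|exact: (trig_C1 IHt).2].
elim: s => [//|i s IH] /=; rewrite IH.
have [c1 _] := trig_C1 (ts s).
rewrite [in LHS]convC//; last exact: C1_cper.
have [_ ->] := C1_conv cW c1; rewrite convC//; exact: (C1_partial i c1).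
Qed.

(** The derivatives of the mollified W fall on the kernel, which is a smooth test function, and are
    transferred to a weak derivative g of W; a nonnegative kernel of mass one preserves the bound on
    g. The strict inequality is what extracts such a g from the infimum. *)
Lemma mollify_partial_bound n W (s : seq 'I_d) (m : R) : cper W ->
  (weak_partial_norm s W < m%:E)%E ->
  forall x, `|iter_partial s (mollify n W) x| <= m.
Proof.
move=> cW /ereal_inf_lt [_ [g [_ ig wg] <-] /ltW Lg] x.
have tp := trig_reflect x (@trig_nfejer R d n).
have cp := trig_cper tp.
rewrite iter_partial_mollify// convE.
have := wg _ (trig_smooth tp); rewrite sub_conv_trig_partial => E.
have ts : trig (iter_partial s (@nfejer R d n)).
  by elim: (s) => [|j t IHt] /=; [exact: trig_nfejer|exact: (trig_C1 IHt).2].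
have -> : tint (fun y => iter_partial s (@nfejer R d n) (x - y) * W y) =
   \int[mu]_y (g y * nfejer n (x - y)).
  have cc := cper_conv_integrand x (trig_cper ts) cW.
  have E2 : (-1) ^+ size s * tint (fun y => iter_partial s (@nfejer R d n) (x - y) * W y) =
     (-1) ^+ size s * \int[mu]_y (g y * nfejer n (x - y)).
    rewrite -E -tintZ//; apply: eq_tint => y; ring.
  move: E2 => /(congr1 (fun z => (-1) ^+ size s * z)).
  by rewrite !mulrA -exprD -signr_odd oddD addbb expr0 !mul1r.
have := Loo_norm_tint ig Lg cp (fun y => nfejer_ge0 n (x - y)).
by rewrite tint_trig_reflect ?tint_nfejer ?mulr1//; exact: trig_nfejer.
Qed.

Lemma conv_limit_bound W f (m B : R) x : cper W -> cper f ->
  (forall n, `|convolution (mollify n W) f x| <= m * B) -> `|convolution W f x| <= m * B.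
Proof.
move=> cW cf H; apply/ler_addgt0Pr => e e0.
pose q := e / (tint (fun y => `|f y|) + 1).
have I0 : 0 <= tint (fun y => `|f y|) by apply: tint_ge0.
have q0 : 0 < q by rewrite divr_gt0// ltr_wpDl.
have [N _ /(_ N (leqnn N)) HN] := nfejer_cvg cW q0.
have cV := trig_cper (trig_mollify N cW).
rewrite -[convolution W f x](subrK (convolution (mollify N W) f x)) -convBl//.
rewrite addrC; apply: le_trans (ler_normD _ _) _; apply: lerD; first exact: H.
apply: le_trans (conv_le x (cperB cW cV) cf HN) _.
by rewrite /q mulrAC ler_pdivrMr ?ltr_wpDl// ler_wpM2l ?(ltW e0)// lerDl.
Qed.

Lemma conv_partialC W f i : C1 W -> C1 f ->
  convolution W (partial i f) = convolution (partial i W) f.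
Proof.
move=> cW cf; have [_ <-] := C1_conv (C1_cper cW) cf.
rewrite convC; [|exact: C1_cper..].
have [_ ->] := C1_conv (C1_cper cf) cW.
by rewrite convC//; [exact: C1_cper|exact: C1_partial].
Qed.

Lemma weak_conv1 W f i (m : R) x : cper W -> C1 f ->
  (weak_partial_norm [:: i] W < m%:E)%E ->
  `|convolution W (partial i f) x| <= m * tint (fun y => `|f y|).
Proof.
move=> cW cf Hm; apply: (conv_limit_bound cW (C1_partial i cf)) => n.
have tm := trig_mollify n cW.
rewrite (conv_partialC i (trig_C1 tm).1 cf).
apply: conv_le; [exact: trig_cper ((trig_C1 tm).2 i)|exact: C1_cper|].
exact: (mollify_partial_bound n cW Hm).
Qed.

Lemma weak_conv2 W f i (m : R) x : cper W -> C1 f -> C1 (partial i f) ->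
  (weak_partial_norm [:: i; i] W < m%:E)%E ->
  `|convolution W (partial i (partial i f)) x| <= m * tint (fun y => `|f y|).
Proof.
move=> cW cf cdf Hm; apply: (conv_limit_bound cW (C1_partial i cdf)) => n.
have tm := trig_mollify n cW; have [c1 t1] := trig_C1 tm.
rewrite (conv_partialC i c1 cdf) (conv_partialC i (trig_C1 (t1 i)).1 cf).
apply: conv_le; [exact: trig_cper ((trig_C1 (t1 i)).2 i)|exact: C1_cper|].
exact: (mollify_partial_bound n cW Hm).
Qed.

Lemma weak_partial_norm_ge0 (s : seq 'I_d) W : (0 <= weak_partial_norm s W)%E.
Proof. by apply: le_ereal_inf_tmp => _ [g _ <-]; exact: Lnorm_ge0. Qed.

Lemma lee_sum_term (I : finType) (P : pred I) (F : I -> \bar R) (i0 : I) :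
  P i0 -> (forall j, 0 <= F j)%E -> (F i0 <= \sum_(j | P j) F j)%E.
Proof. by move=> Pi F0; rewrite (bigD1 i0)//= leeDl// sume_ge0. Qed.

Lemma W2oo_norm_ge (W : 'rV[R]_d -> R) :
  (forall i, (weak_partial_norm [:: i] W <= W2oo_norm W)%E) /\
  (forall i, (weak_partial_norm [:: i; i] W <= W2oo_norm W)%E).
Proof.
have L0 : (0 <= Loo_norm W)%E by exact: Lnorm_ge0.
have S1 : (0 <= \sum_(i < d) weak_partial_norm [:: i] W)%E.
  by apply: sume_ge0 => i _; exact: weak_partial_norm_ge0.
have S2 : (0 <= \sum_(i < d) \sum_(j < d | (i <= j)%N) weak_partial_norm [:: i; j] W)%E.
  by apply: sume_ge0 => i _; apply: sume_ge0 => j _; exact: weak_partial_norm_ge0.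
split => i; rewrite /W2oo_norm.
  apply: (@le_trans _ _ (\sum_(i < d) weak_partial_norm [:: i] W)%E).
    exact: (@lee_sum_term _ xpredT (fun j => weak_partial_norm [:: j] W) i isT (fun j => weak_partial_norm_ge0 [:: j] W)).
  apply: le_trans (leeDl _ S2); exact: leeDr.
apply: (@le_trans _ _ (\sum_(i < d) \sum_(j < d | (i <= j)%N) weak_partial_norm [:: i; j] W)%E).
  apply: (@le_trans _ _ (\sum_(j < d | (i <= j)%N) weak_partial_norm [:: i; j] W)%E).
    exact: (@lee_sum_term _ (fun j : 'I_d => (i <= j)%N) (fun j => weak_partial_norm [:: i; j] W) i (leqnn i) (fun j => weak_partial_norm_ge0 [:: i; j] W)).
  apply: (@lee_sum_term _ xpredT (fun l : 'I_d => \sum_(j < d | (l <= j)%N) weak_partial_norm [:: l; j] W)%E i isT) => l.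
  by apply: sume_ge0 => j _; exact: weak_partial_norm_ge0.
by apply: leeDr; exact: adde_ge0.
Qed.

Lemma W2oo_norm_ge0 W : (0 <= W2oo_norm W)%E.
Proof.
rewrite /W2oo_norm !adde_ge0//; first exact: Lnorm_ge0.
- by apply: sume_ge0 => i _; exact: weak_partial_norm_ge0.
- by apply: sume_ge0 => i _; apply: sume_ge0 => j _; exact: weak_partial_norm_ge0.
Qed.

Lemma le_of_eps (a b I : R) : 0 <= I -> (forall m, b < m -> a <= m * I) -> a <= b * I.
Proof.
move=> I0 H; apply/ler_addgt0Pr => e e0.
have I1 : 0 < I + 1 by rewrite ltr_wpDl.
apply: le_trans (H (b + e / (I + 1)) _) _; first by rewrite ltrDl divr_gt0.
by rewrite mulrDl lerD2l mulrAC ler_pdivrMr// ler_wpM2l ?(ltW e0)// lerDl.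
Qed.

(** For a probability density f the right-hand side is M, which bounds the drift; for the difference
    u of two solutions it is at most M times the L^2 norm of u. *)
Lemma W2oo_conv1 W f i (M : R) x : cper W -> C1 f -> (W2oo_norm W <= M%:E)%E ->
  `|convolution W (partial i f) x| <= M * tint (fun y => `|f y|).
Proof.
move=> cW cf HM; apply: le_of_eps => [|m Mm]; first by apply: tint_ge0.
apply: weak_conv1 => //; apply: le_lt_trans ((W2oo_norm_ge W).1 i) _.
by apply: le_lt_trans HM _; rewrite lte_fin.
Qed.

Lemma W2oo_conv2 W f i (M : R) x : cper W -> C1 f -> C1 (partial i f) ->
  (W2oo_norm W <= M%:E)%E ->
  `|convolution W (partial i (partial i f)) x| <= M * tint (fun y => `|f y|).
Proof.
move=> cW cf cdf HM; apply: le_of_eps => [|m Mm]; first by apply: tint_ge0.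
apply: weak_conv2 => //; apply: le_lt_trans ((W2oo_norm_ge W).2 i) _.
by apply: le_lt_trans HM _; rewrite lte_fin.
Qed.

End weak.

(** * Weak time derivatives *)

(** The product rule computation for [bump]: s and x stand for the value and derivative of [sp], y
    and z for those of the polynomial p, E for the exponential and c for [eps]. *)
Lemma bump_derive_identity {F : fieldType} (s E x y z c : F) (n : nat) : s != 0 ->
  y * s ^- n * (E * - (c * (- s ^- 2 * x))) +
  E * (y * (n%:R * s ^- n.-1 * (- s ^- 2 * x)) + s ^- n * z) =
  (z * s ^+ 2 - n%:R * (y * x * s) + c * (y * x)) * s ^- n.+2 * E.
Proof.
move=> s0; have sm m : s ^+ m != 0 by rewrite expf_neq0.
have -> : s ^+ n.+2 = s ^+ n * s ^+ 2 by rewrite -exprD addn2.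
case: n => [|n] /=; first by rewrite expr0; field; rewrite ?s0 ?oner_neq0.
by rewrite exprS; field; rewrite s0 sm.
Qed.

(** * Smooth bump functions *)

Section bump.
Context {R : realType}.
Variables (a b eps : R).
Hypotheses (ab : a < b) (eps0 : 0 < eps).
Implicit Types (p q : {poly R}) (n : nat) (t : R).

Let sp : {poly R} := ('X - a%:P) * (b%:P - 'X).

Let spE t : sp.[t] = (t - a) * (b - t).
Proof. by rewrite /sp !hornerE. Qed.

Let sp_gt0 t : a < t < b -> 0 < sp.[t].
Proof. by move=> /andP[h1 h2]; rewrite spE mulr_gt0// subr_gt0. Qed.

(* As p runs over the polynomials and n over nat, this family is closed under
   differentiation, which gives the smoothness of bump functions. *)
Definition bump p n t : R :=
  if a < t < b then p.[t] * sp.[t] ^- n * expR (- (eps * sp.[t]^-1)) else 0.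

Let bump_bound p n : exists2 C : R, 0 <= C & forall t, `|bump p n t| <= C * sp.[t] ^+ 2.
Proof.
have [B B0 HB] : exists2 B : R, 0 <= B & forall t, a < t < b -> `|p.[t]| <= B.
  have := @compact_bounded _ _ _ (@continuous_compact _ _ (fun t : R => p.[t]) `[a, b]%classic
    (continuous_subspaceT (@continuous_horner R p)) (@segment_compact R a b)).
  move=> [B [_ HB]]; exists (`|B| + 1); first by rewrite addr_ge0.
  move=> t /andP[h1 h2]; apply: HB; first by rewrite ltr_pwDr// ler_norm.
  by exists t => //=; rewrite in_itv/= !ltW.
(* With this q, eps / s = m / (q s), and exp (1/(q s)) >= 1/(q s) bounds the exponential by (q s)^m.
   The two extra powers in m leave s^2 after division by s^n. *)
pose m := n.+2; pose q : R := m%:R / eps.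
have q0 : 0 < q by rewrite divr_gt0.
exists (B * q ^+ m); first by rewrite mulr_ge0// exprn_ge0// ltW.
move=> t; rewrite /bump; case: ifPn => tab; last by rewrite normr0 mulr_ge0// ?sqr_ge0// mulr_ge0// exprn_ge0// ltW.
have s0 := sp_gt0 tab; set s := sp.[t] in s0 *.
have h : expR (- (eps * s^-1)) <= q ^+ m * s ^+ m.
  have qs : 0 < (q * s) ^+ m by apply: exprn_gt0; exact: mulr_gt0.
  rewrite expRN -exprMn -[leRHS]invrK lef_pV2 ?posrE ?expR_gt0 ?invr_gt0//.
  have -> : eps * s^-1 = m%:R * (q * s)^-1.
    by rewrite /q; field; rewrite !gt_eqF.
  have qs0 : 0 <= (q * s)^-1 by rewrite invr_ge0 ltW//; exact: mulr_gt0.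
  rewrite expRM_natl -exprVn ler_pXn2r// ?nnegrE ?expR_ge0//.
  by apply: le_trans (expR_ge1Dx _); rewrite lerDr.
rewrite !normrM (ger0_norm (expR_ge0 _)) [X in _ * X * _]ger0_norm ?invr_ge0 ?exprn_ge0 ?(ltW s0)//.
apply: (@le_trans _ _ (B * s ^- n * (q ^+ m * s ^+ m))).
  apply: ler_pM => //; first by rewrite mulr_ge0// invr_ge0 exprn_ge0// ltW.
  by apply: ler_wpM2r; [rewrite invr_ge0 exprn_ge0// ltW|exact: HB].
rewrite le_eqVlt; apply/orP; left; apply/eqP.
rewrite /m -addn2 [s ^+ (n + 2)]exprD; field.
by rewrite expf_neq0// gt_eqF.
Qed.

Let bump_derive p n : exists q m, forall t, is_derive t 1 (bump p n) (bump q m t).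
Proof.
pose dsp := sp^`().
pose q := p^`() * sp ^+ 2 - n%:R *: (p * dsp * sp) + eps *: (p * dsp).
exists q, n.+2 => t.
have [tab|tab] := boolP (a < t < b).
  have s0 := sp_gt0 tab.
  apply: (@near_eq_is_derive _ _ _ (fun t => p.[t] * sp.[t] ^- n * expR (- (eps * sp.[t]^-1)))).
    have : \forall u \near t, a < u < b.
      have : open `]a, b[%classic by exact: interval_open.
      rewrite openE => /(_ t) /=; rewrite in_itv/= => /(_ tab).
      by apply: filterS => u /=; rewrite in_itv.
    by apply: filterS => u uab; rewrite /bump uab.
  have Ds : is_derive t 1 (fun t => sp.[t]) dsp.[t] by exact: is_derive_poly.
  have Di : is_derive t 1 (fun t => sp.[t]^-1) (- (sp.[t] ^- 2) * dsp.[t]).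
    exact: (is_deriveV (lt0r_neq0 s0) Ds).
  have Dn : is_derive t 1 (fun t => sp.[t] ^- n) (n%:R * sp.[t] ^- n.-1 * (- (sp.[t] ^- 2) * dsp.[t])).
    rewrite (_ : (fun t => _) = (fun t => (sp.[t]^-1) ^+ n)); last by apply/funext => u; rewrite exprVn.
    have De : is_derive (sp.[t]^-1) (1 : R) (fun u : R => u ^+ n) (n%:R * (sp.[t]^-1) ^+ n.-1).
      apply: DeriveDef; first exact: exprn_derivable.
      by rewrite exp_derive [_ *: 1]mulr1.
    by have := is_derive_comp_R Di De; rewrite exprVn.
  have De : is_derive t 1 (fun t => expR (- (eps * sp.[t]^-1)))
      (expR (- (eps * sp.[t]^-1)) * (- (eps * (- (sp.[t] ^- 2) * dsp.[t])))).
    apply: is_derive_comp_R; exact: (is_deriveN (is_deriveZ eps Di)).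
  have Dp : is_derive t 1 (fun t => p.[t]) p^`().[t] by exact: is_derive_poly.
  apply: (is_derive_eq (is_deriveM (is_deriveM Dp Dn) De)).
  have qE : q.[t] = p^`().[t] * sp.[t] ^+ 2 - n%:R * (p.[t] * dsp.[t] * sp.[t]) + eps * (p.[t] * dsp.[t]).
    by rewrite /q !(hornerD, hornerN, hornerM, hornerZ, horner_exp).
  rewrite /bump tab qE.
  move: s0; set s := sp.[t]; set E := expR _; set x := dsp.[t]; set y := p.[t]; set z := p^`().[t] => s0.
  apply: (@etrans _ _ (y * s ^- n * (E * - (eps * (- s ^- 2 * x))) + E * (y * (n%:R * s ^- n.-1 * (- s ^- 2 * x)) + s ^- n * z))) => //.
  by apply: bump_derive_identity; rewrite gt_eqF.
have -> : bump q n.+2 t = 0 by rewrite /bump (negbTE tab).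
have bt0 : bump p n t = 0 by rewrite /bump (negbTE tab).
have [C C0 HC] := bump_bound p n.
(* If t is outside ]a, b[, an interior point h + t lies within |h| of an endpoint, so [sp] is at
   most (b - a) |h| there. The difference quotient is then O(h), which settles the endpoints too. *)
have H (h : R) : `|bump p n (h + t)| <= C * ((b - a) * h) ^+ 2.
  have [uab|uab] := boolP (a < h + t < b); last first.
    by rewrite /bump (negbTE uab) normr0 mulr_ge0// sqr_ge0.
  apply: le_trans (HC _) _; apply: ler_wpM2l => //.
  have s0 := sp_gt0 uab.
  rewrite -[leRHS]real_normK ?num_real// ler_pXn2r ?nnegrE ?(ltW s0)//.
  rewrite spE normrM (gtr0_norm (_ : 0 < b - a)) ?subr_gt0//.
  move: uab => /andP[u1 u2]; move: tab; rewrite negb_and -!leNgt => /orP[ta|tb].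
    rewrite mulrC; apply: ler_pM; rewrite ?subr_ge0 ?(ltW u1) ?(ltW u2)//; first lra.
    by rewrite ler_normr; apply/orP; left; lra.
  apply: ler_pM; rewrite ?subr_ge0 ?(ltW u1) ?(ltW u2)//; first lra.
  by rewrite ler_normr; apply/orP; right; lra.
suff L : h^-1 *: (bump p n (h *: (1 : R) + t) - bump p n t) @[h --> 0^'] --> (0 : R).
  by split; [apply/cvg_ex; exists 0|exact/cvg_lim].
apply/cvgrPdist_le => e e0; rewrite bt0.
pose D := C * (b - a) ^+ 2 + 1.
have D0 : 0 < D by rewrite ltr_wpDl// mulr_ge0// sqr_ge0.
near=> h; rewrite sub0r normrN subr0 [_%:A]mulr1 [_ *: _]/(_ * _) normrM.
have h0 : h != 0 by near: h; exact: nbhs_dnbhs_neq.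
apply: (@le_trans _ _ (`|h|^-1 * (C * ((b - a) * h) ^+ 2))).
  by rewrite normfV ler_wpM2l ?invr_ge0.
have -> : `|h|^-1 * (C * ((b - a) * h) ^+ 2) = (C * (b - a) ^+ 2) * `|h|.
  by rewrite exprMn -[h ^+ 2]real_normK ?num_real//; field; rewrite normr_eq0.
apply: (@le_trans _ _ (D * `|h|)); first by rewrite ler_wpM2r// lerDl.
rewrite mulrC -ler_pdivlMr//.
near: h; apply: dnbhs0_le; exact: divr_gt0.
Unshelve. all: by end_near. Qed.

Lemma bump_smooth p n k t : derivable (derive1n k (bump p n)) t 1.
Proof.
have [q [m H]] : exists q m, forall t, derive1n k (bump p n) t = bump q m t.
  elim: k => [|k [q [m IH]]]; first by exists p, n.
  have [q' [m' H]] := bump_derive q m; exists q', m' => u.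
  rewrite derive1nS (funext IH) derive1E; by have [_ ->] := H u.
have [q' [m' H']] := bump_derive q m.
by rewrite (funext H); have [] := H' t.
Qed.

(** As [eps] tends to 0, these functions tend to the indicator of ]a, b[ while staying in [0, 1]. *)
Definition bump1 := bump 1 0%N.

Lemma bump1E t : bump1 t = if a < t < b then expR (- (eps * ((t - a) * (b - t))^-1)) else 0.
Proof. by rewrite /bump1 /bump spE hornerE expr0 invr1 !mul1r. Qed.

Lemma bump1_derivable t : derivable bump1 t 1.
Proof. exact: (@bump_smooth 1 0%N 0%N t). Qed.

Lemma bump1_derive_continuous : continuous (derive1 bump1).
Proof.
move=> t; apply: differentiable_continuous; apply/derivable1_diffP.
exact: (@bump_smooth 1 0%N 1%N t).
Qed.

Lemma bump1_test (t0 : R) : 0 < a -> b < t0 -> time_test t0 bump1.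
Proof.
move=> a0 bt; split; first by move=> n t; exact: bump_smooth.
exists a, b; split => // t; rewrite bump1E; case: ifPn => [/andP[h1 h2] _|_ /eqP//].
by rewrite !ltW.
Qed.

Lemma bump1_le1 t : 0 <= bump1 t <= 1.
Proof.
rewrite bump1E; case: ifPn => [tab|_]; last by rewrite lexx ler01.
rewrite expR_ge0 -[leRHS]expR0 ler_expR oppr_le0 mulr_ge0 ?(ltW eps0)//.
by rewrite invr_ge0 -spE ltW// sp_gt0.
Qed.

Lemma bump1_out t : ~~ (a < t < b) -> bump1 t = 0 /\ derive1 bump1 t = 0.
Proof.
move=> tab; split; first by rewrite bump1E (negbTE tab).
have [q [m H]] := bump_derive 1 0%N.
by rewrite derive1E; have [_ ->] := H t; rewrite /bump (negbTE tab).
Qed.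

End bump.

(** * The fundamental lemma of the calculus of variations in time *)

Section variation.
Context {R : realType}.
Local Notation leb := (@lebesgue_measure R).

Lemma Rintegral_sub_itv (f : R -> R) (a b t0 : R) : 0 <= a -> b <= t0 ->
  (forall t, ~~ (a < t < b) -> f t = 0) ->
  \int[leb]_(t in `[0, t0]) f t = \int[leb]_(t in `]a, b[) f t.
Proof.
move=> a0 bt H; rewrite Rintegral_mkcond [RHS]Rintegral_mkcond; congr (Rintegral _ _ _).
apply/funext => t; rewrite !patchE !mem_setE !in_itv/=.
have [/andP[h1 h2]|h] := boolP (a < t < b).
  by rewrite (le_trans a0 (ltW h1)) (le_trans (ltW h2) bt).
by rewrite H//; case: ifP.
Qed.

Lemma Rintegral_itv_oo_cc (f : R -> R) (a b : R) : a < b ->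
  leb.-integrable `[a, b] (EFin \o f) ->
  \int[leb]_(t in `]a, b[) f t = \int[leb]_(t in `[a, b]) f t.
Proof.
move=> ab fi.
have s1 : `]a, b] `<=` `[a, b] by apply: subset_itvr; rewrite bnd_simp.
have s2 : `]a, b[ `<=` `[a, b] by exact: subset_itv_oo_cc.
rewrite Rintegral_itv_bndo_bndc; last exact: integrableS fi.
by rewrite Rintegral_itv_obnd_cbnd//; exact: integrableS fi.
Qed.

Variables (t0 : R) (F dF G : R -> R).
Hypothesis (dFP : forall t, 0 < t < t0 -> is_derive t 1 F (dF t)).
Hypothesis (cdF : forall t, 0 < t < t0 -> {for t, continuous dF}).
Hypothesis (iG : leb.-integrable `[0, t0] (EFin \o G)).
Hypothesis (weak : forall eta, time_test t0 eta ->
  \int[leb]_(t in `[0, t0]) (F t * derive1 eta t) = - \int[leb]_(t in `[0, t0]) (G t * eta t)).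

Let within_cdF (a b : R) : 0 < a -> b < t0 -> {within `[a, b], continuous dF}.
Proof.
move=> a0 bt; apply: continuous_in_subspaceT => t.
rewrite mem_setE in_itv/= => /andP[h1 h2].
by apply: cdF; rewrite (lt_le_trans a0 h1) (le_lt_trans h2 bt).
Qed.

Let LR_F (a b : R) : 0 < a -> a < b -> b < t0 -> derivable_oo_LRcontinuous F a b.
Proof.
move=> a0 ab bt.
have cF s : a <= s <= b -> {for s, continuous F}.
  move=> /andP[h1 h2]; apply: differentiable_continuous; apply/derivable1_diffP.
  by have /dFP[] : 0 < s < t0 by rewrite (lt_le_trans a0 h1) (le_lt_trans h2 bt).
split.
- move=> s; rewrite in_itv/= => /andP[s1 s2].
  by have /dFP[] : 0 < s < t0 by rewrite (lt_trans a0 s1) (lt_trans s2 bt).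
- by apply: cvg_at_right_filter; apply: cF; rewrite lexx ltW.
- by apply: cvg_at_left_filter; apply: cF; rewrite lexx ltW.
Qed.

Let G_sub (a b : R) : 0 < a -> b < t0 -> leb.-integrable `[a, b] (EFin \o G).
Proof.
move=> a0 bt; apply: integrableS iG => //.
by apply: subset_itv; rewrite bnd_simp ltW.
Qed.

(** Integrating F by parts against [bump1] shows that G - dF has zero integral against every bump on
    ]a, b[; letting [eps] tend to 0 under domination removes the bump. *)
Let primitive (a b : R) : 0 < a -> a < b -> b < t0 ->
  \int[leb]_(t in `[a, b]) G t = F b - F a.
Proof.
move=> a0 ab bt.
have iGab := G_sub a0 bt.
have idF : leb.-integrable `[a, b] (EFin \o dF).
  by apply: continuous_compact_integrable; [exact: segment_compact|exact: within_cdF].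
have H (eps : R) : 0 < eps ->
    \int[leb]_(t in `]a, b[) ((G t - dF t) * bump1 a b eps t) = 0.
  move=> eps0; pose eta := bump1 a b eps.
  have out t : ~~ (a < t < b) -> eta t = 0 /\ derive1 eta t = 0.
    by move=> tab; exact: bump1_out.
  have ceta : continuous eta.
    move=> t; apply: differentiable_continuous; apply/derivable1_diffP; exact: bump1_derivable.
  have ca : ~~ (a < a < b) by rewrite ltxx.
  have cb : ~~ (a < b < b) by rewrite ltxx andbF.
  have := weak (bump1_test ab eps0 a0 bt); rewrite -/eta.
  rewrite (@Rintegral_sub_itv _ a b t0 (ltW a0) (ltW bt)); last first.
    by move=> t /out [_ ->]; rewrite mulr0.
  rewrite (@Rintegral_sub_itv _ a b t0 (ltW a0) (ltW bt)); last first.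
    by move=> t /out [-> _]; rewrite mulr0.
  have c1 : {within `[a, b], continuous eta} by exact: continuous_subspaceT.
  have bnd : [bounded eta x | x in `[a, b]%classic].
    exists 1; split; first exact: num_real.
    move=> M M1 t _ /=; have /andP[e0 e1] := @bump1_le1 _ a b _ eps0 t.
    by rewrite ger0_norm//; exact: le_trans e1 (ltW M1).
  have meta : measurable_fun `[a, b]%classic eta.
    by apply: measurable_funTS; exact: continuous_measurable_fun.
  have iGe : leb.-integrable `[a, b] (EFin \o (fun t => G t * eta t)).
    rewrite (_ : EFin \o _ = ((EFin \o G) \* (EFin \o eta))%E).
      exact: integrableMl.
    by apply/funext => t /=; rewrite EFinM.
  have idFe : leb.-integrable `[a, b] (EFin \o (fun t => dF t * eta t)).
    rewrite (_ : EFin \o _ = ((EFin \o dF) \* (EFin \o eta))%E).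
      exact: integrableMl.
    by apply/funext => t /=; rewrite EFinM.
  have cFw : {within `[a, b], continuous F} := derivable_oo_LRcontinuous_within (LR_F a0 ab bt).
  have iFe : leb.-integrable `[a, b] (EFin \o (fun t => F t * derive1 eta t)).
    apply: continuous_compact_integrable; first exact: segment_compact.
    move=> /= t; apply: continuousM; first exact: cFw.
    by apply: continuous_subspaceT; exact: bump1_derive_continuous.
  rewrite (Rintegral_itv_oo_cc ab iFe) (Rintegral_itv_oo_cc ab iGe).
  rewrite (@Rintegration_by_parts _ F eta dF (derive1 eta) a b ab).
  - rewrite (out a ca).1 (out b cb).1 !mulr0 subrr sub0r => /oppr_inj E.
    rewrite (_ : (fun t => _) = (fun t => G t * eta t - dF t * eta t)); last first.
      by apply/funext => t; rewrite mulrBl.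
    have s1 := @subset_itv_oo_cc _ R a b.
    rewrite RintegralB//; [|exact: integrableS iGe|exact: integrableS idFe].
    by rewrite (Rintegral_itv_oo_cc ab iGe) (Rintegral_itv_oo_cc ab idFe) E subrr.
  - exact: within_cdF.
  - exact: LR_F.
  - move=> s; rewrite in_itv/= => /andP[s1 s2]; rewrite derive1E.
    by have /dFP[_ ->] : 0 < s < t0 by rewrite (lt_trans a0 s1) (lt_trans s2 bt).
  - apply: continuous_subspaceT; exact: bump1_derive_continuous.
  - split.
    + by move=> s _; exact: bump1_derivable.
    + by apply: cvg_at_right_filter; exact: ceta.
    + by apply: cvg_at_left_filter; exact: ceta.
  - by [].
have ig : leb.-integrable `]a, b[ (EFin \o (fun t => G t - dF t)).
  have : leb.-integrable `[a, b] (EFin \o (fun t => G t - dF t)).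
    rewrite (_ : EFin \o _ = ((EFin \o G) \- (EFin \o dF))%E).
      exact: integrableB.
    by apply/funext => t /=; rewrite EFinB.
  by apply: integrableS => //; exact: subset_itv_oo_cc.
have E0 : \int[leb]_(t in `]a, b[) (G t - dF t) = 0.
  pose g_ (n : nat) t := (G t - dF t) * bump1 a b n.+1%:R^-1 t.
  have mg : measurable_fun `]a, b[%classic (fun t => G t - dF t).
    by have /measurable_int/measurable_EFinP := ig.
  have mg_ n : measurable_fun `]a, b[%classic (EFin \o g_ n).
    apply/measurable_EFinP; apply: measurable_funM => //.
    apply: measurable_funTS; apply: continuous_measurable_fun => t.
    apply: differentiable_continuous; apply/derivable1_diffP; exact: bump1_derivable.
  have cv : {ae leb, forall t, `]a, b[%classic t ->
      (EFin \o g_ n) t @[n --> \oo] --> (EFin \o (fun t => G t - dF t)) t}.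
    apply: aeW => t /=; rewrite in_itv/= => tab.
    apply: cvg_EFin; first exact: nearW.
    rewrite /comp/= -[X in _ --> X]mulr1; apply: cvgM; first exact: cvg_cst.
    rewrite (_ : (fun n => _) = (fun n => expR (- (n.+1%:R^-1 * ((t - a) * (b - t))^-1)))); last first.
      by apply/funext => n; rewrite bump1E tab.
    have L : n.+1%:R^-1 * ((t - a) * (b - t))^-1 @[n --> \oo] --> (0 : R).
      rewrite -[X in _ --> X](mul0r ((t - a) * (b - t))^-1).
      by apply: cvgM; [exact: cvg_harmonic|exact: cvg_cst].
    have L2 : - (n.+1%:R^-1 * ((t - a) * (b - t))^-1) @[n --> \oo] --> (0 : R).
      by rewrite -[X in _ --> X]oppr0; apply: cvgN.
    rewrite -[X in _ --> X]expR0.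
    by apply: continuous_cvg; [exact: continuous_expR|exact: L2].
  have dom : {ae leb, forall t n, `]a, b[%classic t ->
      (`|(EFin \o g_ n) t| <= (abse \o (EFin \o (fun s : R => (G s - dF s)%R))) t)%E}.
    apply: aeW => t n _ /=; rewrite lee_fin /g_ normrM ler_piMr//.
    have n0 : (0 : R) < n.+1%:R^-1 by rewrite invr_gt0.
    by have /andP[e0 e1] := @bump1_le1 _ a b _ n0 t; rewrite ger0_norm.
  have [_ _ L] := @dominated_convergence _ _ _ leb `]a, b[%classic (measurable_itv _)
    (fun n => EFin \o g_ n) (EFin \o (fun s : R => G s - dF s)) _ mg_ (measurable_int _ ig) cv (integrable_abse ig) dom.
  rewrite /Rintegral; have <- := cvg_lim _ L => //.
  rewrite (_ : (fun n => _) = cst 0%E) ?lim_cst//.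
  apply/funext => n /=.
  have n0 : (0 : R) < n.+1%:R^-1 by rewrite invr_gt0.
  rewrite -[RHS](congr1 EFin (H _ n0)) /Rintegral fineK//.
  apply: integrable_fin_num => //; apply: le_integrable (ig) => //.
    exact: mg_.
  move=> t _ /=; rewrite lee_fin normrM ler_piMr//.
  by have /andP[e0 e1] := @bump1_le1 _ a b _ n0 t; rewrite ger0_norm.
have s1 := @subset_itv_oo_cc _ R a b.
move: E0; rewrite RintegralB//; [|exact: integrableS iGab|exact: integrableS idF].
rewrite (Rintegral_itv_oo_cc ab iGab) (Rintegral_itv_oo_cc ab idF) => /eqP.
rewrite subr_eq0 => /eqP ->.
have dF' s : a <= s <= b -> is_derive s 1 F (dF s).
  by move=> /andP[h1 h2]; apply: dFP; rewrite (lt_le_trans a0 h1) (le_lt_trans h2 bt).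
by rewrite /Rintegral (FTC_R ab dF' (within_cdF a0 bt)).
Qed.

(** Lebesgue differentiation of the primitive of G. Since F is differentiable on the open interval
    only, primitives start at t0 / (n + 2), and the countably many exceptional null sets are
    united. *)
Lemma weak_derivative_ae : {ae leb, forall t, 0 < t < t0 -> G t = dF t}.
Proof.
have [t00|t00] := ltP 0 t0; last first.
  by apply: aeW => t /andP[h1 h2]; have := lt_trans h1 h2; rewrite ltNge t00.
pose f := G \_ `[0, t0].
have fi : leb.-integrable setT (EFin \o f).
  by rewrite /f -restrict_EFin; apply/integrable_restrict; rewrite ?setTI.
have H (n : nat) : {ae leb, forall t, t0 / n.+2%:R < t < t0 -> G t = dF t}.
  pose a := t0 / n.+2%:R; have a0 : 0 < a by rewrite divr_gt0.
  have h1 y : leb.-integrable [set` Interval (BLeft a) (BRight y)] (EFin \o f).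
    by apply: integrableS fi.
  have := FTC1 h1 (integrable_locally (measurable_itv _) iG).
  apply: filterS; first exact: (ae_filter_ringOfSetsType leb).
  move=> t /= FT /andP[ta tt].
  have [|dPhi] := FT; first by rewrite lte_fin.
  have t00t : 0 < t < t0 by rewrite tt (lt_trans a0 ta).
  rewrite /f patchE mem_setE in_itv/= !ltW//; last by case/andP: t00t.
  move=> /= <-; rewrite derive1E; have [_ <-] := dFP t00t.
  transitivity ('D_1 (fun y => F y - F a) t); last first.
    have [d1 d2] := dFP t00t.
    have := @deriveB _ _ _ F (cst (F a)) t 1 d1 (derivable_cst _ _ _).
    by rewrite derive_cst subr0.
  apply: near_eq_derive.
  have : \forall y \near t, a < y < t0.
    have : open `]a, t0[%classic by exact: interval_open.
    rewrite openE => /(_ t) /=; rewrite in_itv/= ta tt => /(_ isT).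
    by apply: filterS => u /=; rewrite in_itv.
  apply: filterS => y /andP[ay yt0].
  rewrite -(primitive a0 ay yt0); apply: eq_Rintegral => s.
  rewrite mem_setE in_itv/= => /andP[s1 s2].
  by rewrite patchE mem_setE in_itv/= (le_trans (ltW a0) s1) (le_trans s2 (ltW yt0)).
have {}H : {ae leb, forall t (n : nat), t0 / n.+2%:R < t < t0 -> G t = dF t} := ae_foralln H.
move: H; apply: filterS; first exact: (ae_filter_ringOfSetsType leb).
move=> t /= Ht /andP[h1 h2].
have q0 : 0 <= t0 / t by rewrite divr_ge0// ltW.
(* An n larger than t0 / t, so that t0 / (n + 2) < t. *)
apply: (Ht (Num.bound (t0 / t))); rewrite h2 andbT ltr_pdivrMr// -ltr_pdivrMl// mulrC.
have := archi_boundP q0 => /lt_le_trans; apply; rewrite ler_nat.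
by rewrite -addn2 leq_addr.
Qed.

End variation.

#[local] Opaque convolution partial.

(** * The McKean-Vlasov equation *)

Section mv_basics.
Context {R : realType} {d : nat}.
Variables (T M : R) (W phi : 'rV[R]_d -> R) (rho : R -> 'rV[R]_d -> R).
Hypotheses (mv : McKean_Vlasov_solution T W phi rho) (cW : cper W)
  (WM : (W2oo_norm W <= M%:E)%E).
Implicit Types (t s : R) (x : 'rV[R]_d) (i : 'I_d).

Lemma mv_M_ge0 : 0 <= M.
Proof. by rewrite -lee_fin; exact: le_trans (W2oo_norm_ge0 W) WM. Qed.

Lemma mv_near t x (e : R) : 0 <= t <= T -> 0 < e ->
  \forall p \near (t, x), 0 <= p.1 <= T -> `|rho p.1 p.2 - rho t x| < e.
Proof.
move=> tT e0; have /subspace_continuousP/(_ (t, x) tT) := mv_continuous mv.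
move=> /cvgrPdist_lt/(_ _ e0); rewrite near_withinE /=.
by apply: filterS => p H pT; rewrite distrC; exact: H.
Qed.

Lemma mv_cper t : 0 <= t <= T -> cper (rho t).
Proof.
move=> tT; split; first by have [] := mv_density mv tT.
move=> x; apply: (iffRL (@cvgrPdist_lt _ _ _ (nbhs x) _ (rho t) (rho t x))) => e e0.
have [[A B] [/= At Bx] sAB] := mv_near x tT e0.
apply: filterS Bx => y By; rewrite distrC; apply: (sAB (t, y)) => //.
by split => //; exact: nbhs_singleton At.
Qed.

Lemma mv_tube t (e : R) : 0 <= t <= T -> 0 < e ->
  \forall s \near t, 0 <= s <= T -> forall x, `|rho s x - rho t x| < e.
Proof.
move=> tT e0.
have := @tube _ _ _ (within [set s | 0 <= s <= T] (nbhs t)) rho (rho t) _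
  (mv_cper tT).2 (mv_cper tT).1 _ _ e e0.
apply.
- by rewrite near_withinE; apply: nearW => s /mv_cper[].
- move=> x e1 e10; have [[A B] [/= At Bx] sAB] := mv_near x tT e10.
  exists (B, [set s | A s /\ 0 <= s <= T]).
    by split => //=; apply: filterS At => s As.
  by move=> [y s] [/= By [As sT]]; exact: (sAB (s, y)).
Qed.

(** Functionals continuous for the uniform norm are continuous along the solution on closed
    intervals, time 0 included; this lets the mean value theorem start at the initial datum. *)
Lemma mv_within (Phi : ('rV[R]_d -> R) -> R) (a b : R) : 0 <= a -> b <= T ->
  (forall f, cper f -> forall e : R, 0 < e -> exists2 e1 : R, 0 < e1 & forall g, cper g ->
     (forall x, `|g x - f x| < e1) -> `|Phi g - Phi f| < e) ->
  {within `[a, b], continuous (fun t => Phi (rho t))}.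
Proof.
move=> a0 bT H; apply/subspace_continuousP => t /=; rewrite in_itv/= => /andP[at_ tb].
have tT : 0 <= t <= T by rewrite (le_trans a0 at_) (le_trans tb bT).
apply/cvgrPdist_lt => e e0; rewrite near_withinE.
have [e1 e10 He1] := H _ (mv_cper tT) e e0.
apply: filterS (mv_tube tT e10) => s Hs /=; rewrite in_itv/= => /andP[as_ sb].
have sT : 0 <= s <= T by rewrite (le_trans a0 as_) (le_trans sb bT).
by rewrite distrC; apply: He1; [exact: mv_cper|exact: Hs].
Qed.

Lemma mv_tint_within (psi : 'rV[R]_d -> R) (a b : R) : cper psi -> 0 <= a -> b <= T ->
  {within `[a, b], continuous (fun t => tint (fun x => rho t x * psi x))}.
Proof.
move=> cp a0 bT; apply: (@mv_within (fun f => tint (fun x => f x * psi x)) a b) => //.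
move=> f cf e e0; have [B B0 HB] := cper_bounded cp.
exists (e / (2 * B)); first by rewrite divr_gt0// mulr_gt0.
move=> g cg gf; rewrite -tintB; [|exact: cperM|exact: cperM].
apply: (@le_lt_trans _ _ (e / 2)); last by rewrite ltr_pdivrMr// ltr_pMr// ltr1n.
apply: tint_bound => [|x]; first by apply: cperB; exact: cperM.
rewrite -mulrBl normrM (_ : e / 2 = e / (2 * B) * B); last by field; rewrite gt_eqF.
by apply: ler_pM => //; exact: ltW.
Qed.

Lemma mv_sqint_within (psi : 'rV[R]_d -> R) (a b : R) : cper psi -> 0 <= a -> b <= T ->
  {within `[a, b], continuous (fun t => sqint (fun x => rho t x - psi x))}.
Proof.
move=> cp a0 bT; apply: (@mv_within (fun f => sqint (fun x => f x - psi x)) a b) => //.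
move=> f cf e e0; have [B B0 HB] := cper_bounded (cperB cf cp).
pose q := Num.min 1 (e / (2 * (2 * B + 1))).
have D0 : 0 < 2 * B + 1 by rewrite addr_gt0// mulr_gt0.
have q0 : 0 < q by rewrite lt_min ltr01 divr_gt0// mulr_gt0.
exists q => // g cg gf; have c1 := cperX 2 (cperB cg cp); have c2 := cperX 2 (cperB cf cp).
rewrite /sqint -tintB//.
apply: (@le_lt_trans _ _ (e / 2)); last by rewrite ltr_pdivrMr// ltr_pMr// ltr1n.
apply: tint_bound => [|x]; first exact: cperB.
rewrite (_ : _ - _ = (g x - f x) * ((g x - f x) + 2 * (f x - psi x))); last by ring.
rewrite normrM (_ : e / 2 = e / (2 * (2 * B + 1)) * (2 * B + 1)); last by field; rewrite gt_eqF.
apply: ler_pM => //.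
  by apply: le_trans (ltW (gf x)) _; rewrite ge_min lexx orbT.
apply: le_trans (ler_normD _ _) _; rewrite addrC lerD//.
  by rewrite normrM ger0_norm// ler_pM2l.
by apply: le_trans (ltW (gf x)) _; rewrite ge_min lexx.
Qed.

Lemma mv_ge0 t x : 0 <= t <= T -> 0 <= rho t x.
Proof. by move=> /(mv_density mv)[]. Qed.

Lemma prob_density_tint f : @prob_density R d f -> tint f = 1.
Proof. by move=> [_ _ _ E]; rewrite /tint /Rintegral E. Qed.

Lemma mv_tint1 t : 0 <= t <= T -> tint (fun x => `|rho t x|) = 1.
Proof.
move=> tT; rewrite -(prob_density_tint (mv_density mv tT)).
by apply: eq_tint => x; rewrite ger0_norm// mv_ge0.
Qed.

Let oc t : 0 < t < T -> 0 <= t <= T.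
Proof. by move=> /andP[h1 h2]; rewrite !ltW. Qed.

Lemma continuous_section (F : R -> 'rV[R]_d -> R) t :
  (forall x, {for (t, x), continuous (fun p : R * 'rV[R]_d => F p.1 p.2)}) -> continuous (F t).
Proof.
move=> H x; apply: (@continuous_comp _ _ _ (fun y => (t, y)) (fun p : R * 'rV[R]_d => F p.1 p.2)).
  move=> A [[P Q] [/= Pt Qx] sPQ]; apply: filterS Qx => y Qy; apply: sPQ.
  by split => //; exact: nbhs_singleton Pt.
exact: H.
Qed.

Lemma mv_C1 t : 0 < t < T -> C1 (rho t).
Proof.
move=> tT; have ct := mv_cper (oc tT); split => // i; split.
  by move=> x; exact: (mv_derivable_x mv).
split; first exact: partial_periodic ct.1.
by apply: (@continuous_section (fun s => partial i (rho s))) => x; exact: (mv_continuous_x mv).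
Qed.

Lemma mv_C1_partial t i : 0 < t < T -> C1 (partial i (rho t)).
Proof.
move=> tT; have ct := C1_partial i (mv_C1 tT); split=> [|j]; [exact: ct|split].
  by move=> x; exact: (mv_derivable_xx mv).
split; first exact: partial_periodic ct.1.
by apply: (@continuous_section (fun s => partial j (partial i (rho s)))) => x; exact: (mv_continuous_xx mv).
Qed.

Definition dt t x : R := derive1 (rho ^~ x) t.

Lemma mv_dt t x : 0 < t < T -> is_derive t 1 (rho ^~ x) (dt t x).
Proof. by move=> tT; split; [exact: (mv_derivable_t mv)|rewrite /dt derive1E]. Qed.

Lemma mv_cper_dt t : 0 < t < T -> cper (dt t).
Proof.
move=> tT; split; last by apply: continuous_section => x; exact: (mv_continuous_t mv).
move=> x i; rewrite /dt !derive1E; apply: near_eq_derive.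
have : open `]0, T[%classic by exact: interval_open.
rewrite openE => /(_ t) /=; rewrite in_itv/= => /(_ tT).
apply: filterS => s /=; rewrite in_itv/= => sT.
by have [/(_ x i)] := mv_cper (oc sT).
Qed.

Lemma mv_conv_C1 t V : 0 < t < T -> cper V ->
  [/\ C1 (convolution V (rho t)),
      forall i, partial i (convolution V (rho t)) = convolution V (partial i (rho t)),
      forall i, C1 (partial i (convolution V (rho t))) &
      forall i, partial i (partial i (convolution V (rho t))) =
        convolution V (partial i (partial i (rho t)))].
Proof.
move=> tT cV; have [c1 p1] := C1_conv cV (mv_C1 tT).
split=> [||i|i]; [exact: c1|exact: p1| |].
  by rewrite p1; exact: (C1_conv cV (mv_C1_partial i tT)).1.
by rewrite p1; exact: (C1_conv cV (mv_C1_partial i tT)).2.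
Qed.

Let v t := convolution W (rho t).

Lemma mv_drift_bound t x i : 0 < t < T -> `|partial i (v t) x| <= M.
Proof.
move=> tT; have [_ -> _ _] := mv_conv_C1 tT cW.
have := W2oo_conv1 i x cW (mv_C1 tT) WM.
by rewrite mv_tint1 ?mulr1//; exact: oc.
Qed.

Lemma mv_drift2_bound t x i : 0 < t < T -> `|partial i (partial i (v t)) x| <= M.
Proof.
move=> tT; have [_ _ _ ->] := mv_conv_C1 tT cW.
have := W2oo_conv2 x cW (mv_C1 tT) (mv_C1_partial i tT) WM.
by rewrite mv_tint1 ?mulr1//; exact: oc.
Qed.

Lemma mv_flux_C1 t i : 0 < t < T -> C1 (fun y => rho t y * partial i (v t) y) /\
  forall j, partial j (fun y => rho t y * partial i (v t) y) =
    fun y => partial j (rho t) y * partial i (v t) y + rho t y * partial j (partial i (v t)) y.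
Proof. by move=> tT; have [_ _ c2 _] := mv_conv_C1 tT cW; exact: C1M (mv_C1 tT) (c2 i). Qed.

Lemma mv_eq t x : 0 < t < T ->
  dt t x = \sum_i partial i (partial i (rho t)) x +
    \sum_i (partial i (rho t) x * partial i (v t) x + rho t x * partial i (partial i (v t)) x).
Proof.
move=> tT; rewrite /dt (mv_equation mv)//; congr (_ + _).
apply: eq_bigr => i _; have [_ H] := mv_flux_C1 i tT.
by rewrite -[X in partial i X]/(fun y => rho t y * partial i (v t) y) H.
Qed.

Lemma mv_weak t h : 0 < t < T -> C1 h ->
  tint (fun x => dt t x * h x) =
  - \sum_i (tint (fun x => partial i (rho t) x * partial i h x) +
            tint (fun x => rho t x * partial i (v t) x * partial i h x)).
Proof.
move=> tT ch; have cr := mv_C1 tT; have chh := C1_cper ch.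
have c2 i := mv_C1_partial i tT.
have cf i := (mv_flux_C1 i tT).1.
rewrite (@eq_tint _ _ _ (fun x => \sum_i (partial i (partial i (rho t)) x * h x +
   partial i (fun y => rho t y * partial i (v t) y) x * h x))); last first.
  move=> x; rewrite mv_eq// -big_split mulr_suml; apply: eq_bigr => i _ /=.
  by rewrite (mv_flux_C1 i tT).2 mulrDl.
rewrite tint_sum; last first.
  by move=> i; exact: cperD (cperM (C1_partial i (c2 i)) chh) (cperM (C1_partial i (cf i)) chh).
rewrite -sumrN; apply: eq_bigr => i _.
rewrite (tintD (cperM (C1_partial i (c2 i)) chh) (cperM (C1_partial i (cf i)) chh)).
by rewrite (tint_by_parts i (c2 i) ch) (tint_by_parts i (cf i) ch) opprD.
Qed.

Lemma mv_tint_derive (psi : 'rV[R]_d -> R) t : 0 < t < T -> cper psi ->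
  is_derive t 1 (fun s => tint (fun x => rho s x * psi x)) (tint (fun x => dt t x * psi x)).
Proof.
move=> tT cp.
have [r r0 Hr] : exists2 r : R, 0 < r & forall s, `|t - s| < r -> 0 < s < T.
  have : open `]0, T[%classic by exact: interval_open.
  rewrite openE => /(_ t) /=; rewrite in_itv/= => /(_ tT) /nbhs_ballP[r /= r0 H].
  by exists r => // s /H /=; rewrite in_itv.
apply: (@tint_derive _ _ (fun s x => rho s x * psi x) (fun s x => dt s x * psi x) t r r0).
- by move=> s sr; apply: cperM => //; apply: mv_cper; apply: oc; exact: Hr.
- move=> s x sr; have H := mv_dt x (Hr _ sr).
  rewrite (_ : (fun _ => _) = (fun s => psi x * rho s x)); last first.
    by apply/funext => u; rewrite mulrC.
  by rewrite mulrC; exact: (is_deriveZ (psi x) H).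
- move=> x; apply: (@continuousM R _ (fun p : R * 'rV[R]_d => dt p.1 p.2) (fun p => psi p.2) (t, x)).
    exact: (mv_continuous_t mv).
  apply: (@continuous_comp _ _ _ (fun p : R * 'rV[R]_d => p.2) psi); last exact: cp.2.
  exact: cvg_snd.
Qed.

Lemma mv_sqint_derive (psi : 'rV[R]_d -> R) t : 0 < t < T -> cper psi ->
  is_derive t 1 (fun s => sqint (fun x => rho s x - psi x))
    (tint (fun x => dt t x * (2 * (rho t x - psi x)))).
Proof.
move=> tT cp.
have [r r0 Hr] : exists2 r : R, 0 < r & forall s, `|t - s| < r -> 0 < s < T.
  have : open `]0, T[%classic by exact: interval_open.
  rewrite openE => /(_ t) /=; rewrite in_itv/= => /(_ tT) /nbhs_ballP[r /= r0 H].
  by exists r => // s /H /=; rewrite in_itv.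
apply: (@tint_derive _ _ (fun s x => (rho s x - psi x) ^+ 2) (fun s x => dt s x * (2 * (rho s x - psi x))) t r r0).
- by move=> s sr; apply: cperX; apply: cperB => //; apply: mv_cper; apply: oc; exact: Hr.
- move=> s x sr; have H := mv_dt x (Hr _ sr).
  have D : is_derive s 1 (fun s => rho s x - psi x) (dt s x).
    have := is_deriveB H (is_derive_cst (psi x) s 1).
    by rewrite subr0.
  apply: is_derive_eq (is_deriveM D D) _.
  by rewrite /= -[_ *: _]/(_ * _); ring.
- move=> x; apply: (@continuousM R _ (fun p : R * 'rV[R]_d => dt p.1 p.2) (fun p => 2 * (rho p.1 p.2 - psi p.2)) (t, x)).
    exact: (mv_continuous_t mv).
  apply: (@continuousM R _ (fun=> 2) (fun p => rho p.1 p.2 - psi p.2) (t, x)); first exact: cst_continuous.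
  apply: (@continuousB R _ _ (fun p : R * 'rV[R]_d => rho p.1 p.2) (fun p => psi p.2) (t, x)).
    apply: (iffRL (@cvgrPdist_lt _ _ _ (nbhs (t, x)) _ _ (rho t x))) => e e0.
    have H1 := mv_near x (oc tT) e0.
    have H2 : \forall p \near (t, x), 0 <= p.1 <= T.
      exists ([set s | `|t - s| < r], setT); first by split; [exact: nbhsx_ballx|exact: filterT].
      by move=> [s y] [/= sr _]; apply: oc; exact: Hr.
    by apply: filterS2 H1 H2 => p h1 h2; rewrite distrC; exact: h1.
  apply: (@continuous_comp _ _ _ (fun p : R * 'rV[R]_d => p.2) psi); last exact: cp.2.
  exact: cvg_snd.
Qed.

End mv_basics.

(** * Minimum principle and lower bound for the density *)

Lemma is_derive_near {R : realType} (f : R -> R) (x c e : R) :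
  is_derive x 1 f c -> 0 < e ->
  exists2 r : R, 0 < r & forall h, h != 0 -> `|h| < r ->
    `|h^-1 * (f (h + x) - f x) - c| < e.
Proof.
move=> [df <-] e0.
have /cvgrPdist_lt/(_ _ e0) := df.
move=> /nbhs_ballP[r /= r0 H]; exists r => // h h0 hr.
have hb : ball (0 : R) r h by rewrite /ball/= sub0r normrN.
by have := H h hb h0; rewrite distrC [_%:A]mulr1.
Qed.

(** If c were negative, [dg] would be negative just to the right of its zero at 0, and the mean
    value theorem would give a value of g below the minimum. *)
Lemma second_derivative_test {R : realType} (g dg : R -> R) (c : R) :
  (forall s : R, is_derive s 1 g (dg s)) -> is_derive (0 : R) 1 dg c ->
  (forall s, g 0 <= g s) -> dg 0 = 0 /\ 0 <= c.
Proof.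
move=> Hg Hdg gmin.
have dg0 : dg 0 = 0.
  have [|||s|_ E] := @derive1_at_min R g (-1) 1 0.
  - by lra.
  - by move=> s _; have [] := Hg s.
  - by rewrite in_itv/= ltrN10 ltr01.
  - by move=> _; exact: gmin.
  - by have [_ <-] := Hg 0.
split => //; rewrite leNgt; apply/negP => c0.
have nc : 0 < - c by rewrite oppr_gt0.
have [r r0 Hr] := is_derive_near Hdg nc.
have r2 : 0 < r / 2 by rewrite divr_gt0.
have [|xi] := @MVT R g dg 0 (r / 2) r2 (fun s _ => Hg s).
  apply: derivable_within_continuous => s _; by have [] := Hg s.
rewrite in_itv/= => /andP[xi0 xir] E.
have : dg xi < 0.
  have := Hr xi (lt0r_neq0 xi0); rewrite gtr0_norm// addr0 dg0 subr0.
  have xr : xi < r by apply: lt_trans xir _; rewrite ltr_pdivrMr// ltr_pMr// ltr1n.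
  move=> /(_ xr) H; have : xi^-1 * dg xi < 0.
    by have := ler_norm (xi^-1 * dg xi - c); move: H; lra.
  by rewrite pmulr_rlt0// invr_gt0.
move=> dx; have := gmin (r / 2); rewrite -subr_ge0 E subr0 pmulr_lge0// leNgt.
by rewrite dx.
Qed.

(** One-sided, because the minimum over space and time may be attained at the final time, where only
    earlier times can be compared. *)
Lemma left_min_test {R : realType} (h : R -> R) (t c : R) : 0 < t ->
  is_derive t 1 h c -> (forall s, 0 <= s <= t -> h t <= h s) -> c <= 0.
Proof.
move=> t0 Hd hmin; rewrite leNgt; apply/negP => c0.
have [r r0 Hr] := is_derive_near Hd c0.
pose q := Num.min (r / 2) t.
have q0 : 0 < q by rewrite lt_min divr_gt0.
have qt : q <= t by rewrite ge_min lexx orbT.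
have qr : `|- q| < r.
  rewrite normrN gtr0_norm//; apply: (@le_lt_trans _ _ (r / 2)); first by rewrite ge_min lexx.
  by rewrite ltr_pdivrMr// ltr_pMr// ltr1n.
have := Hr (- q); rewrite oppr_eq0 gt_eqF// => /(_ isT qr) H.
have h1 : 0 <= h (- q + t) - h t.
  by rewrite subr_ge0; apply: hmin; rewrite addrC subr_ge0 qt gerBl ltW.
have h2 : (- q)^-1 * (h (- q + t) - h t) <= 0.
  by rewrite invrN mulNr oppr_le0 mulr_ge0// invr_ge0 ltW.
by have := ler_norm (c - (- q)^-1 * (h (- q + t) - h t)); rewrite distrC; move: H h2; lra.
Qed.

Section mv_estimates.
Context {R : realType} {d : nat}.
Variables (T M : R) (W phi : 'rV[R]_d -> R) (rho : R -> 'rV[R]_d -> R).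
Hypotheses (mv : McKean_Vlasov_solution T W phi rho) (cW : cper W)
  (WM : (W2oo_norm W <= M%:E)%E).
Implicit Types (t s : R) (x : 'rV[R]_d) (i : 'I_d).

Let M0 : 0 <= M := mv_M_ge0 WM.

(* Comparison with the barrier pmin * (1 - l * t): at a first negative minimum of
   the difference the equation would force l <= d * M. *)
Lemma mv_lower_bound (pmin t1 : R) : 0 < pmin -> (forall x, pmin <= phi x) ->
  0 < t1 < T -> t1 * (2 * (d%:R * M + 1)) <= 1 ->
  forall t x, 0 <= t <= t1 -> pmin / 2 <= rho t x.
Proof.
move=> p0 Hphi /andP[t10 t1T] t1l.
pose l : R := d%:R * M + 1.
have l1 : 1 <= l by rewrite /l lerDr mulr_ge0.
pose f (p : R * 'rV[R]_d) := rho p.1 p.2 + pmin * l * p.1.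
have H p : 0 <= p.1 <= t1 -> pmin <= f p.
  pose A := `[(0 : R), t1]%classic `*` (@cube R d).
  have A0 : A !=set0.
    by exists (0, 0); split => /=; [rewrite in_itv/= lexx ltW|move=> i; rewrite /= mxE in_itv/= lexx ler01].
  have cA : compact A by apply: compact_setX; [exact: segment_compact|exact: cube_compact].
  have cf : {within A, continuous f}.
    have h1 : {within A, continuous (fun p : R * 'rV[R]_d => rho p.1 p.2)}.
      apply: continuous_subspaceW (mv_continuous mv) => -[s y] [/=]; rewrite in_itv/= => /andP[s0 s1] _.
      by rewrite s0 (le_trans s1 (ltW t1T)).
    have h2 : {within A, continuous (fun p : R * 'rV[R]_d => pmin * l * p.1)}.
      apply: continuous_subspaceT => z.
      apply: (@continuousM R _ (fun=> pmin * l) (fun p : R * 'rV[R]_d => p.1) z); first exact: cst_continuous.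
      exact: cvg_fst.
    by move=> z; exact: (continuousD (h1 z) (h2 z)).
  have [[ts xs]] := compact_EVT_min A0 cA cf.
  rewrite inE => -[/=]; rewrite in_itv/= => /andP[ts0 tst1] _ fmin0.
  have fmin s y : 0 <= s <= t1 -> f (ts, xs) <= f (s, y).
    move=> st; have sT : 0 <= s <= T by case/andP: st => -> s1; rewrite (le_trans s1 (ltW t1T)).
    have -> : f (s, y) = f (s, wrap y) by rewrite /f /= (periodic_wrap _ (mv_cper mv sT).1).
    by apply: fmin0; rewrite inE; split => //=; exact: wrap_cube.
  move=> pt; case: p pt => s y /= st; apply: le_trans (fmin s y st).
  rewrite leNgt; apply/negP => fneg.
  have ts_gt0 : 0 < ts.
    rewrite lt_neqAle ts0 andbT; apply/eqP => ts00; move: fneg.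
    by rewrite /f /= -ts00 mulr0 addr0 (mv_initial mv) ltNge Hphi.
  have tsT : 0 < ts < T by rewrite ts_gt0 (le_lt_trans tst1 t1T).
  have tsI : 0 <= ts <= t1 by rewrite ts0 tst1.
  have tsTc : 0 <= ts <= T by rewrite ts0 (le_trans tst1 (ltW t1T)).
  have c1 := mv_C1 mv tsT.
  have spat i : partial i (rho ts) xs = 0 /\ 0 <= partial i (partial i (rho ts)) xs.
    have D1 (u : R) : is_derive u 1 (fun u : R => rho ts (line xs i u)) (partial i (rho ts) (line xs i u)).
      by apply: line_partial; exact: (c1.2 i).1.
    have D2 : is_derive (0 : R) 1 (fun s => partial i (rho ts) (line xs i s)) (partial i (partial i (rho ts)) (line xs i 0)).
      by apply: line_partial; exact: ((mv_C1_partial mv i tsT).2 i).1.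
    have := second_derivative_test D1 D2; rewrite !line0; apply => u.
    by have := fmin ts (line xs i u) tsI; rewrite /f /= lerD2r.
  have Dt : is_derive ts 1 (fun s => f (s, xs)) (dt rho ts xs + pmin * l).
    have h1 := mv_dt mv xs tsT.
    have h2 := is_deriveZ (pmin * l) (is_derive_id ts (1 : R)).
    apply: is_derive_eq (is_deriveD h1 h2) _.
    by rewrite [_ *: _]mulr1.
  have tneg : dt rho ts xs + pmin * l <= 0.
    apply: left_min_test ts_gt0 Dt _ => u /andP[u0 ut].
    by apply: fmin; rewrite u0 (le_trans ut tst1).
  have r0 := mv_ge0 mv xs tsTc.
  (* At the minimum the gradient vanishes and the second derivatives are nonnegative, so the
     equation bounds [dt rho] below by - d M rho. With rho <= pmin and l = d M + 1 this is
     incompatible with [dt rho] <= - pmin l. *)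
  have rp : rho ts xs <= pmin.
    apply: le_trans (ltW fneg); rewrite /f /= lerDl mulr_ge0// mulr_ge0 ?(ltW p0)//.
    exact: le_trans ler01 l1.
  have dlow : - (d%:R * M * rho ts xs) <= dt rho ts xs.
    rewrite (mv_eq mv)// -[leLHS]add0r; apply: lerD.
      by apply: sumr_ge0 => i _; exact: (spat i).2.
    have -> : - (d%:R * M * rho ts xs) = \sum_(i < d) - (M * rho ts xs).
      by rewrite sumr_const card_ord -[_ *+ d]mulr_natl; ring.
    apply: ler_sum => i _; rewrite (spat i).1 mul0r add0r.
    have := mv_drift2_bound mv cW WM xs i tsT; rewrite ler_norml => /andP[lo _].
    by rewrite -mulNr mulrC; exact: ler_wpM2l.
  have : d%:R * M * rho ts xs <= d%:R * M * pmin by rewrite ler_wpM2l// mulr_ge0.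
  by move: tneg dlow p0; rewrite /l; lra.
move=> t x /andP[t0 tt1]; have := H (t, x); rewrite /f /= t0 tt1 => /(_ isT) h.
have : pmin * l * t <= pmin / 2.
  rewrite -mulrA ler_wpM2l ?(ltW p0)//.
  apply: (@le_trans _ _ (l * t1)); first by rewrite ler_wpM2l// (le_trans ler01 l1).
  by move: t1l; rewrite -/l; lra.
by move: h; lra.
Qed.

End mv_estimates.

(** * Short-time control of the density and of its Fourier modes *)

Section mv_short_time.
Context {R : realType} {d : nat}.
Variables (T M N t1 : R) (W phi : 'rV[R]_d -> R) (rho : R -> 'rV[R]_d -> R).

Definition freq_sq (k : 'rV[int]_d) : R := \sum_i (k 0 i)%:~R ^+ 2.

Lemma freq_sq_ge0 k : 0 <= freq_sq k.
Proof. by apply: sumr_ge0 => i _; exact: sqr_ge0. Qed.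

Lemma sum_freq_sq k : \sum_i freq k i ^+ 2 = 4 * pi ^+ 2 * freq_sq k.
Proof.
by rewrite /freq_sq mulr_sumr; apply: eq_bigr => i _; rewrite /freq; ring.
Qed.

Hypotheses (mv : McKean_Vlasov_solution T W phi rho) (cW : cper W)
  (WM : (W2oo_norm W <= M%:E)%E) (cphi : cper phi).
(** Two consequences of the H^beta bound on [phi]: [HN1] controls its H^1 energy, and [HN2] makes
    single modes decay fast enough to pay for the Laplacian. *)
Hypothesis (HN1 : forall S : {fset 'rV[int]_d},
  \sum_(k <- enum_fset S) (1 + freq_sq k) * fsq phi k <= N).
Hypothesis (HN2 : forall k, (1 + freq_sq k) ^+ 2 * fsq phi k <= N).
Hypothesis (t1T : 0 < t1 < T).
Implicit Types (t s : R) (x : 'rV[R]_d) (i : 'I_d).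

Let M0 : 0 <= M := mv_M_ge0 WM.

Let N0 : 0 <= N.
Proof. by have := HN1 fset0; rewrite big_nil. Qed.

Let sqphi : sqint phi <= N.
Proof.
apply: parseval_le => // S; apply: le_trans (HN1 S); apply: ler_sum => k _.
by rewrite ler_peMl ?fsq_ge0// lerDl freq_sq_ge0.
Qed.

(** A bound on the squared norm of grad phi, expressed through coefficients; 4 pi^2 converts |k|^2
    into squared frequencies. *)
Definition energy_bound : R := 4 * pi ^+ 2 * N.

Let A0 : 0 <= energy_bound.
Proof. by rewrite mulr_ge0// mulr_ge0// sqr_ge0. Qed.

Let freq_energy (S : {fset 'rV[int]_d}) :
  \sum_i \sum_(k <- enum_fset S) freq k i ^+ 2 * fsq phi k <= energy_bound.
Proof.
rewrite exchange_big /= /energy_bound.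
rewrite (eq_bigr (fun k => 4 * pi ^+ 2 * (freq_sq k * fsq phi k))); last first.
  by move=> k _; rewrite -mulr_suml sum_freq_sq mulrA.
rewrite -mulr_sumr; apply: ler_wpM2l; first by rewrite mulr_ge0// sqr_ge0.
apply: le_trans (HN1 S).
by apply: ler_sum => k _; rewrite ler_wpM2r ?fsq_ge0// lerDr.
Qed.

Let ocT t : 0 <= t <= t1 -> 0 <= t <= T.
Proof. by move=> /andP[-> h]; case/andP: t1T => _ h2; rewrite (le_trans h (ltW h2)). Qed.

Let v t := convolution W (rho t).

(** The left-hand side is the time derivative of the squared distance from rho to p. Completing the
    square lets the diffusion absorb every gradient of rho, leaving the gradient of p and the
    drift. *)
Lemma mv_energy (p : 'rV[R]_d -> R) t : 0 < t < T -> C1 p ->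
  tint (fun x => dt rho t x * (2 * (rho t x - p x))) <=
  \sum_i (sqint (partial i p) + M ^+ 2 * sqint (rho t)).
Proof.
move=> tT cp; have cr := mv_C1 mv tT.
have [cB pB] := C1B cr cp; have [c2 p2] := C1Z 2 cB.
rewrite (mv_weak mv cW tT c2) -sumrN; apply: ler_sum => i _.
have [_ _ cv _] := mv_conv_C1 mv tT cW.
have ca := C1_partial i cr; have cb := C1_partial i cp.
have cc : cper (fun x => rho t x * partial i (v t) x) := cperM (C1_cper cr) (C1_cper (cv i)).
have cdh := C1_partial i c2.
rewrite p2 pB in cdh *.
rewrite -(tintD (cperM ca cdh) (cperM cc cdh)) -tintN; last first.
  exact: cperD (cperM ca cdh) (cperM cc cdh).
apply: (@le_trans _ _ (sqint (partial i p) + sqint (fun x => rho t x * partial i (v t) x))); last first.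
  rewrite lerD2l; apply: sqintM_le; [exact: C1_cper|exact: C1_cper (cv i)|].
  by move=> x; exact: (mv_drift_bound mv cW WM x i tT).
rewrite /sqint -(tintD (cperX 2 cb) (cperX 2 cc)).
apply: tint_le.
- exact: cperN (cperD (cperM ca cdh) (cperM cc cdh)).
- exact: cperD (cperX 2 cb) (cperX 2 cc).
- move=> x; set a := partial i (rho t) x; set b := partial i p x; set c := rho t x * _.
  rewrite -subr_ge0 (_ : _ - _ = 2^-1 * (2 * (a - b) + (b + c)) ^+ 2 + 2^-1 * (b - c) ^+ 2).
    by rewrite addr_ge0// mulr_ge0 ?invr_ge0// sqr_ge0.
  by field.
Qed.

Let rho0 : rho 0 = phi.
Proof. by apply/funext => x; exact: (mv_initial mv). Qed.

(** [mv_energy] needs a differentiable reference, so it is applied to a projection p of [phi];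
    [freq_energy] bounds the gradient of p uniformly in the projection, and the distance from p to
    [phi] is sent to 0. *)
Lemma mv_increment (Q : R) : (forall s, 0 <= s <= t1 -> sqint (rho s) <= Q) ->
  forall t, 0 <= t <= t1 ->
  sqint (fun x => rho t x - phi x) <= 2 * t * (energy_bound + d%:R * M ^+ 2 * Q).
Proof.
move=> HQ t /andP[t0 tt1]; set B := _ + _.
move: t0; rewrite le_eqVlt => /predU1P[<-|t0].
  rewrite mulr0 mul0r rho0 /sqint; under eq_tint do rewrite subrr expr0n.
  by rewrite tint0.
(* The tolerance e/4 occurs twice, at time 0 and in the return from p to [phi], each time doubled by
   [sqintD_le]. *)
apply/ler_addgt0Pr => e e0; have e4 : 0 < e / 4 by rewrite divr_gt0.
have [S0 /(_ _ (symm_symmz S0) (symmz_sub S0))] := proj_cvg cphi e4.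
set S := symmz S0; set p := proj S phi => hp.
have tp : trig p := trig_synth S _ _.
have c1p := (trig_C1 tp).1; have cp := trig_cper tp.
have tT : t < T by case/andP: t1T => _; exact: le_lt_trans.
have ct : cper (rho t) by apply: (mv_cper mv); rewrite (ltW t0) ltW.
have [xi|xi] := @MVT R (fun s => sqint (fun x => rho s x - p x))
  (fun s => tint (fun x => dt rho s x * (2 * (rho s x - p x)))) 0 t t0 _
  (mv_sqint_within mv cp (lexx 0) (ltW tT)).
  rewrite in_itv/= => /andP[x0 xt]; apply: (mv_sqint_derive mv) => //.
  by rewrite x0 (lt_trans xt tT).
rewrite in_itv/= => /andP[x0 xt]; rewrite rho0 subr0 => E.
have xiT : 0 < xi < T by rewrite x0 (lt_trans xt tT).
have xi1 : 0 <= xi <= t1 by rewrite ltW//= (le_trans (ltW xt) tt1).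
have step : sqint (fun x => rho t x - p x) <= e / 4 + t * B.
  rewrite -[X in X <= _](subrK (sqint (fun x => phi x - p x))) E addrC lerD// mulrC.
  rewrite ler_wpM2l ?(ltW t0)//; apply: le_trans (mv_energy xiT c1p) _.
  rewrite big_split/= /B lerD//; last first.
    rewrite sumr_const card_ord -[_ *+ d]mulr_natl mulrA ler_wpM2l ?mulr_ge0 ?sqr_ge0//.
    exact: HQ.
  apply: le_trans (freq_energy S); apply: ler_sum => i _.
  rewrite /p partial_synth sqint_synth.
  - by rewrite le_eqVlt; apply/orP; left; apply/eqP; apply: eq_bigr => k _; rewrite /fsq; ring.
  - exact: symm_symmz.
  - by move=> k; rewrite scoefN// /freq mxE mulrNz; ring.
  - by move=> k; rewrite ccoefN /freq mxE mulrNz; ring.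
have -> : (fun x => rho t x - phi x) = (fun x => (rho t x - p x) + (- 1) * (phi x - p x)).
  by apply/funext => x; ring.
have c1 := cperB ct cp; have c2 := cperB cphi cp.
apply: le_trans (sqintD_le c1 (cperZ (-1) c2)) _.
have -> : sqint (fun x => -1 * (phi x - p x)) = sqint (fun x => phi x - p x).
  by apply: eq_tint => x; ring.
move: step hp; set X := sqint _; set Y := sqint _.
by move: (t * B) (2 * t * B) (mulrA 2 t B) => z _ <-; lra.
Qed.

(** Solves Q <= A + Q/2 + 2 N for Q, with A = [energy_bound]: the inequality reached in
    [mv_sqint_bound]. *)
Definition sqint_const : R := 2 * energy_bound + 4 * N.
Definition increment_const : R := energy_bound + d%:R * M ^+ 2 * sqint_const.

Hypothesis (t1M : 8 * t1 * (d%:R * M ^+ 2) <= 1) (t1s : 4 * t1 <= 1).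

(** Bootstrap: Q is the maximum of the squared norm over [0, t1], finite by continuity. Inserted in
    [mv_increment], it returns on the right with a factor at most 1/2 because t1 is small. *)
Lemma mv_sqint_bound s : 0 <= s <= t1 -> sqint (rho s) <= sqint_const.
Proof.
move=> st; have t10 : 0 < t1 by case/andP: t1T.
have /ltW t1T' : t1 < T by case/andP: t1T.
have E u : sqint (fun x => rho u x - 0) = sqint (rho u).
  by apply: eq_tint => x; rewrite subr0.
have := mv_sqint_within mv (cper_cst 0) (lexx 0) t1T'.
rewrite (_ : (fun _ => _) = (fun u => sqint (rho u))); last by apply/funext => u; exact: E.
move=> /(EVT_max (ltW t10)) [sm]; rewrite in_itv/= => sm1 Hmax.
apply: le_trans (Hmax s _) _; first by rewrite in_itv.
set Q := sqint (rho sm).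
have HQ u : 0 <= u <= t1 -> sqint (rho u) <= Q by move=> ut; apply: Hmax; rewrite in_itv.
have Q0 : 0 <= Q := sqint_ge0 _.
have csm : cper (rho sm) := mv_cper mv (ocT sm1).
have h1 : Q <= 2 * sqint (fun x => rho sm x - phi x) + 2 * sqint phi.
  apply: le_trans (sqintD_le (cperB csm cphi) cphi).
  by rewrite le_eqVlt; apply/orP; left; apply/eqP; apply: eq_tint => x; rewrite subrK.
have h2 := mv_increment HQ sm1; set B := energy_bound + _ in h2.
have B0 : 0 <= B by rewrite addr_ge0// !mulr_ge0// sqr_ge0.
have h3 : 2 * sm * B <= 2 * t1 * B.
  by rewrite ler_wpM2r// ler_wpM2l//; case/andP: sm1.
have h4 : 4 * t1 * energy_bound <= energy_bound by rewrite ler_piMl.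
have h5 : 8 * t1 * (d%:R * M ^+ 2) * Q <= Q by rewrite ler_piMl.
have h6 : 4 * t1 * B = 4 * t1 * energy_bound + (8 * t1 * (d%:R * M ^+ 2) * Q) / 2.
  by rewrite /B; field.
rewrite /sqint_const; move: h1 h2 h3 h4 h5 h6 sqphi; set w := sqint _.
have -> : 4 * t1 * B = 2 * (2 * t1 * B) by ring.
move: (2 * t1 * B) (2 * sm * B) (8 * t1 * (d%:R * M ^+ 2) * Q) (4 * t1 * energy_bound) => a b c e.
lra.
Qed.

Lemma mv_increment_bound t : 0 <= t <= t1 ->
  sqint (fun x => rho t x - phi x) <= 2 * t * increment_const.
Proof. by move=> tt; apply: mv_increment => // s; exact: mv_sqint_bound. Qed.

Let B0 : 0 <= increment_const.
Proof.
by rewrite /increment_const /sqint_const addr_ge0// !mulr_ge0// ?sqr_ge0// addr_ge0// mulr_ge0.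
Qed.

(* Bounds the time derivative of the k-th Fourier coefficient of rho uniformly in
   |k| <= K: after subtracting phi, the Laplacian costs K ^+ 2 times the L^2 norm
   of rho t - phi, which is of order sqrt t <= K ^- 2. *)
Definition coef_const : R :=
  4 * pi ^+ 2 * Num.sqrt N + 4 * pi ^+ 2 * Num.sqrt (2 * increment_const) +
  d%:R * (2 * pi * M * Num.sqrt (2 * increment_const) + 2 * pi * Num.sqrt N * M + M * Num.sqrt N).

Lemma coef_const_ge0 : 0 <= coef_const.
Proof.
have p0 : 0 <= pi :> R := pi_ge0 R.
by do ![exact: p0|exact: M0|exact: sqr_ge0|exact: sqrtr_ge0|exact: ler0n|apply: addr_ge0|apply: mulr_ge0].
Qed.

Section mode.
(** Here e stands for [cosk k] or [sink k]; the hypotheses are the properties that both share. *)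
Variables (K : R) (k : 'rV[int]_d) (e : 'rV[R]_d -> R).
Hypotheses (K1 : 1 <= K) (kK : freq_sq k <= K ^+ 2) (Kt : K ^+ 4 * t1 <= 1).
Hypotheses (ce : C1 e) (ce1 : forall x, `|e x| <= 1)
  (ce2 : forall i, C1 (partial i e)) (ce3 : forall i x, `|partial i e x| <= `|freq k i|)
  (ce4 : forall i x, partial i (partial i e) x = - freq k i ^+ 2 * e x)
  (ce5 : tint (fun x => phi x * e x) ^+ 2 <= fsq phi k).

Let freqK i : `|freq k i| <= 2 * pi * K.
Proof.
have K0 : 0 <= K := le_trans ler01 K1.
rewrite /freq normrM ger0_norm ?mulr_ge0 ?pi_ge0// ler_wpM2l ?mulr_ge0 ?pi_ge0//.
rewrite -(ler_pXn2r (ltn0Sn 1)) ?nnegrE// real_normK ?num_real//.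
apply: le_trans kK; rewrite /freq_sq (bigD1 i)//= lerDl sumr_ge0// => j _.
exact: sqr_ge0.
Qed.

(** Write rho = phi + w. Terms in w may lose up to two powers of K, since K^2 times the norm of w is
    bounded. Terms in [phi] may lose none: in the Laplacian the decay of its modes helps, and in the
    drift the factor [partial i e] is rewritten by the product rule, so that [H1_duality] moves the
    derivative onto [phi]. *)
Lemma mv_mode_derive t : 0 < t <= t1 -> `|tint (fun x => dt rho t x * e x)| <= coef_const.
Proof.
move=> /andP[t0 tt1]; have K0 : 0 <= K := le_trans ler01 K1.
have tI : 0 <= t <= t1 by rewrite ltW.
have tT : 0 < t < T by rewrite t0; case/andP: t1T => _; exact: le_lt_trans.
have p0 : 0 <= pi :> R := pi_ge0 R.
have cr := mv_C1 mv tT; have [_ _ cv _] := mv_conv_C1 mv tT cW.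
have ccr := C1_cper cr; have cce := C1_cper ce.
pose w x := rho t x - phi x; have cw : cper w := cperB ccr cphi.
have KK : K <= K ^+ 2 by rewrite expr2 ler_peMr.
(* The increment bound squared out: K^4 t1 <= 1 is exactly what is consumed here. *)
have nw : K ^+ 2 * nrm w <= Num.sqrt (2 * increment_const).
  have s0 : 0 <= 2 * increment_const by rewrite mulr_ge0.
  rewrite -(ler_pXn2r (ltn0Sn 1)) ?nnegrE ?mulr_ge0 ?nrm_ge0 ?sqrtr_ge0 ?exprn_ge0//.
  rewrite exprMn nrm_sq sqr_sqrtr// -exprM.
  apply: (@le_trans _ _ (K ^+ 4 * (2 * t1 * increment_const))).
    apply: ler_wpM2l; first exact: exprn_ge0.
    apply: le_trans (mv_increment_bound tI) _.
    by rewrite ler_wpM2r// ler_wpM2l.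
  rewrite (_ : _ * _ = K ^+ 4 * t1 * (2 * increment_const)); last by ring.
  by rewrite ler_piMl.
have nphi : nrm phi <= Num.sqrt N by rewrite ler_sqrt.
have E : tint (fun x => dt rho t x * e x) =
    - (4 * pi ^+ 2 * freq_sq k * tint (fun x => phi x * e x)
     + 4 * pi ^+ 2 * freq_sq k * tint (fun x => w x * e x)
     + \sum_i (tint (fun x => w x * (partial i (v t) x * partial i e x))
            + (tint (fun x => phi x * partial i (fun y => e y * partial i (v t) y) x)
              - tint (fun x => phi x * (e x * partial i (partial i (v t)) x))))).
  rewrite (mv_weak mv cW tT ce); congr (- _).
  rewrite -mulrDr -(tintD (cperM cphi cce) (cperM cw cce)).
  rewrite (@eq_tint _ _ (fun x => phi x * e x + w x * e x) (fun x => rho t x * e x)); last first.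
    by move=> x; rewrite /w; ring.
  rewrite -sum_freq_sq mulr_suml -big_split/=; apply: eq_bigr => i _.
  have [c3 p3] := C1M ce (cv i).
  congr (_ + _).
    rewrite (tint_by_parts i cr (ce2 i)) -tintZ; last exact: cperM.
    rewrite -tintN; last exact: cperM ccr (C1_partial i (ce2 i)).
    by apply: eq_tint => x; rewrite ce4; ring.
  have cd := C1_partial i ce; have cdv := C1_cper (cv i); have cddv := C1_partial i (cv i).
  have d1 : cper (fun x => w x * (partial i (v t) x * partial i e x)) := cperM cw (cperM cdv cd).
  have d2 : cper (fun x => phi x * partial i (fun y => e y * partial i (v t) y) x) := cperM cphi (C1_partial i c3).
  have d3 : cper (fun x => phi x * (e x * partial i (partial i (v t)) x)) := cperM cphi (cperM cce cddv).
  rewrite -(tintB d2 d3) -(tintD d1 (cperB d2 d3)); apply: eq_tint => x.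
  by rewrite p3 /w; ring.
rewrite E normrN /coef_const; apply: le_trans (ler_normD _ _) _; apply: lerD.
  apply: le_trans (ler_normD _ _) _; apply: lerD.
    rewrite -mulrA normrM ger0_norm ?mulr_ge0 ?sqr_ge0// ler_wpM2l ?mulr_ge0 ?sqr_ge0//.
    rewrite -(ler_pXn2r (ltn0Sn 1)) ?nnegrE ?sqrtr_ge0// sqr_sqrtr// real_normK ?num_real//.
    rewrite exprMn; apply: le_trans (HN2 k); apply: ler_pM; rewrite ?sqr_ge0//.
    by rewrite ler_pXn2r ?nnegrE ?freq_sq_ge0 ?addr_ge0 ?freq_sq_ge0// lerDr.
  rewrite -mulrA normrM ger0_norm ?mulr_ge0 ?sqr_ge0// ler_wpM2l ?mulr_ge0 ?sqr_ge0//.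
  apply: le_trans nw; rewrite normrM ger0_norm ?freq_sq_ge0//.
  apply: ler_pM; rewrite ?freq_sq_ge0//.
  apply: le_trans (tint_le_nrm cw cce) _; rewrite ler_piMr ?nrm_ge0//.
  rewrite -sqrtr1 /nrm ler_sqrt// (_ : 1 = 1 ^+ 2 :> R) ?expr1n//.
  by rewrite -[X in _ <= X](expr1n _ 2); exact: sqint_bound.
apply: le_trans (ler_norm_sum _ _ _) _.
have Mb i x : `|partial i (v t) x| <= M := mv_drift_bound mv cW WM x i tT.
apply: (@le_trans _ _ (\sum_(i < d) (2 * pi * M * Num.sqrt (2 * increment_const) +
    2 * pi * Num.sqrt N * M + M * Num.sqrt N))); last first.
  by rewrite sumr_const card_ord -[_ *+ d]mulr_natl.
apply: ler_sum => i _.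
have Mbb x : `|partial i (partial i (v t)) x| <= M := mv_drift2_bound mv cW WM x i tT.
have cdv := C1_cper (cv i); have cddv := C1_partial i (cv i); have cd := C1_partial i ce.
have [c3 p3] := C1M ce (cv i).
rewrite -addrA; apply: le_trans (ler_normD _ _) _; apply: lerD.
  have cvd := cperM cdv cd.
  apply: le_trans (tint_le_nrm cw cvd) _.
  have hb : nrm (fun x => partial i (v t) x * partial i e x) <= M * (2 * pi * K).
    have b0 : 0 <= M * (2 * pi * K) by rewrite !mulr_ge0.
    rewrite -(ler_pXn2r (ltn0Sn 1)) ?nnegrE ?nrm_ge0// nrm_sq.
    apply: sqint_bound => // x; rewrite normrM; apply: ler_pM => //.
    exact: le_trans (ce3 i x) (freqK i).
  apply: (@le_trans _ _ (nrm w * (M * (2 * pi * K)))).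
    by rewrite ler_wpM2l ?nrm_ge0.
  rewrite (_ : _ * _ = 2 * pi * M * (K * nrm w)); last by ring.
  apply: ler_wpM2l; first by rewrite !mulr_ge0.
  by apply: le_trans nw; rewrite ler_wpM2r ?nrm_ge0.
apply: le_trans (ler_normB _ _) _; apply: lerD.
  apply: le_trans (H1_duality (A := 2 * pi * Num.sqrt N) cphi c3 _ _) _.
  - by rewrite !mulr_ge0// sqrtr_ge0.
  - move=> S; rewrite exprMn sqr_sqrtr// (_ : (2 * pi) ^+ 2 * N = energy_bound); last first.
      by rewrite /energy_bound; ring.
    apply: le_trans (freq_energy S); rewrite (bigD1 i)//= lerDl sumr_ge0// => j _.
    by apply: sumr_ge0 => l _; rewrite mulr_ge0 ?sqr_ge0 ?fsq_ge0.
  apply: ler_wpM2l; first by rewrite !mulr_ge0// sqrtr_ge0.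
  rewrite -(ler_pXn2r (ltn0Sn 1)) ?nnegrE ?nrm_ge0// nrm_sq.
  apply: sqint_bound => [|x]; first exact: C1_cper c3.
  by rewrite normrM -[leRHS]mul1r; apply: ler_pM.
apply: le_trans (tint_le_nrm cphi (cperM cce cddv)) _.
rewrite mulrC; apply: ler_pM; rewrite ?nrm_ge0//.
rewrite -(ler_pXn2r (ltn0Sn 1)) ?nnegrE ?nrm_ge0// nrm_sq.
apply: sqint_bound => [|x]; first exact: cperM.
by rewrite normrM -[leRHS]mul1r; apply: ler_pM.
Qed.

Lemma mv_mode_increment t : 0 <= t <= t1 ->
  `|tint (fun x => rho t x * e x) - tint (fun x => phi x * e x)| <= coef_const * t.
Proof.
move=> /andP[]; rewrite le_eqVlt => /predU1P[<- _|t0 tt1].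
  by rewrite rho0 subrr normr0 mulr0.
have tT : t < T by case/andP: t1T => _; exact: le_lt_trans.
have [xi|xi] := @MVT R (fun s => tint (fun x => rho s x * e x))
  (fun s => tint (fun x => dt rho s x * e x)) 0 t t0 _
  (mv_tint_within mv (C1_cper ce) (lexx 0) (ltW tT)).
  rewrite in_itv/= => /andP[x0 xt]; apply: (mv_tint_derive mv) => //.
    by rewrite x0 (lt_trans xt tT).
  exact: C1_cper ce.
rewrite in_itv/= => /andP[x0 xt]; rewrite rho0 subr0 => ->.
rewrite normrM (gtr0_norm t0) ler_wpM2r ?(ltW t0)//; apply: mv_mode_derive.
by rewrite x0 (le_trans (ltW xt) tt1).
Qed.

End mode.

Lemma mv_fsq_lower (K q t : R) k : 1 <= K -> freq_sq k <= K ^+ 2 ->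
  K ^+ 4 * t1 <= 1 -> 0 <= q -> q ^+ 2 <= fsq phi k -> 4 * (coef_const * t) <= q ->
  0 <= t <= t1 -> q ^+ 2 / 4 <= fsq (rho t) k.
Proof.
move=> K1 kK Kt q0 qp cq tI.
have [cc pc] := @C1_cosk R d k; have [cs ps] := @C1_sink R d k.
have hc : `|tint (fun x => rho t x * cosk k x) - tint (fun x => phi x * cosk k x)| <= coef_const * t.
  apply: (@mv_mode_increment K k (cosk k) K1 kK Kt cc _ _ _ _ _ t tI).
  - by move=> x; rewrite ler_norml cos_le1 cos_geN1.
  - by move=> i; rewrite pc; exact: (C1Z (- freq k i) cs).1.
  - move=> i x; rewrite pc normrM normrN ler_piMr// ler_norml sin_le1.
    by rewrite sin_geN1.
  - by move=> i x; rewrite pc (C1Z (- freq k i) cs).2 ps; ring.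
  - by rewrite -/(ccoef phi k) /fsq lerDl sqr_ge0.
have hs : `|tint (fun x => rho t x * sink k x) - tint (fun x => phi x * sink k x)| <= coef_const * t.
  apply: (@mv_mode_increment K k (sink k) K1 kK Kt cs _ _ _ _ _ t tI).
  - by move=> x; rewrite ler_norml sin_le1 sin_geN1.
  - by move=> i; rewrite ps; exact: (C1Z (freq k i) cc).1.
  - move=> i x; rewrite ps normrM ler_piMr// ler_norml cos_le1.
    by rewrite cos_geN1.
  - by move=> i x; rewrite ps (C1Z (freq k i) cc).2 pc; ring.
  - by rewrite -/(scoef phi k) /fsq lerDr sqr_ge0.
have dq : coef_const * t <= q / 4 by lra.
move: qp; rewrite /fsq -/(ccoef phi k) -/(scoef phi k).
(* From b^2 <= 2 a^2 + 2 (a - b)^2 with |a - b| <= q/4. The cosine and sine parts together lose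
   q^2/4, so [fsq (rho t) k] is at least 3 q^2/8. *)
have sq (a b : R) : `|a - b| <= coef_const * t -> b ^+ 2 <= 2 * a ^+ 2 + q ^+ 2 / 8.
  move=> h; have : (a - b) ^+ 2 <= (q / 4) ^+ 2.
    rewrite -(real_normK (num_real (a - b))) ler_pXn2r ?nnegrE ?divr_ge0//.
    exact: le_trans h dq.
  have := sqr_ge0 (2 * a - b); have := sqr_ge0 (q).
  rewrite (_ : (2 * a - b) ^+ 2 = 4 * a ^+ 2 - 4 * (a * b) + b ^+ 2); last by ring.
  rewrite (_ : (a - b) ^+ 2 = a ^+ 2 - 2 * (a * b) + b ^+ 2); last by ring.
  rewrite (_ : (q / 4) ^+ 2 = q ^+ 2 / 16); last by field.
  lra.
have := sq _ _ hc; have := sq _ _ hs; rewrite -!/(ccoef _ k) -!/(scoef _ k).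
have := sqr_ge0 q; lra.
Qed.

End mv_short_time.

(** * Sobolev norms and duality *)

Lemma poweR_half_sq {R : realType} (x : \bar R) : (0 <= x)%E ->
  ((x `^ 2^-1) ^+ 2 = x)%E.
Proof.
case: x => [r| |] //; last by move=> _; rewrite poweRyr ?invr_eq0// expe2 mulyy.
by rewrite poweR_EFin lee_fin => r0; rewrite -EFin_expe powR12_sqrt// sqr_sqrtr.
Qed.

Section sobolev.
Context {R : realType} {d : nat}.
Implicit Types (f g h : 'rV[R]_d -> R) (k : 'rV[int]_d) (i : 'I_d) (s c a B : R).

Lemma freq_norm_sq k : freq_norm k ^+ 2 = freq_sq k :> R.
Proof. by rewrite sqr_sqrtr// freq_sq_ge0. Qed.

Lemma normc_fourier_sq f k : Normc.normc (fourier_coef f k) ^+ 2 = fsq f k.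
Proof.
by rewrite /Normc.normc /fourier_coef sqr_sqrtr ?addr_ge0 ?sqr_ge0// sqrrN.
Qed.

Definition hs_weight s f k : R := (1 + freq_sq k) `^ s * fsq f k.

Lemma hs_weight_ge0 s f k : 0 <= hs_weight s f k.
Proof. by rewrite mulr_ge0 ?powR_ge0 ?fsq_ge0. Qed.

Lemma Hs_norm_sq s f :
  (Hs_norm s f ^+ 2 = \esum_(k in [set: 'rV[int]_d]) (hs_weight s f k)%:E)%E.
Proof.
rewrite /Hs_norm poweR_half_sq; last first.
  by apply: esum_ge0 => k _; rewrite lee_fin mulr_ge0 ?powR_ge0 ?sqr_ge0.
by apply: eq_esum => k _; rewrite freq_norm_sq normc_fourier_sq.
Qed.

Lemma Hs_norm_ge0 s f : (0 <= Hs_norm s f)%E.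
Proof. exact: poweR_ge0. Qed.

Lemma Hs_norm_sum_le s f c : (Hs_norm s f ^+ 2 <= c%:E)%E ->
  forall S : {fset 'rV[int]_d}, \sum_(k <- enum_fset S) hs_weight s f k <= c.
Proof.
rewrite Hs_norm_sq => H S; rewrite -lee_fin -sumEFin; apply: le_trans H.
apply: esum_ge; exists [set` S]; first by split.
by rewrite fsbig_finite//= set_fsetK.
Qed.

Lemma sum_Hs_norm_le s f c :
  (forall S : {fset 'rV[int]_d}, \sum_(k <- enum_fset S) hs_weight s f k <= c) ->
  (Hs_norm s f ^+ 2 <= c%:E)%E.
Proof.
move=> H; rewrite Hs_norm_sq; apply: ge_ereal_sup => _ [A [fA _] <-].
by rewrite fsbig_finite//= sumEFin lee_fin; exact: H.
Qed.

Lemma L2_norm_sq f : cper f -> (L2_norm f ^+ 2 = (sqint f)%:E)%E.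
Proof.
move=> cf; rewrite /L2_norm unlock poweR_half_sq; last first.
  by apply: integral_ge0 => x _; exact: poweR_ge0.
have ci := cper_integrable (cperX 2 cf).
rewrite /sqint /tint /Rintegral fineK ?integrable_fin_num//.
apply: eq_integral => x _ /=; rewrite powR_mulrn ?normr_ge0// real_normK ?num_real//.
Qed.

(** The squared H^1 norm in physical space; the Sobolev weight is 1 + |k|^2, whereas differentiation
    produces 2 pi k, hence the factor. *)
Definition h1sq f : R := sqint f + (4 * pi ^+ 2)^-1 * \sum_i sqint (partial i f).

Let pi2 : 0 < 4 * pi ^+ 2 :> R.
Proof. by rewrite mulr_gt0// exprn_gt0// pi_gt0. Qed.

Lemma hs1_sum f (S : {fset 'rV[int]_d}) : C1 f ->
  \sum_(k <- enum_fset S) hs_weight 1 f k = \sum_(k <- enum_fset S) fsq f k +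
    (4 * pi ^+ 2)^-1 * \sum_i \sum_(k <- enum_fset S) fsq (partial i f) k.
Proof.
move=> cf; rewrite exchange_big/= mulr_sumr -big_split/=; apply: eq_bigr => k _.
rewrite /hs_weight powRr1 ?addr_ge0 ?freq_sq_ge0// mulrDl mul1r; congr (_ + _).
rewrite (eq_bigr (fun i => freq k i ^+ 2 * fsq f k)) => [|i _]; last exact: fsq_partial.
by rewrite -mulr_suml sum_freq_sq mulrA mulrA mulVf ?gt_eqF// mul1r.
Qed.

(** One inequality is Bessel applied to f and to its partial derivatives. For the converse a single
    symmetric set has to nearly exhaust all of them at once, hence the union of the [S1 i] with
    [S0]. *)
Lemma Hs1_norm_sq f : C1 f -> (Hs_norm 1 f ^+ 2 = (h1sq f)%:E)%E.
Proof.
move=> cf; have cc := C1_cper cf; apply/eqP; rewrite eq_le; apply/andP; split.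
  apply: sum_Hs_norm_le => S; rewrite hs1_sum// lerD ?bessel//.
  rewrite ler_wpM2l ?invr_ge0 ?(ltW pi2)//; apply: ler_sum => i _.
  exact: bessel (C1_partial i cf).
rewrite Hs_norm_sq; apply/lee_addgt0Pr => e e0.
have cp i := C1_partial i cf.
pose n : R := d%:R + 1; have n0 : 0 < n by rewrite ltr_wpDl.
have e2 : 0 < e / 2 by rewrite divr_gt0.
have en : 0 < 4 * pi ^+ 2 * (e / 2) / n by rewrite divr_gt0// mulr_gt0.
have [S0 HS0] := proj_cvg cc e2.
have [S1 HS1] : exists S1 : 'I_d -> {fset 'rV[int]_d}, forall i S, symm S ->
    (S1 i `<=` S)%fset ->
    sqint (fun x => partial i f x - proj S (partial i f) x) <= 4 * pi ^+ 2 * (e / 2) / n.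
  exists (fun i => sval (cid (proj_cvg (cp i) en))) => i.
  exact: svalP (cid (proj_cvg (cp i) en)).
pose S := symmz (S0 `|` \bigcup_(i <- enum 'I_d) S1 i)%fset.
have sS : symm S := symm_symmz _.
have SS := symmz_sub (S0 `|` \bigcup_(i <- enum 'I_d) S1 i)%fset.
have := HS0 S sS (fsubset_trans (fsubsetUl _ _) SS); rewrite proj_dist// lerBlDr => h0.
have h1 i : sqint (partial i f) <= 4 * pi ^+ 2 * (e / 2) / n +
    \sum_(k <- enum_fset S) fsq (partial i f) k.
  rewrite -lerBlDr -proj_dist//; apply: HS1 => //.
  apply: fsubset_trans SS; apply: fsubset_trans (fsubsetUr _ _).
  by apply: (bigfcup_sup (P := predT)); rewrite ?mem_enum.
apply: (@le_trans _ _ ((\sum_(k <- enum_fset S) hs_weight 1 f k)%:E + e%:E)%E); last first.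
  rewrite leeD2r// -sumEFin; apply: esum_ge; exists [set` S]; first by split.
  by rewrite fsbig_finite//= set_fsetK.
rewrite -EFinD lee_fin hs1_sum// /h1sq.
have h2 : \sum_i sqint (partial i f) <= 4 * pi ^+ 2 * (e / 2) +
    \sum_i \sum_(k <- enum_fset S) fsq (partial i f) k.
  apply: le_trans (ler_sum _ (fun i _ => h1 i)) _; rewrite big_split/= lerD2r.
  rewrite sumr_const card_ord -[_ *+ d]mulr_natl.
  rewrite mulrA ler_pdivrMr// mulrC ler_wpM2l//; last by rewrite lerDl.
  by rewrite mulr_ge0 ?(ltW pi2)// ltW.
have h3 : (4 * pi ^+ 2)^-1 * (\sum_i sqint (partial i f)) <= e / 2 + (4 * pi ^+ 2)^-1 *
    \sum_i \sum_(k <- enum_fset S) fsq (partial i f) k.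
  rewrite -[e / 2](mulKf (lt0r_neq0 pi2)) -mulrDr ler_wpM2l ?invr_ge0 ?(ltW pi2)//.
move: h0 h3; set a := _^-1 * _; set b := _^-1 * _; lra.
Qed.

Lemma sqe_lty (x : \bar R) : (x ^+ 2 < +oo)%E -> (x < +oo)%E.
Proof. by case: x => [r _| |//]; rewrite ?ltry ?ltNyr// expe2 mulyy. Qed.

Lemma C1_Hs1 f : C1 f -> Hs 1 f.
Proof.
move=> cf; have [pf cfc] := C1_cper cf; split => //.
- exact: continuous_row_measurable.
- by apply: sqe_lty; rewrite L2_norm_sq ?ltry.
- by apply: sqe_lty; rewrite Hs1_norm_sq ?ltry.
Qed.

Lemma h1sqZ c f : C1 f -> h1sq (fun x => c * f x) = c ^+ 2 * h1sq f.
Proof.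
move=> cf; have [_ pc] := C1Z c cf.
have E g : cper g -> sqint (fun x => c * g x) = c ^+ 2 * sqint g.
  move=> cg; rewrite /sqint -tintZ; last exact: cperX.
  by apply: eq_tint => x; rewrite exprMn.
have E2 : \sum_i sqint (partial i (fun x => c * f x)) = c ^+ 2 * \sum_i sqint (partial i f).
  rewrite mulr_sumr; apply: eq_bigr => i _; rewrite pc; exact: E (C1_partial i cf).
rewrite [LHS]/h1sq E2 (E f (C1_cper cf)) /h1sq.
by ring.
Qed.

Lemma dual_linear0 (G : ('rV[R]_d -> R) -> R) : Hs_dual 1 G -> G (fun=> 0) = 0.
Proof.
move=> [Glin _]; have c0 : C1 (fun _ : 'rV[R]_d => 0 : R) := (C1_cst 0).1.
have := Glin 1 _ _ (C1_Hs1 c0) (C1_Hs1 c0).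
rewrite (_ : (fun _ => _ * 0 + 0) = (fun=> 0)); last by apply/funext => x; ring.
by move: (G _) => z; lra.
Qed.

Lemma dual_normP (G : ('rV[R]_d -> R) -> R) h a : Hs_dual 1 G -> C1 h -> 0 < a ->
  h1sq h <= a ^+ 2 -> `|G h| <= fine (dual_norm 1 G) * a.
Proof.
move=> HG ch a0 ha; have [Glin Gfin] := HG.
have c0 : C1 (fun _ : 'rV[R]_d => 0 : R) := (C1_cst 0).1.
have G0 := dual_linear0 HG.
have Gh : G (fun x => a^-1 * h x) = a^-1 * G h.
  have := Glin a^-1 _ _ (C1_Hs1 ch) (C1_Hs1 c0).
  rewrite G0 addr0 => <-; congr G; apply/funext => x; exact/esym/addr0.
have chz : C1 (fun x => a^-1 * h x) := (C1Z a^-1 ch).1.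
have le : ((`|G (fun x => a^-1 * h x)|)%:E <= dual_norm 1 G)%E.
  apply: ereal_sup_ubound; exists (fun x => a^-1 * h x) => //; split; first exact: C1_Hs1.
  have := Hs1_norm_sq chz; rewrite h1sqZ//.
  have le1 : a^-1 ^+ 2 * h1sq h <= 1.
    by rewrite exprVn mulrC ler_pdivrMr ?exprn_gt0// mul1r.
  have := Hs_norm_ge0 1 (fun x => a^-1 * h x).
  case: (Hs_norm _ _) => [r| |]//; rewrite !lee_fin => r0.
  rewrite -EFin_expe => -[E]; rewrite -(ler_pXn2r (ltn0Sn 1)) ?nnegrE// E expr1n//.
have d0 : (0 <= dual_norm 1 G)%E by apply: le_trans le; rewrite lee_fin.
have fd : dual_norm 1 G \is a fin_num by rewrite ge0_fin_numE.
move: le; rewrite -(fineK fd) lee_fin Gh normrM gtr0_norm ?invr_gt0//.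
by rewrite mulrC ler_pdivrMr.
Qed.

Lemma dual_trig (G : ('rV[R]_d -> R) -> R) f p : Hs_dual 1 G -> cper f ->
  (forall k, G (cosk k) = tint (fun x => f x * cosk k x)) ->
  (forall k, G (sink k) = tint (fun x => f x * sink k x)) ->
  trig p -> G p = tint (fun x => f x * p x).
Proof.
move=> HG cf Gc Gs; have [Glin _] := HG; have c0 : C1 (fun _ : 'rV[R]_d => 0 : R) := (C1_cst 0).1.
have G0 := dual_linear0 HG.
elim => [k|k|g h tg Hg th Hh|c g tg Hg] //.
  have := Glin 1 _ _ (C1_Hs1 (trig_C1 tg).1) (C1_Hs1 (trig_C1 th).1).
  rewrite (_ : (fun _ => _ * _ + _) = (fun x => g x + h x)); last by apply/funext => x; rewrite mul1r.
  move=> ->; rewrite Hg Hh mul1r -(tintD (cperM cf (trig_cper tg)) (cperM cf (trig_cper th))).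
  by apply: eq_tint => x; rewrite mulrDr.
have := Glin c _ _ (C1_Hs1 (trig_C1 tg).1) (C1_Hs1 c0).
rewrite (_ : (fun _ => _ * _ + 0) = (fun x => c * g x)); last by apply/funext => x; rewrite addr0.
move=> ->; rewrite G0 addr0 Hg -(tintZ c (cperM cf (trig_cper tg))).
by apply: eq_tint => x; ring.
Qed.

(** G is identified with f on trigonometric polynomials only, so g is replaced by a projection.
    Projections commute with derivatives and decrease the L^2 norm, hence do not increase [h1sq]. *)
Lemma dual_trig_bound (G : ('rV[R]_d -> R) -> R) f g a : Hs_dual 1 G -> cper f ->
  (forall p, trig p -> G p = tint (fun x => f x * p x)) ->
  C1 g -> 0 < a -> h1sq g <= a ^+ 2 ->
  `|tint (fun x => f x * g x)| <= fine (dual_norm 1 G) * a.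
Proof.
move=> HG cf Gf cg a0 ga; have cgc := C1_cper cg.
apply/ler_addgt0Pr => e e0.
pose q := e / (nrm f + 1); have n1 : 0 < nrm f + 1 by rewrite ltr_wpDl ?nrm_ge0.
have q0 : 0 < q by rewrite divr_gt0.
have q20 : 0 < q ^+ 2 by rewrite exprn_gt0.
have [S0 /(_ _ (symm_symmz S0) (symmz_sub S0))] := proj_cvg cgc q20.
set S := symmz S0; set p := proj S g => hp.
have sS : symm S := symm_symmz _.
have tp : trig p := trig_synth S _ _; have cp := trig_cper tp.
have pa : h1sq p <= a ^+ 2.
  have pp i : partial i p = proj S (partial i g) := proj_partial S i cg.
  have l1 : sqint p <= sqint g := sqint_proj_le sS cgc.
  have l2 : \sum_i sqint (partial i p) <= \sum_i sqint (partial i g).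
    by apply: ler_sum => i _; rewrite pp; exact: sqint_proj_le sS (C1_partial i cg).
  have i0 : 0 <= (4 * pi ^+ 2 : R)^-1 by rewrite invr_ge0 ltW.
  exact: le_trans (lerD l1 (ler_wpM2l i0 l2)) ga.
have h1 := dual_normP HG (trig_C1 tp).1 a0 pa.
rewrite Gf// in h1.
have E : tint (fun x => f x * g x) = tint (fun x => f x * p x) +
    tint (fun x => f x * (g x - p x)).
  rewrite -(tintD (cperM cf cp) (cperM cf (cperB cgc cp))).
  by apply: eq_tint => x; ring.
rewrite E; apply: le_trans (ler_normD _ _) _; apply: lerD => //.
apply: le_trans (tint_le_nrm cf (cperB cgc cp)) _.
have hq : nrm (fun x => g x - p x) <= q.
  by rewrite -(ler_pXn2r (ltn0Sn 1)) ?nnegrE ?nrm_ge0 ?(ltW q0)// nrm_sq.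
apply: (@le_trans _ _ (nrm f * q)); first by rewrite ler_wpM2l ?nrm_ge0.
by rewrite /q mulrA ler_pdivrMr// mulrC ler_wpM2l ?(ltW e0)// lerDl.
Qed.

End sobolev.

(** * The inverse estimate *)

Section mv_gradient.
Context {R : realType} {d : nat}.
Implicit Types (k : 'rV[int]_d) (x : 'rV[R]_d) (i : 'I_d).

Lemma freq_sq_ge1 k : k != 0 -> 1 <= freq_sq k :> R.
Proof.
move=> k0; have [i ki] : exists i, k 0 i != 0.
  apply/existsP; move: k0; apply: contraR; rewrite negb_exists => /forallP H.
  by apply/eqP/rowP => i; rewrite mxE; move: (H i); rewrite negbK => /eqP.
rewrite /freq_sq (bigD1 i)//=.
have h : 1 <= (k 0 i)%:~R ^+ 2 :> R by rewrite sqr_intr_ge1 ?intr_eq0// intr_int.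
by apply: le_trans h _; rewrite lerDl; apply: sumr_ge0 => j _; exact: sqr_ge0.
Qed.

Variables (T M Q m : R) (W W0 phi : 'rV[R]_d -> R) (r1 r0 : R -> 'rV[R]_d -> R).
Hypotheses (mv1 : McKean_Vlasov_solution T W phi r1)
  (mv0 : McKean_Vlasov_solution T W0 phi r0) (cW : cper W) (cW0 : cper W0)
  (WM : (W2oo_norm W <= M%:E)%E).
Variable t : R.
Hypotheses (tT : 0 < t < T) (m0 : 0 < m) (r0m : forall x, m / 2 <= r0 t x)
  (r0Q : sqint (r0 t) <= Q).

Let w x := W x - W0 x.
Let u x := r1 t x - r0 t x.
Let g := convolution w (r0 t).
Let cr1 : C1 (r1 t) := mv_C1 mv1 tT.
Let cr0 : C1 (r0 t) := mv_C1 mv0 tT.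
Let cw : cper w := cperB cW cW0.
Let cu : C1 u := (C1B cr1 cr0).1.
Let pu i : partial i u = fun x => partial i (r1 t) x - partial i (r0 t) x.
Proof. by rewrite (C1B cr1 cr0).2. Qed.
Let cg : C1 g := (C1_conv cw cr0).1.
Let pg i : partial i g = convolution w (partial i (r0 t)) := (C1_conv cw cr0).2 i.
Let cWu : C1 (convolution W u) := (C1_conv cW cu).1.
Let pWu i : partial i (convolution W u) = convolution W (partial i u) := (C1_conv cW cu).2 i.

(** The flux of the difference u without the forcing r0 grad g: diffusion of u, transport of u by
    the drift of r1, and transport of r0 by the drift generated by u. *)
Let z i x := partial i u x + (u x * partial i (convolution W (r1 t)) x +
  r0 t x * partial i (convolution W u) x).

Let cV i : cper (partial i (convolution W (r1 t))).
Proof. by have [_ _ cv _] := mv_conv_C1 mv1 tT cW; exact: C1_cper (cv i). Qed.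

Let cz1 i : cper (fun x => u x * partial i (convolution W (r1 t)) x) := cperM (C1_cper cu) (cV i).
Let cz2 i : cper (fun x => r0 t x * partial i (convolution W u) x) :=
  cperM (C1_cper cr0) (C1_partial i cWu).
Let cz i : cper (z i) := cperD (C1_partial i cu) (cperD (cz1 i) (cz2 i)).

Lemma mv_diff_weak h : C1 h ->
  tint (fun x => (dt r1 t x - dt r0 t x) * h x) =
  - \sum_i tint (fun x => (z i x + r0 t x * partial i g x) * partial i h x).
Proof.
move=> ch; have chc := C1_cper ch.
have cd1 := mv_cper_dt mv1 tT; have cd0 := mv_cper_dt mv0 tT.
rewrite (@eq_tint _ _ (fun x => (dt r1 t x - dt r0 t x) * h x)
  (fun x => dt r1 t x * h x - dt r0 t x * h x)); last by move=> x; rewrite mulrBl.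
rewrite (tintB (cperM cd1 chc) (cperM cd0 chc)).
rewrite (mv_weak mv1 cW tT ch) (mv_weak mv0 cW0 tT ch) -opprB opprK addrC -sumrB.
congr (- _); apply: eq_bigr => i _.
have [_ pv1 cv1 _] := mv_conv_C1 mv1 tT cW.
have [_ pv0 cv0 _] := mv_conv_C1 mv0 tT cW0.
have cph := C1_partial i ch.
have c1 := cperM (C1_partial i cr1) cph; have c0 := cperM (C1_partial i cr0) cph.
have c3 := cperM (cperM (C1_cper cr1) (C1_cper (cv1 i))) cph.
have c4 := cperM (cperM (C1_cper cr0) (C1_cper (cv0 i))) cph.
have e1 := tintD c1 c3; have e0 := tintD c0 c4.
have e2 := tintB (cperD c1 c3) (cperD c0 c4).
apply: etrans (congr2 (fun a b => a - b) (esym e1) (esym e0)) _.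
apply: etrans (esym e2) _; apply: eq_tint => x; rewrite /z pv1 pv0 pg pWu pu.
rewrite (convBl x cW cW0 (C1_partial i cr0)).
rewrite (convBr x cW (C1_partial i cr1) (C1_partial i cr0)) /u.
move: (convolution W (partial i (r1 t)) x) (convolution W (partial i (r0 t)) x).
move: (convolution W0 (partial i (r0 t)) x) (partial i (r1 t) x) (partial i (r0 t) x).
by move: (r1 t x) (r0 t x) (partial i h x) => a1 a0 b c3' c2' c1' b1 b0; ring.
Qed.

(** From |a + b + c|^2 <= 2 |a|^2 + 4 |b|^2 + 4 |c|^2 for the three parts of [z], summed over d
    directions; 8 pi^2 is 2 times the 4 pi^2 that undoes the normalization of [h1sq]. *)
Definition drift_const : R := 8 * pi ^+ 2 + 4 * d%:R * M ^+ 2 * (1 + Q).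

Lemma sum_drift_le : \sum_i sqint (z i) <= drift_const * h1sq u.
Proof.
have M0 : 0 <= M := mv_M_ge0 WM.
have Q0 : 0 <= Q := le_trans (sqint_ge0 _) r0Q.
have u0 := sqint_ge0 u.
have hi i : sqint (z i) <= 2 * sqint (partial i u) + 4 * M ^+ 2 * (1 + Q) * sqint u.
  apply: le_trans (sqintD_le (C1_partial i cu) (cperD (cz1 i) (cz2 i))) _.
  rewrite lerD2l; have h := sqintD_le (cz1 i) (cz2 i).
  have h1 : sqint (fun x => u x * partial i (convolution W (r1 t)) x) <= M ^+ 2 * sqint u.
    apply: sqintM_le (C1_cper cu) (cV i) _ => x; exact: (mv_drift_bound mv1 cW WM x i tT).
  have h2 : sqint (fun x => r0 t x * partial i (convolution W u) x) <= M ^+ 2 * sqint u * Q.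
    apply: (@le_trans _ _ ((M * nrm u) ^+ 2 * sqint (r0 t))).
      apply: sqintM_le (C1_cper cr0) (C1_partial i cWu) _ => x; rewrite pWu.
      apply: le_trans (W2oo_conv1 i x cW cu WM) _.
      by rewrite ler_wpM2l// tint_norm_le_nrm//; exact: C1_cper.
    by rewrite exprMn nrm_sq ler_wpM2l// mulr_ge0// sqr_ge0.
  move: h h1 h2; set a := sqint _; set b := sqint _; set c := sqint _.
  have -> : 4 * M ^+ 2 * (1 + Q) * sqint u = 4 * (M ^+ 2 * sqint u) + 4 * (M ^+ 2 * sqint u * Q) by ring.
  by move: (M ^+ 2 * sqint u) (M ^+ 2 * sqint u * Q) => p q; lra.
apply: le_trans (ler_sum _ (fun i _ => hi i)) _.
rewrite big_split/= sumr_const card_ord -[_ *+ d]mulr_natl -mulr_sumr /drift_const /h1sq.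
set X := \sum_i _; have X0 : 0 <= X by apply: sumr_ge0 => i _; exact: sqint_ge0.
rewrite [leRHS]mulrDr.
have -> : (8 * pi ^+ 2 + 4 * d%:R * M ^+ 2 * (1 + Q)) * ((4 * pi ^+ 2)^-1 * X) =
   2 * X + (4 * d%:R * M ^+ 2 * (1 + Q)) * ((4 * pi ^+ 2)^-1 * X).
  have p0 : (4 * pi ^+ 2 : R) != 0 by rewrite gt_eqF// mulr_gt0// exprn_gt0// pi_gt0.
  rewrite mulrDl; congr (_ + _); rewrite mulrA (_ : 8 * pi ^+ 2 = 2 * (4 * pi ^+ 2)).
    by rewrite mulfK.
  by ring.
have -> : d%:R * (4 * M ^+ 2 * (1 + Q) * sqint u) = 4 * d%:R * M ^+ 2 * (1 + Q) * sqint u by ring.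
rewrite (mulrDl (8 * pi ^+ 2)).
have a1 : 0 <= 8 * pi ^+ 2 * sqint u by rewrite mulr_ge0// mulr_ge0// sqr_ge0.
have a2 : 0 <= 4 * d%:R * M ^+ 2 * (1 + Q) * ((4 * pi ^+ 2)^-1 * X).
  apply: mulr_ge0; last by rewrite mulr_ge0// invr_ge0 mulr_ge0// sqr_ge0.
  by rewrite mulr_ge0 ?addr_ge0// mulr_ge0 ?sqr_ge0.
by move: a1 a2; lra.
Qed.

Hypothesis mean0 : tint w = 0.

Let X : R := \sum_i sqint (partial i g).

Let fsqg k : fsq g k = fsq w k * fsq (r0 t) k := fsq_conv k cw (C1_cper cr0).

Lemma fsq_w0 : fsq w 0 = 0.
Proof.
have -> : fsq w 0 = tint w ^+ 2; last by rewrite mean0 expr0n.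
rewrite /fsq /ccoef /scoef.
rewrite (@eq_tint _ _ (fun x => w x * cosk 0 x) w) => [|x]; last by rewrite cosk0 mulr1.
rewrite (@eq_tint _ _ (fun x => w x * sink 0 x) (fun=> 0)) => [|x]; last by rewrite sink0 mulr0.
by rewrite tint0 expr0n addr0.
Qed.

Let sum_fsq_partial (S : {fset 'rV[int]_d}) :
  \sum_(k <- enum_fset S) 4 * pi ^+ 2 * freq_sq k * fsq g k <= X.
Proof.
apply: (@le_trans _ _ (\sum_i \sum_(k <- enum_fset S) fsq (partial i g) k)); last first.
  by apply: ler_sum => i _; exact: bessel (C1_partial i cg).
rewrite exchange_big/= le_eqVlt; apply/orP; left; apply/eqP; apply: eq_bigr => k _.
rewrite -sum_freq_sq mulr_suml; apply: eq_bigr => i _; exact/esym/fsq_partial.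
Qed.

(** The zero mode of g vanishes because W - W0 has mean zero, and every other frequency has |k| >=
    1. *)
Lemma poincare_g : 4 * pi ^+ 2 * sqint g <= X.
Proof.
have p0 : 0 < 4 * pi ^+ 2 :> R by rewrite mulr_gt0// exprn_gt0// pi_gt0.
rewrite mulrC -ler_pdivlMr//; apply: parseval_le (C1_cper cg) _ => S.
rewrite ler_pdivlMr//; apply: le_trans (sum_fsq_partial S); rewrite mulr_suml.
apply: ler_sum => k _; have [->|k0] := eqVneq k 0.
  by rewrite fsqg fsq_w0 !(mul0r, mulr0).
rewrite mulrC; apply: ler_wpM2r; first exact: fsq_ge0.
by rewrite ler_peMr ?(ltW p0)// freq_sq_ge1.
Qed.

Lemma gradient_lower (S : {fset 'rV[int]_d}) (q : R) :
  (forall k, k \in S -> k != 0 -> q ^+ 2 / 4 <= fsq (r0 t) k) ->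
  q ^+ 2 * \sum_(k <- enum_fset S) fsq w k <= X.
Proof.
move=> Hq; apply: le_trans (sum_fsq_partial S); rewrite mulr_sumr big_seq [leRHS]big_seq.
apply: ler_sum => k kS; rewrite fsqg.
have [->|k0] := eqVneq k 0; first by rewrite fsq_w0 !(mul0r, mulr0).
have h := Hq k kS k0; have k1 : 1 <= freq_sq k :> R := freq_sq_ge1 k0.
have p1 : 1 <= pi ^+ 2 :> R by rewrite exprn_ege1// (le_trans _ (pi_ge2 R))// ler1n.
rewrite (mulrC (fsq w k)) mulrA ler_wpM2r ?fsq_ge0//.
have h1 : 4 * pi ^+ 2 * freq_sq k * (q ^+ 2 / 4) <= 4 * pi ^+ 2 * freq_sq k * fsq (r0 t) k.
  by rewrite ler_wpM2l// mulr_ge0 ?freq_sq_ge0// mulr_ge0// sqr_ge0.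
apply: le_trans h1.
have -> : 4 * pi ^+ 2 * freq_sq k * (q ^+ 2 / 4) = (pi ^+ 2 * freq_sq k) * q ^+ 2 by field.
rewrite ler_peMl ?sqr_ge0//; apply: mulr_ege1 => //.
Qed.

(* The equation for r1 - r0 is tested against g = (W - W0) * r0, the only choice
   for which the forcing term div (r0 grad g) becomes coercive. *)
Lemma gradient_upper (D : R) :
  (forall a, 0 < a -> h1sq g <= a ^+ 2 ->
    `|tint (fun x => (dt r1 t x - dt r0 t x) * g x)| <= D * a) ->
  X <= (16 * D ^+ 2 + 8 * drift_const * h1sq u) / m ^+ 2.
Proof.
move=> HD.
have X0 : 0 <= X by apply: sumr_ge0 => i _; exact: sqint_ge0.
have Z := sum_drift_le; set Zb := drift_const * h1sq u in Z *.
have Zb0 : 0 <= Zb by apply: le_trans Z; apply: sumr_ge0 => i _; exact: sqint_ge0.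
have m20 : 0 < m ^+ 2 by rewrite exprn_gt0.
(* The duality hypothesis asks for a > 0, so X = 0 is set apart before taking a = sqrt X. *)
move: (X0); rewrite le_eqVlt => /predU1P[<-|Xp].
  rewrite divr_ge0 ?(ltW m20)// -(mulrA 8); apply: addr_ge0; last exact: mulr_ge0.
  by rewrite mulr_ge0// sqr_ge0.
pose a := Num.sqrt X; have a0 : 0 < a by rewrite sqrtr_gt0.
have a2 : a ^+ 2 = X by rewrite sqr_sqrtr.
have ha : h1sq g <= a ^+ 2.
  rewrite a2 /h1sq -/X; have hg := poincare_g; have g0 := sqint_ge0 g.
  have p1 : 1 <= pi ^+ 2 :> R by rewrite exprn_ege1// (le_trans _ (pi_ge2 R))// ler1n.
  have q0 : 0 < 4 * pi ^+ 2 :> R by rewrite mulr_gt0// (lt_le_trans ltr01).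
  have h1 : 4 * sqint g <= 4 * pi ^+ 2 * sqint g by rewrite ler_wpM2r// ler_peMr.
  have h2 : (4 * pi ^+ 2)^-1 * X <= 4^-1 * X.
    by rewrite ler_wpM2r// lef_pV2 ?posrE// ler_peMr.
  by move: h1 h2 hg; lra.
have hD := HD a a0 ha.
(* Young's inequality pointwise: half of the coercivity constant m/2 is given up to absorb the cross
   term with [z]. *)
have lower i : m / 4 * sqint (partial i g) - m^-1 * sqint (z i) <=
    tint (fun x => (z i x + r0 t x * partial i g x) * partial i g x).
  have cpg := C1_partial i cg.
  have c1 := cperZ (m / 4) (cperX 2 cpg); have c2 := cperZ m^-1 (cperX 2 (cz i)).
  rewrite /sqint -(tintZ (m / 4) (cperX 2 cpg)) -(tintZ m^-1 (cperX 2 (cz i))) -(tintB c1 c2).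
  apply: tint_le (cperB c1 c2) (cperM (cperD (cz i) (cperM (C1_cper cr0) cpg)) cpg) _ => x.
  have := r0m x; move: (r0 t x) (partial i g x) (z i x) => b y v hb.
  rewrite -subr_ge0 (_ : _ - _ = (b - m / 2) * y ^+ 2 + m^-1 * (v + m / 2 * y) ^+ 2); last first.
    by field; rewrite gt_eqF.
  by rewrite addr_ge0// mulr_ge0 ?sqr_ge0// ?subr_ge0// invr_ge0 ltW.
have hl : m / 4 * X - m^-1 * (\sum_i sqint (z i)) <=
    \sum_i tint (fun x => (z i x + r0 t x * partial i g x) * partial i g x).
  by rewrite /X !mulr_sumr -sumrB; apply: ler_sum => i _; exact: lower.
have E := mv_diff_weak cg; move: hD E; set I := tint _; set J := \sum_i tint _ in hl *.
move=> hI IJ; have hI2 : J <= D * a by apply: le_trans hI; rewrite IJ normrN ler_norm.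
have hZ : m^-1 * (\sum_i sqint (z i)) <= m^-1 * Zb by rewrite ler_wpM2l// invr_ge0 ltW.
(* Young's inequality again, D a <= (m/8) a^2 + 2 D^2 / m, keeping half of the remaining (m/4) X. *)
have hq : 0 <= (8 * m)^-1 * (m * a - 4 * D) ^+ 2.
  by rewrite mulr_ge0 ?sqr_ge0// invr_ge0 mulr_ge0// ltW.
have Eq : (8 * m)^-1 * (m * a - 4 * D) ^+ 2 = m / 8 * X - D * a + m^-1 * (2 * D ^+ 2).
  by rewrite -a2; field; rewrite gt_eqF.
have F : m / 8 * X <= m^-1 * (2 * D ^+ 2 + Zb).
  rewrite mulrDr; move: hl hI2 hZ hq; rewrite Eq.
  move: (m^-1 * Zb) (m^-1 * \sum_i _) (m^-1 * (2 * D ^+ 2)) (D * a) => A1 A2 A3 A4.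
  rewrite -[m / 4 * X]mulrA -[m / 8 * X]mulrA (mulrC _^-1 X) (mulrC _^-1 X) !mulrA.
  by lra.
rewrite ler_pdivlMr//.
have -> : X * m ^+ 2 = 8 * m * (m / 8 * X) by field.
have -> : 16 * D ^+ 2 + 8 * drift_const * h1sq u = 8 * m * (m^-1 * (2 * D ^+ 2 + Zb)).
  by rewrite /Zb; field; rewrite gt_eqF.
by rewrite ler_wpM2l// mulr_ge0// ltW.
Qed.

End mv_gradient.

(** * Lower bounds for time integrals *)

Section integral_lower.
Context {R : realType}.
Local Notation leb := (@lebesgue_measure R).

(* No measurability is assumed: the integral of a nonnegative function is a
   supremum over the simple functions below it. *)
Lemma ge0_subset_le_integral (D1 D2 : set (measurableTypeR R)) (f1 f2 : R -> \bar R) :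
  D1 `<=` D2 -> (forall t, D1 t -> 0 <= f1 t)%E -> (forall t, D2 t -> 0 <= f2 t)%E ->
  (forall t, D1 t -> f1 t <= f2 t)%E ->
  (\int[leb]_(t in D1) f1 t <= \int[leb]_(t in D2) f2 t)%E.
Proof.
move=> D12 f10 f20 f12; rewrite ge0_integralE// ge0_integralE//.
apply: ereal_sup_le => _ [h /= hf <-]; exists h => //= t; apply: le_trans (hf t) _; rewrite !patchE.
case: ifPn => [|_]; last by case: ifPn => // /set_mem; exact: f20.
by move=> /set_mem tD; rewrite mem_set; [exact: f12|exact: D12].
Qed.

(* A will be the squared dual norm of a weak time derivative, whose measurability
   is not known. *)
Lemma integral_ae_lower (t0 L : R) (A E : R -> \bar R) (e : R -> R) :
  0 < t0 -> 0 <= L -> (forall t, 0 <= A t)%E -> (forall t, 0 <= E t)%E ->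
  (forall t, 0 < t < t0 -> E t = (e t)%:E) ->
  measurable_fun (`]0, t0[%classic : set (measurableTypeR R)) e ->
  {ae leb, forall t, 0 < t < t0 -> (L%:E <= A t + (e t)%:E)%E} ->
  ((t0 * L)%:E <= \int[leb]_(t in `[0%R, t0]) A t + \int[leb]_(t in `[0%R, t0]) E t)%E.
Proof.
move=> t00 L0 A0 E0 Ee me [N [mN N0 HN]].
pose D := `]0, t0[%classic `\` N : set (measurableTypeR R).
have mD : measurable D by apply: measurableD => //; exact: measurable_itv.
have DI t : D t -> 0 < t < t0 by move=> -[] /=; rewrite in_itv.
have Dc : D `<=` `[0, t0]%classic by move=> t /DI /andP[h1 h2]; rewrite /= in_itv/= !ltW.
have meD : measurable_fun D e by apply: measurable_funS me => // t [].
have e0 t : D t -> 0 <= e t by move=> /DI tI; rewrite -lee_fin -Ee.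
(* Off the null set, A is replaced by a measurable minorant, to which additivity of the integral
   applies. *)
have LA t : D t -> ((Num.max (L - e t) 0)%:E <= A t)%E.
  move=> Dt; have LE : (L%:E <= A t + (e t)%:E)%E.
    by apply: contrapT => h; case: Dt => tI; apply; apply: HN => /= H; apply: h; apply: H; move: tI; rewrite /= in_itv.
  rewrite EFin_max ge_max A0 andbT EFinB leeBlDr//.
have mB : measurable_fun D (fun t => (Num.max (L - e t) 0)%:E).
  apply/measurable_EFinP; apply: measurable_maxr => //.
  exact: measurable_funB.
have h1 := ge0_subset_le_integral Dc (f1 := fun t => (Num.max (L - e t) 0)%:E) (f2 := A)
  _ (fun t _ => A0 t) LA.
have h2 := ge0_subset_le_integral Dc (f1 := fun t => (e t)%:E) (f2 := E)
  _ (fun t _ => E0 t).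
apply: le_trans (leeD (h1 _) (h2 _ _)).
- rewrite -ge0_integralD//.
  + apply: (@le_trans _ _ (\int[leb]_(t in D) L%:E)%E).
      rewrite integral_cst// mulrC EFinM; apply: lee_wpmul2l; first by rewrite lee_fin.
      have : (leb `]0%R, t0[%classic <= leb (D `|` N))%E.
        apply: le_measure; rewrite ?inE//; [exact: measurableU|].
        by move=> t It; have [tN|tN] := pselect (N t); [right|left].
      rewrite lebesgue_measure_itv/= lte_fin t00 oppr0 adde0 => h; apply: le_trans h _.
      apply: le_trans (measureU2 _ mD mN) _.
      by rewrite [X in (_ + X)%E](_ : _ = 0)%E ?adde0//.
    apply: ge0_le_integral => //.
    * apply: emeasurable_funD => //; exact/measurable_EFinP.
    * by move=> t _; rewrite -EFinD lee_fin -lerBlDr le_max lexx.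
  + by move=> t _; rewrite lee_fin le_max lexx orbT.
  + by apply/measurable_EFinP.
- by move=> t _; rewrite lee_fin le_max lexx orbT.
- by move=> t Dt; rewrite lee_fin e0.
- by move=> t Dt; rewrite Ee//; exact: DI.
Qed.

End integral_lower.

Section mv_time.
Context {R : realType} {d : nat}.
Local Notation leb := (@lebesgue_measure R).
Implicit Types (k : 'rV[int]_d) (x : 'rV[R]_d) (i : 'I_d).

Lemma tint_continuous (F : R -> 'rV[R]_d -> R) (t : R) :
  (\forall s \near t, cper (F s)) ->
  (forall x, {for (t, x), continuous (fun p : R * 'rV[R]_d => F p.1 p.2)}) ->
  {for t, continuous (fun s => tint (F s))}.
Proof.
move=> cF cc; have ct : cper (F t) := nbhs_singleton cF.
apply: (@tint_cvg R d R (nbhs t) F (F t)) => //; apply: tube_at => //.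
by apply: filterS cF => s [].
Qed.

Lemma continuous_at_sum (J : Type) (l : seq J) (f : J -> R -> R) (t : R) :
  (forall j, {for t, continuous (f j)}) ->
  {for t, continuous (fun s => \sum_(j <- l) f j s)}.
Proof.
move=> H; elim: l => [|j0 l IH].
  have -> : (fun s => \sum_(j <- [::]) f j s) = (fun=> 0).
    by apply/funext => s; rewrite big_nil.
  exact: cst_continuous.
have -> : (fun s => \sum_(j <- j0 :: l) f j s) = (fun s => f j0 s + \sum_(j <- l) f j s).
  by apply/funext => s; rewrite big_cons.
exact: (continuousD (H j0) IH).
Qed.

Lemma near_itv (T t : R) : 0 < t < T -> \forall s \near t, 0 < s < T.
Proof.
move=> tT; have : open `]0, T[%classic by exact: interval_open.
rewrite openE => /(_ t) /=; rewrite in_itv/= => /(_ tT).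
by apply: filterS => s /=; rewrite in_itv.
Qed.

Lemma mv_continuous_at (T : R) (W phi : 'rV[R]_d -> R) (rho : R -> 'rV[R]_d -> R) (t : R) x :
  McKean_Vlasov_solution T W phi rho -> 0 < t < T ->
  {for (t, x), continuous (fun p : R * 'rV[R]_d => rho p.1 p.2)}.
Proof.
move=> mv tT; have tT' : 0 <= t <= T by case/andP: tT => h1 h2; rewrite !ltW.
apply: (iffRL (@cvgrPdist_lt _ _ _ (nbhs (t, x)) _ _ _)) => e e0.
have H : \forall p \near (t, x), 0 < p.1 < T.
  exists ([set s | 0 < s < T], setT); first by split; [exact: near_itv|exact: filterT].
  by move=> [s y] /= [].
apply: filterS2 H (mv_near mv x tT' e0) => p /andP[h1 h2] h.
by rewrite distrC; apply: h; rewrite !ltW.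
Qed.

Variables (T : R) (W W0 phi : 'rV[R]_d -> R) (r1 r0 : R -> 'rV[R]_d -> R).
Hypotheses (mv1 : McKean_Vlasov_solution T W phi r1)
  (mv0 : McKean_Vlasov_solution T W0 phi r0).

Let ocT (t : R) : 0 < t < T -> 0 <= t <= T.
Proof. by move=> /andP[h1 h2]; rewrite !ltW. Qed.

(* Agrees with h1sq (r1 s - r0 s) on ]0, T[ only, where partial is additive. *)
Definition diff_h1sq (s : R) : R :=
  sqint (fun x => r1 s x - r0 s x) + (4 * pi ^+ 2)^-1 *
    \sum_i sqint (fun x => partial i (r1 s) x - partial i (r0 s) x).

Lemma diff_h1sqE s : 0 < s < T -> diff_h1sq s = h1sq (fun x => r1 s x - r0 s x).
Proof.
move=> sT; rewrite /diff_h1sq /h1sq; congr (_ + _ * _); apply: eq_bigr => i _.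
by rewrite (C1B (mv_C1 mv1 sT) (mv_C1 mv0 sT)).2.
Qed.

Lemma diff_dt_continuous (psi : 'rV[R]_d -> R) t : 0 < t < T -> cper psi ->
  {for t, continuous (fun s => tint (fun x => (dt r1 s x - dt r0 s x) * psi x))}.
Proof.
move=> tT cp; apply: (@tint_continuous (fun s x => (dt r1 s x - dt r0 s x) * psi x)).
  apply: filterS (near_itv tT) => s sT.
  exact: cperM (cperB (mv_cper_dt mv1 sT) (mv_cper_dt mv0 sT)) cp.
move=> x; apply: (@continuousM R _ (fun p : R * 'rV[R]_d => dt r1 p.1 p.2 - dt r0 p.1 p.2)
  (fun p => psi p.2) (t, x)).
  apply: (@continuousB R _ _ (fun p : R * 'rV[R]_d => dt r1 p.1 p.2) (fun p => dt r0 p.1 p.2) (t, x)).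
    exact: (mv_continuous_t mv1).
  exact: (mv_continuous_t mv0).
apply: (@continuous_comp _ _ _ (fun p : R * 'rV[R]_d => p.2) psi); last exact: cp.2.
exact: cvg_snd.
Qed.

Lemma diff_h1sq_continuous t : 0 < t < T -> {for t, continuous diff_h1sq}.
Proof.
move=> tT.
have c0 : {for t, continuous (fun s => sqint (fun x => r1 s x - r0 s x))}.
  apply: (@tint_continuous (fun s x => (r1 s x - r0 s x) ^+ 2)).
    apply: filterS (near_itv tT) => s sT.
    exact: (cperX 2 (cperB (C1_cper (mv_C1 mv1 sT)) (C1_cper (mv_C1 mv0 sT)))).
  move=> x; have h : {for (t, x), continuous (fun p : R * 'rV[R]_d => r1 p.1 p.2 - r0 p.1 p.2)}.
    apply: (@continuousB R _ _ (fun p : R * 'rV[R]_d => r1 p.1 p.2) (fun p => r0 p.1 p.2) (t, x)).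
      exact: (mv_continuous_at mv1 tT).
    exact: (mv_continuous_at mv0 tT).
  apply: (@continuousM R _ (fun p : R * 'rV[R]_d => r1 p.1 p.2 - r0 p.1 p.2)
    (fun p : R * 'rV[R]_d => r1 p.1 p.2 - r0 p.1 p.2) (t, x)); exact: h.
have ci i : {for t, continuous (fun s => sqint (fun x => partial i (r1 s) x - partial i (r0 s) x))}.
  apply: (@tint_continuous (fun s x => (partial i (r1 s) x - partial i (r0 s) x) ^+ 2)).
    apply: filterS (near_itv tT) => s sT.
    exact: (cperX 2 (cperB (C1_partial i (mv_C1 mv1 sT)) (C1_partial i (mv_C1 mv0 sT)))).
  move=> x; have h : {for (t, x), continuous
      (fun p : R * 'rV[R]_d => partial i (r1 p.1) p.2 - partial i (r0 p.1) p.2)}.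
    apply: (@continuousB R _ _ (fun p : R * 'rV[R]_d => partial i (r1 p.1) p.2)
      (fun p => partial i (r0 p.1) p.2) (t, x)).
      exact: (mv_continuous_x mv1).
    exact: (mv_continuous_x mv0).
  apply: (@continuousM R _ (fun p : R * 'rV[R]_d => partial i (r1 p.1) p.2 - partial i (r0 p.1) p.2)
    (fun p : R * 'rV[R]_d => partial i (r1 p.1) p.2 - partial i (r0 p.1) p.2) (t, x)); exact: h.
apply: (continuousD c0); apply: continuousM; first exact: cst_continuous.
exact: continuous_at_sum ci.
Qed.

Lemma diff_h1sq_measurable (t0 : R) : t0 < T ->
  measurable_fun (`]0, t0[%classic : set (measurableTypeR R)) diff_h1sq.
Proof.
move=> t0T; apply: open_continuous_measurable_fun; first exact: interval_open.
move=> t /set_mem/=; rewrite in_itv/= => /andP[h1 h2]; apply: diff_h1sq_continuous.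
by rewrite h1 (lt_trans h2).
Qed.

(** The null set furnished by [weak_derivative_ae] depends on the test function. Cosines and sines
    are countably many, enumerated here by [unpickle]; off a common null set linearity of G t
    reaches all trigonometric polynomials at once. *)
Lemma weak_dt_ae (t0 : R) G : 0 < t0 < T ->
  weak_dt 1 t0 (fun t => pairing (fun x => r1 t x - r0 t x)) G ->
  {ae leb, forall t, 0 < t < t0 -> forall p, trig p ->
    G t p = tint (fun x => (dt r1 t x - dt r0 t x) * p x)}.
Proof.
move=> /andP[t00 t0T] [Gd Gi Gw].
have step psi : C1 psi -> {ae leb, forall t, 0 < t < t0 ->
    G t psi = tint (fun x => (dt r1 t x - dt r0 t x) * psi x)}.
  move=> cpsi; have cp := C1_cper cpsi; have hp := C1_Hs1 cpsi.
  apply: (@weak_derivative_ae R t0 (fun t => tint (fun x => (r1 t x - r0 t x) * psi x))).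
  - move=> t /andP[h1 h2]; have tT : 0 < t < T by rewrite h1 (lt_trans h2).
    have D := is_deriveB (mv_tint_derive mv1 tT cp) (mv_tint_derive mv0 tT cp).
    have cd1 := mv_cper_dt mv1 tT; have cd0 := mv_cper_dt mv0 tT.
    have E : tint (fun x => (dt r1 t x - dt r0 t x) * psi x) =
        tint (fun x => dt r1 t x * psi x) - tint (fun x => dt r0 t x * psi x).
      rewrite -(tintB (cperM cd1 cp) (cperM cd0 cp)); apply: eq_tint => x.
      by rewrite mulrBl.
    rewrite E; apply: near_eq_is_derive D; apply: filterS (near_itv tT) => s sT.
    have c1 := mv_cper mv1 (ocT sT); have c0 := mv_cper mv0 (ocT sT).
    rewrite -[LHS](tintB (cperM c1 cp) (cperM c0 cp)); apply: eq_tint => x.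
    by rewrite mulrBl.
  - by move=> t /andP[h1 h2]; apply: diff_dt_continuous => //; rewrite h1 (lt_trans h2).
  - exact: Gi.
  - by move=> eta he; exact: Gw.
have Hc : {ae leb, forall t, forall n : nat, 0 < t < t0 -> forall k, @choice.unpickle 'rV[int]_d n = Some k ->
    G t (cosk k) = tint (fun x => (dt r1 t x - dt r0 t x) * cosk k x)}.
  apply: ae_foralln => n; case E : (@choice.unpickle 'rV[int]_d n) => [k|]; last by apply: aeW.
  apply: filterS (step _ (C1_cosk k).1); first exact: (ae_filter_ringOfSetsType leb).
  by move=> t H tI l [<-]; exact: H.
have Hs : {ae leb, forall t, forall n : nat, 0 < t < t0 -> forall k, @choice.unpickle 'rV[int]_d n = Some k ->
    G t (sink k) = tint (fun x => (dt r1 t x - dt r0 t x) * sink k x)}.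
  apply: ae_foralln => n; case E : (@choice.unpickle 'rV[int]_d n) => [k|]; last by apply: aeW.
  apply: filterS (step _ (C1_sink k).1); first exact: (ae_filter_ringOfSetsType leb).
  by move=> t H tI l [<-]; exact: H.
apply: filterS2 Hc Hs; first exact: (ae_filter_ringOfSetsType leb).
move=> t Hc Hs tI p tp; have [h1 h2] := andP tI.
have tT : 0 < t < T by rewrite h1 (lt_trans h2).
apply: dual_trig (Gd t tI) (cperB (mv_cper_dt mv1 tT) (mv_cper_dt mv0 tT)) _ _ tp.
- by move=> k; apply: (Hc (choice.pickle k) tI); rewrite choice.pickleK.
- by move=> k; apply: (Hs (choice.pickle k) tI); rewrite choice.pickleK.
Qed.

End mv_time.

(** * Band-limited potentials and assembly of the estimate *)

Section band.
Context {R : realType} {d : nat}.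
Implicit Types (k l : 'rV[int]_d) (x : 'rV[R]_d) (i : 'I_d).

(** Every coordinate of such a frequency lies in [-K, K], so after a shift by K the band is covered
    by the image of a finite type. *)
Lemma finite_band (K : nat) : finite_set [set k : 'rV[int]_d | freq_norm k <= K%:R :> R].
Proof.
pose f (v : 'rV['I_(2 * K).+1]_d) : 'rV[int]_d := \row_i ((v 0 i)%:Z - K%:Z).
apply: (@sub_finite_set _ _ (range f)); last exact/finite_image/finite_finset.
move=> k /= kK; have ki i : (absz (k 0%R i) <= K)%N.
  rewrite -(ler_nat R) natr_absz -(ler_pXn2r (ltn0Sn 1)) ?nnegrE ?ler0z// intr_norm.
  rewrite real_normK ?num_real//.
  apply: (@le_trans _ _ (freq_norm k ^+ 2)); last first.
    by rewrite ler_pXn2r ?nnegrE ?sqrtr_ge0// ler0n.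
  rewrite freq_norm_sq /freq_sq (bigD1 i)//= lerDl; apply: sumr_ge0 => j _; exact: sqr_ge0.
exists (\row_i inord (absz (k 0 i + K%:Z))) => //; apply/rowP => i; rewrite !mxE.
have := ki i; move: (k 0 i) => z zK.
have h : (absz (z + K%:Z)%R <= 2 * K)%N by lia.
rewrite inordK ?ltnS//; lia.
Qed.

(** Taking real parts turns the complex sum into [synth S a b], with b = - Im c because Re (c e^(i
    s)) = Re c cos s - Im c sin s. No parity of a and b is given, so the high modes are computed
    from the orthogonality relations directly. *)
Lemma band_limited_trig (K : nat) (W : 'rV[R]_d -> R) : band_limited K W ->
  cper W /\ forall k, K%:R ^+ 2 < freq_sq k :> R -> fsq W k = 0.
Proof.
move=> [c Wc]; pose S : {fset 'rV[int]_d} := fset_set [set k : 'rV[int]_d | freq_norm k <= K%:R :> R].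
have HS k : (k \in S) = (freq_norm k <= K%:R :> R).
  by rewrite (in_fset_set (finite_band K)); apply/idP/idP => [/set_mem//|]; exact: mem_set.
pose a k := let: Complex u v := c k in u; pose b k := let: Complex u v := c k in - v.
have WE : W = synth S a b.
  apply/funext => x; have := Wc x; rewrite fsbig_finite/=; last exact: finite_band.
  move=> /(congr1 (fun z : R[i] => let: Complex u _ := z in u)) => ->.
  rewrite /synth -/S; elim: (enum_fset S) => [|k l IH]; first by rewrite !big_nil.
  rewrite !big_cons -IH /a /b /fourier_mode; case: (\sum_(j <- l) _) => u1 u2.
  by case: (c k) => v1 v2 /=; rewrite mulNr.
split; first by rewrite WE; exact: cper_synth.
move=> k kK.
have kS l : l \in S -> (l == k) = false /\ (l == - k) = false.
  rewrite HS => lK; have lk : freq_sq l < freq_sq k :> R.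
    apply: le_lt_trans kK; rewrite -freq_norm_sq.
    by rewrite ler_pXn2r ?nnegrE ?sqrtr_ge0// ler0n.
  split; apply/eqP => E; move: lk; rewrite E ?ltxx//.
  rewrite (_ : freq_sq (- k) = freq_sq k :> R) ?ltxx//.
  by apply: eq_bigr => i _; rewrite mxE mulrNz sqrrN.
have kS' l : l \in S -> (k == l) = false /\ (k == - l) = false.
  by move=> /kS[e1 e2]; rewrite eq_sym e1 -eqr_oppLR eq_sym e2.
rewrite WE /fsq {1}/ccoef {1}/scoef !tint_synth; [|exact: cper_sink|exact: cper_cosk].
rewrite big_seq big1 => [|l /kS'[e1 e2]]; last first.
  rewrite /ccoef /scoef tint_cosk_cosk e1 e2 addr0 !mulr0 add0r.
  rewrite (@eq_tint _ _ (fun x => cosk k x * sink l x) (fun x => sink l x * cosk k x)).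
    by rewrite tint_sink_cosk mulr0.
  by move=> x; rewrite mulrC.
rewrite big_seq big1 => [|l /kS'[e1 e2]]; first by rewrite expr0n addr0.
by rewrite /ccoef /scoef tint_sink_cosk tint_sink_sink e1 e2 subrr !mulr0 addr0.
Qed.

End band.

Section estimate.
Context {R : realType} {d : nat}.
Local Notation leb := (@lebesgue_measure R).
Implicit Types (k : 'rV[int]_d) (x : 'rV[R]_d).

Lemma Hs_norm_moments (s a : R) (f : 'rV[R]_d -> R) : 2 <= s -> Hs_norm s f = a%:E ->
  (forall S : {fset 'rV[int]_d}, \sum_(k <- enum_fset S) (1 + freq_sq k) * fsq f k <= a ^+ 2) /\
  forall k, (1 + freq_sq k) ^+ 2 * fsq f k <= a ^+ 2.
Proof.
move=> s2 E; have H S : \sum_(k <- enum_fset S) hs_weight s f k <= a ^+ 2.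
  by apply: Hs_norm_sum_le; rewrite E -EFin_expe.
have h1 k : 1 <= 1 + freq_sq k :> R by rewrite lerDl freq_sq_ge0.
have hp k (r : R) : r <= s -> (1 + freq_sq k) `^ r * fsq f k <= hs_weight s f k.
  by move=> rs; rewrite ler_wpM2r ?fsq_ge0// ler_powR.
split=> [S|k].
  apply: le_trans (H S); apply: ler_sum => k _; apply: le_trans (hp k 1 _).
    by rewrite powRr1// (le_trans ler01).
  by rewrite (le_trans _ s2)// ler1n.
apply: le_trans (H [fset k]%fset); rewrite big_seq_fset1; apply: le_trans (hp k 2 s2).
by rewrite powR_mulrn// (le_trans ler01).
Qed.

Lemma sqe_ge0 (y : \bar R) : (0 <= y ^+ 2)%E.
Proof. by case: y => [r| |]; rewrite expe2 ?mulyy ?mulNyNy ?leey// -EFinM lee_fin -expr2 sqr_ge0. Qed.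

Variables (T M N m q K t0 : R) (W W0 phi : 'rV[R]_d -> R) (r1 r0 : R -> 'rV[R]_d -> R).
Hypotheses (mv1 : McKean_Vlasov_solution T W phi r1)
  (mv0 : McKean_Vlasov_solution T W0 phi r0) (cW : cper W) (cW0 : cper W0)
  (WM : (W2oo_norm W <= M%:E)%E) (W0M : (W2oo_norm W0 <= M%:E)%E) (cphi : cper phi).
Hypothesis (HN1 : forall S : {fset 'rV[int]_d},
  \sum_(k <- enum_fset S) (1 + freq_sq k) * fsq phi k <= N).
Hypothesis (HN2 : forall k, (1 + freq_sq k) ^+ 2 * fsq phi k <= N).
Hypotheses (m0 : 0 < m) (phim : forall x, m <= phi x)
  (mean0 : tint (fun x => W x - W0 x) = 0).
Hypotheses (t0T : 0 < t0 < T) (t0M1 : t0 * (2 * (d%:R * M + 1)) <= 1)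
  (t0M : 8 * t0 * (d%:R * M ^+ 2) <= 1) (t0s : 4 * t0 <= 1) (t0K : K ^+ 4 * t0 <= 1)
  (K1 : 1 <= K) (q0 : 0 <= q) (t0q : 4 * (@coef_const R d M N * t0) <= q)
  (Hq : forall k, k != 0 -> freq_sq k <= K ^+ 2 -> q ^+ 2 <= fsq phi k).

(** A common factor for the two terms in the bound of [gradient_upper]. *)
Definition energy_const (n : nat) (M' N' m' : R) : R :=
  (16 + 8 * @drift_const R n M' (sqint_const N')) / m' ^+ 2.

Let w x := W x - W0 x.
Let u t x := r1 t x - r0 t x.
Let ec := energy_const d M N m.

Let N0 : 0 <= N.
Proof. by have := HN1 fset0; rewrite big_nil. Qed.

Let drift0 : 0 <= @drift_const R d M (sqint_const N).
Proof.
have Q0 : 0 <= sqint_const N.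
  by rewrite /sqint_const /energy_bound addr_ge0// mulr_ge0// mulr_ge0// mulr_ge0// sqr_ge0.
rewrite /drift_const addr_ge0//; first by rewrite mulr_ge0// sqr_ge0.
by apply: mulr_ge0; [apply: mulr_ge0; [exact: mulr_ge0|exact: sqr_ge0]|exact: addr_ge0].
Qed.

Lemma energy_const_gt0 : 0 < energy_const d M N m.
Proof. by rewrite divr_gt0 ?exprn_gt0// ltr_pwDl// mulr_ge0. Qed.

Let C10 : 0 < ec := energy_const_gt0.

Lemma pointwise_estimate (S : {fset 'rV[int]_d}) (G : ('rV[R]_d -> R) -> R) t :
  (forall k, k \in S -> freq_sq k <= K ^+ 2) -> 0 < t < t0 -> Hs_dual 1 G ->
  (forall p, trig p -> G p = tint (fun x => (dt r1 t x - dt r0 t x) * p x)) ->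
  q ^+ 2 * (\sum_(k <- enum_fset S) fsq w k) <=
  ec * (fine (dual_norm 1 G) ^+ 2 + h1sq (u t)).
Proof.
move=> SK /andP[tp tt0] HG Gt; have [_ t0T'] := andP t0T.
have tT : 0 < t < T by rewrite tp (lt_trans tt0).
have tI : 0 <= t <= t0 by rewrite !ltW.
have lo : forall k, k \in S -> k != 0 -> q ^+ 2 / 4 <= fsq (r0 t) k.
  move=> k kS k0; apply: (mv_fsq_lower mv0 cW0 W0M cphi HN1 HN2 t0T t0M t0s K1 (SK k kS) t0K q0) => //.
    exact: Hq k0 (SK k kS).
  apply: le_trans t0q; rewrite ler_wpM2l// ler_wpM2l//; last exact: ltW.
  exact: coef_const_ge0 W0M.
have h1 := gradient_lower mv0 cW cW0 tT mean0 lo.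
have r0m x : m / 2 <= r0 t x := mv_lower_bound mv0 cW0 W0M m0 phim t0T t0M1 x tI.
have r0Q : sqint (r0 t) <= sqint_const N := mv_sqint_bound mv0 cW0 W0M cphi HN1 t0T t0M t0s tI.
have cg : C1 (convolution w (r0 t)) := (C1_conv (cperB cW cW0) (mv_C1 mv0 tT)).1.
have cd : cper (fun x => dt r1 t x - dt r0 t x) :=
  cperB (mv_cper_dt mv1 tT) (mv_cper_dt mv0 tT).
have h2 := gradient_upper mv1 mv0 cW cW0 WM tT m0 r0m r0Q mean0
  (fun a a0 ha => dual_trig_bound HG cd Gt cg a0 ha).
apply: le_trans h1 _; apply: le_trans h2 _.
rewrite /ec /energy_const [leRHS]mulrAC; apply: ler_wpM2r; first by rewrite invr_ge0 sqr_ge0.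
have h0 : 0 <= h1sq (u t).
  rewrite /h1sq addr_ge0 ?sqint_ge0// mulr_ge0//; first by rewrite invr_ge0 mulr_ge0// sqr_ge0.
  by apply: sumr_ge0 => i _; exact: sqint_ge0.
set D2 := _ ^+ 2; have D0 : 0 <= D2 := sqr_ge0 _.
rewrite -/(h1sq (u t)) -[h1sq (fun x => _)]/(h1sq (u t)); move: h0; set h := h1sq (u t) => h0.
have a1 := mulr_ge0 drift0 D0; have a2 := mulr_ge0 drift0 h0.
by move: (@drift_const R d M (sqint_const N)) a1 a2 => dc a1 a2; lra.
Qed.

(** Each weak derivative G satisfies the same lower bound, which therefore passes to the infimum,
    also when there is none and the infimum is +oo. The remaining part of the H^1-in-time norm is
    nonnegative and is dropped. *)
Lemma integrated_estimate (S : {fset 'rV[int]_d}) :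
  (forall k, k \in S -> freq_sq k <= K ^+ 2) ->
  ((t0 * (q ^+ 2 * (\sum_(k <- enum_fset S) fsq w k) / ec))%:E <=
   H1t_dual_sqnorm 1 t0 u + L2t_sqnorm (Hs_norm 1) t0 u)%E.
Proof.
move=> SK; set L := _ / _; have [t00 t0T'] := andP t0T.
have L0 : 0 <= L.
  by rewrite divr_ge0 ?(ltW C10)// mulr_ge0 ?sqr_ge0// sumr_ge0// => k _; exact: fsq_ge0.
have E0 : (0 <= L2t_sqnorm (Hs_norm 1) t0 u)%E by apply: integral_ge0 => t _; exact: sqe_ge0.
have P0 : (0 <= L2t_sqnorm (dual_norm 1) t0 (fun t => pairing (u t)))%E.
  by apply: integral_ge0 => t _; exact: sqe_ge0.
have I0 (G : R -> ('rV[R]_d -> R) -> R) : (0 <= L2t_sqnorm (dual_norm 1) t0 G)%E.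
  by apply: integral_ge0 => t _; exact: sqe_ge0.
have HG G : weak_dt 1 t0 (fun t => pairing (u t)) G ->
    ((t0 * L)%:E <= L2t_sqnorm (dual_norm 1) t0 G + L2t_sqnorm (Hs_norm 1) t0 u)%E.
  move=> wG; have [Gd _ _] := wG.
  apply: (@integral_ae_lower R t0 L (fun t => dual_norm 1 (G t) ^+ 2)%E
    (fun t => Hs_norm 1 (u t) ^+ 2)%E (diff_h1sq r1 r0)) => //.
  - by move=> t; exact: sqe_ge0.
  - by move=> t; exact: sqe_ge0.
  - move=> t /andP[h1 h2]; have tT : 0 < t < T by rewrite h1 (lt_trans h2).
    rewrite (diff_h1sqE mv1 mv0 tT); apply: Hs1_norm_sq.
    exact: (C1B (mv_C1 mv1 tT) (mv_C1 mv0 tT)).1.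
  - exact: (diff_h1sq_measurable mv1 mv0 t0T').
  apply: filterS (weak_dt_ae mv1 mv0 t0T wG); first exact: (ae_filter_ringOfSetsType leb).
  move=> t Ht tI; have [h1 h2] := andP tI; have tT : 0 < t < T by rewrite h1 (lt_trans h2).
  have [_ fG] := Gd t tI.
  have dn0 : (0 <= dual_norm 1 (G t))%E.
    have c0 : C1 (fun _ : 'rV[R]_d => 0 : R) := (C1_cst 0).1.
    apply: le_trans (_ : (`|G t (fun=> 0)%R|%:E <= _)%E); first by rewrite lee_fin.
    apply: ereal_sup_ubound; exists (fun=> 0) => //; split; first exact: C1_Hs1.
    have := Hs1_norm_sq c0.
    have -> : h1sq (fun _ : 'rV[R]_d => 0 : R) = 0.
      by have := h1sqZ 0 c0; rewrite expr0n mul0r /= mul0r.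
    have := Hs_norm_ge0 1 (fun _ : 'rV[R]_d => 0 : R).
    case: (Hs_norm _ _) => [r| |]//; rewrite lee_fin => r0'.
    by rewrite -EFin_expe => -[/eqP]; rewrite sqrf_eq0 => /eqP ->; rewrite lee_fin.
  have fd : dual_norm 1 (G t) \is a fin_num by rewrite ge0_fin_numE.
  rewrite -(fineK fd) -EFin_expe -EFinD lee_fin (diff_h1sqE mv1 mv0 tT).
  rewrite /L ler_pdivrMr// [leRHS]mulrC; exact: (pointwise_estimate SK tI (Gd t tI) (Ht tI)).
rewrite /H1t_dual_sqnorm -addeA; apply: (@le_trans _ _ (ereal_inf [set L2t_sqnorm (dual_norm 1) t0 G
  | G in weak_dt 1 t0 (fun t => pairing (u t))] + L2t_sqnorm (Hs_norm 1) t0 u)%E); last first.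
  by rewrite leeDr.
have inf0 : (0 <= ereal_inf [set L2t_sqnorm (dual_norm 1) t0 G
    | G in weak_dt 1 t0 (fun t => pairing (u t))])%E.
  by apply: le_ereal_inf_tmp => _ [G _ <-]; exact: I0.
(* Moving this term across the infimum requires it to be finite; if it is infinite, so is the
   right-hand side. *)
move: E0 HG; set E := L2t_sqnorm (Hs_norm 1) t0 u; case: E => [r| |]// r0' HG; last first.
  by rewrite addey ?leey// gt_eqF// (lt_le_trans _ inf0)// ltNy0.
rewrite -leeBlDr//; apply: le_ereal_inf_tmp => _ [G wG <-]; rewrite leeBlDr//; exact: HG.
Qed.

End estimate.

Section final.
Context {R : realType} {d : nat}.
Implicit Types (k : 'rV[int]_d).

(** Above the band the modes of W vanish, and those of W0 gain from the Sobolev weight, which there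
    exceeds K^(2 alpha + 2). *)
Lemma fsq_high (K : nat) (alpha w0 : R) (W W0 : 'rV[R]_d -> R) (S : {fset 'rV[int]_d}) :
  cper W -> cper W0 -> (forall k, K%:R ^+ 2 < freq_sq k :> R -> fsq W k = 0) ->
  (1 <= K)%N -> 0 <= alpha + 1 -> Hs_norm (alpha + 1) W0 = w0%:E ->
  \sum_(k <- enum_fset S | ~~ (freq_sq k <= K%:R ^+ 2 :> R)) fsq (fun x => W x - W0 x) k <=
  K%:R `^ (- 2 * alpha - 2) * w0 ^+ 2.
Proof.
move=> cW cW0 WK K1 a0 E.
have H : \sum_(k <- enum_fset S) hs_weight (alpha + 1) W0 k <= w0 ^+ 2.
  by apply: Hs_norm_sum_le; rewrite E -EFin_expe.
have K0 : 0 < K%:R :> R by rewrite ltr0n.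
apply: le_trans (ler_wpM2l (powR_ge0 _ _) H); rewrite mulr_sumr big_mkcond/=.
apply: ler_sum => k _; case: ifPn => [|_]; last by rewrite mulr_ge0 ?powR_ge0// hs_weight_ge0.
rewrite -ltNge => kK; have := WK k kK; rewrite /fsq => /eqP.
rewrite paddr_eq0 ?sqr_ge0// !sqrf_eq0 => /andP[/eqP c0 /eqP s0].
rewrite (ccoefB k cW cW0) (scoefB k cW cW0) c0 s0 !sub0r !sqrrN /hs_weight -/(fsq W0 k).
rewrite mulrA ler_peMl ?fsq_ge0//.
have -> : - 2 * alpha - 2 = - (2 * (alpha + 1)) by ring.
rewrite powRN mulrC ler_pdivlMr ?powR_gt0// mul1r powRrM ge0_ler_powR ?nnegrE ?powR_ge0//.
  by rewrite addr_ge0// freq_sq_ge0.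
by rewrite powR_mulrn ?(ltW K0)// (le_trans (ltW kK))// lerDr.
Qed.

End final.

Theorem theorem2 (R : realType) (d : nat) (hd : (0 < d)%N)
    (T M phi_norm phi_min c W0_norm : R)
    (hT : 0 < T) (hphi_min : 0 < phi_min) (hc : 0 < c) :
  exists2 C : R, 0 < C &
  forall (alpha : R) (W0 : 'rV[R]_d -> R) (beta : nat) (phi : 'rV[R]_d -> R)
    (zeta : R) (K : nat) (W : 'rV[R]_d -> R)
    (rho_W rho_W0 : R -> 'rV[R]_d -> R) (t0 : R),
  1 + d%:R / 2 < alpha ->
  Hs (alpha + 1) W0 ->
  Hs_norm (alpha + 1) W0 = W0_norm%:E ->
  W2oo W0 ->
  ~~ odd beta ->
  (3 + d <= beta)%N ->
  Hs beta%:R phi ->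
  Hs_norm beta%:R phi = phi_norm%:E ->
  prob_density phi ->
  (forall x, phi_min <= phi x) ->
  beta%:R + d%:R / 2 < zeta ->
  (forall k : 'rV[int]_d, k != 0 ->
     c * freq_norm k `^ (- zeta) <= Normc.normc (fourier_coef phi k)) ->
  (1 <= K)%N ->
  band_limited K W ->
  (W2oo_norm W + W2oo_norm W0 <= M%:E)%E ->
  \int[torus_measure R d]_x (W x - W0 x) = 0 ->
  McKean_Vlasov_solution T W phi rho_W ->
  McKean_Vlasov_solution T W0 phi rho_W0 ->
  0 < t0 ->
  t0 <= c / (2 * C) * K%:R `^ (- zeta) ->
  (L2_norm (fun x => (W x - W0 x)%R) ^+ 2 <=
   C%:E * ((K%:R `^ (- 2 * alpha - 2))%:E +
     (t0^-1 * K%:R `^ (2 * zeta))%:E *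
       (H1t_dual_sqnorm 1 t0 (fun t x => (rho_W t x - rho_W0 t x)%R) +
        L2t_sqnorm (Hs_norm 1) t0 (fun t x => (rho_W t x - rho_W0 t x)%R))))%E.
Proof.
pose N := phi_norm ^+ 2.
(* Absolute values, here and on M below, because C is chosen before any hypothesis that determines
   signs. *)
pose cc := `|@coef_const R d M N|; pose ec := `|energy_const d M N phi_min|.
(* The sum of the reciprocals of the time thresholds: the horizon T, the lower bound on the density,
   the bootstrap, and 4 t0 <= 1 with some room. *)
pose A := T^-1 + 2 * (d%:R * `|M| + 1) + 8 * (d%:R * M ^+ 2) + 5.
(* The first summand pays for the high frequencies and the second for the low ones; the last two
   make t0 small enough. *)
pose C := W0_norm ^+ 2 + ec / c ^+ 2 + c * A + 2 * cc.
have Tv0 : 0 < T^-1 by rewrite invr_gt0.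
have dM0 : 0 <= 2 * (d%:R * `|M| + 1) by rewrite mulr_ge0// addr_ge0// mulr_ge0.
have dM2 : 0 <= 8 * (d%:R * M ^+ 2) by rewrite mulr_ge0// mulr_ge0// sqr_ge0.
have A0 : 0 < A by rewrite /A; lra.
have cA0 : 0 < c * A by rewrite mulr_gt0.
have cc0 : 0 <= cc := normr_ge0 _.
have ec0 : 0 <= ec / c ^+ 2 := divr_ge0 (normr_ge0 _) (sqr_ge0 _).
have w00 := sqr_ge0 W0_norm.
have C0 : 0 < C by rewrite /C; lra.
have C2 : 0 < 2 * C by rewrite mulr_gt0.
exists C => // alpha W0 beta phi zeta K W r1 r0 t0 ha _ HW0 [pW0 cW0 _] _ hb _ Hphi _ phim hz Hk K1
  bW WM mean0 mv1 mv0 t00 t0C.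
have [cpW WK] := band_limited_trig bW.
have cpW0 : cper W0 by split.
have W1M : (W2oo_norm W <= M%:E)%E by apply: le_trans WM; rewrite leeDl// W2oo_norm_ge0.
have W0M : (W2oo_norm W0 <= M%:E)%E by apply: le_trans WM; rewrite leeDr// W2oo_norm_ge0.
have M0 : 0 <= M := mv_M_ge0 W1M.
(* Membership in H^beta says nothing pointwise about this representative; continuity is inherited
   from the solution at time 0. *)
have cphi : cper phi.
  rewrite (_ : phi = r0 0); first by apply: (mv_cper mv0); rewrite lexx ltW.
  by apply/funext => x; rewrite (mv_initial mv0).
(* From d >= 1; this is what makes K^4 t0 <= 1 available through zeta > beta. *)
have b4 : 4 <= beta%:R :> R by rewrite ler_nat (leq_trans _ hb)// -[4]/(3 + 1)%N leq_add2l.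
have z4 : 4 < zeta by apply: le_lt_trans hz; rewrite (le_trans b4)// lerDl divr_ge0.
have K1' : 1 <= K%:R :> R by rewrite ler1n.
have K0 : 0 < K%:R :> R := lt_le_trans ltr01 K1'.
have Kz0 : 0 < K%:R `^ (- zeta) by rewrite powR_gt0.
have Kz1 : K%:R `^ (- zeta) <= 1.
  by rewrite -[leRHS](powRr0 K%:R); apply: ler_powR => //; lra.
have K4z : K%:R ^+ 4 * K%:R `^ (- zeta) <= 1.
  rewrite powRN ler_pdivrMr ?powR_gt0// mul1r -powR_mulrn ?(ltW K0)// ler_powR//.
  exact: ltW.
have t0C' : 2 * C * t0 <= c * K%:R `^ (- zeta).
  by rewrite mulrC -ler_pdivlMr// mulrAC.
(* From C >= c A and K^(-zeta) <= 1, so every threshold whose reciprocal enters A is met with a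
   margin of 2. *)
have t0B (B : R) : 0 <= B -> B <= A -> B * t0 <= 2^-1.
  move=> B0 BA; rewrite -(ler_pM2l (x := 2 * c)) ?mulr_gt0//.
  have -> : 2 * c * 2^-1 = c by field.
  have h : 2 * (c * B) * t0 <= 2 * C * t0.
    rewrite ler_wpM2r ?(ltW t00)// ler_wpM2l//.
    apply: le_trans (ler_wpM2l (ltW hc) BA) _; rewrite /C; lra.
  rewrite mulrA -(mulrA 2 c B); apply: le_trans h _; apply: le_trans t0C' _.
  by rewrite ler_piMr// ltW.
have t0T : 0 < t0 < T.
  rewrite t00/=; have h : T^-1 * t0 <= 2^-1 by apply: t0B; rewrite ?(ltW Tv0)// /A; lra.
  rewrite -(ltr_pM2l Tv0) mulVf ?gt_eqF//; lra.
(* The smallest size that the hypothesis allows for a nonzero mode of [phi] in the band, reached at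
   |k| = K. *)
pose q := c * K%:R `^ (- zeta).
have q0 : 0 < q by rewrite mulr_gt0.
have [HN1 HN2] : (forall S : {fset 'rV[int]_d},
    \sum_(k <- enum_fset S) (1 + freq_sq k) * fsq phi k <= N) /\
    forall k : 'rV[int]_d, (1 + freq_sq k) ^+ 2 * fsq phi k <= N.
  by apply: Hs_norm_moments Hphi; apply: le_trans b4; rewrite ler_nat.
have Hq (k : 'rV[int]_d) : k != 0 -> freq_sq k <= K%:R ^+ 2 :> R -> q ^+ 2 <= fsq phi k.
  move=> k0 kK; rewrite -normc_fourier_sq.
  have n0 : 0 < freq_norm k :> R.
    by rewrite /freq_norm sqrtr_gt0 (lt_le_trans ltr01 (freq_sq_ge1 k0)).
  have nK : freq_norm k <= K%:R :> R.
    by rewrite -(ler_pXn2r (ltn0Sn 1)) ?nnegrE ?(ltW n0) ?(ltW K0)// freq_norm_sq.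
  have h : q <= Normc.normc (fourier_coef phi k).
    apply: le_trans (Hk k k0); rewrite /q ler_wpM2l ?(ltW hc)// !powRN.
    by rewrite lef_pV2 ?posrE ?powR_gt0// ge0_ler_powR ?nnegrE ?(ltW n0) ?(ltW K0)//; lra.
  by rewrite ler_pXn2r ?nnegrE ?(ltW q0)//; apply: le_trans h; exact: ltW.
have h1 : t0 * (2 * (d%:R * M + 1)) <= 1.
  have : 2 * (d%:R * `|M| + 1) * t0 <= 2^-1 by apply: t0B => //; rewrite /A; lra.
  by rewrite ger0_norm// mulrC; lra.
have h2 : 8 * t0 * (d%:R * M ^+ 2) <= 1.
  have : 8 * (d%:R * M ^+ 2) * t0 <= 2^-1 by apply: t0B => //; rewrite /A; lra.
  by rewrite mulrAC; lra.
have h3 : 4 * t0 <= 1 by have := t0B 4; rewrite /A; lra.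
have h4 : K%:R ^+ 4 * t0 <= 1.
  have t0z : t0 <= K%:R `^ (- zeta).
    apply: le_trans t0C _; rewrite ler_piMl ?(ltW Kz0)// ler_pdivrMr// mul1r.
    have : c * 1 <= c * A by rewrite ler_wpM2l ?(ltW hc)// /A; lra.
    by rewrite /C; lra.
  by apply: le_trans K4z; rewrite ler_wpM2l// exprn_ge0// ltW.
have h5 : 4 * (@coef_const R d M N * t0) <= q.
  have e1 : @coef_const R d M N * t0 <= cc * t0 by rewrite ler_wpM2r ?(ltW t00)// ler_norm.
  have e2 : 2 * cc * t0 <= C * t0 by rewrite ler_wpM2r ?(ltW t00)// /C; lra.
  by move: t0C'; rewrite -/q -(mulrA 2 C); move: e1 e2; rewrite -(mulrA 2 cc); lra.
have cw : cper (fun x => W x - W0 x) := cperB cpW cpW0.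
have est := integrated_estimate mv1 mv0 cpW cpW0 W1M W0M cphi HN1 HN2 hphi_min phim mean0
  t0T h1 h2 h3 h4 K1' (ltW q0) h5 Hq.
rewrite (L2_norm_sq cw); move: est.
set H := (H1t_dual_sqnorm 1 t0 _ + _)%E => est.
have b0 : 0 < t0^-1 * K%:R `^ (2 * zeta) by rewrite mulr_gt0 ?invr_gt0// powR_gt0.
(* If H is +oo the bound is trivial; H = -oo contradicts the estimate on the empty set of
   frequencies, which also gives h >= 0 in the finite case. *)
case: H est => [h| |] est.
- have -> : (C%:E * ((K%:R `^ (- 2 * alpha - 2))%:E + (t0^-1 * K%:R `^ (2 * zeta))%:E * h%:E))%E =
    (C * (K%:R `^ (- 2 * alpha - 2) + t0^-1 * K%:R `^ (2 * zeta) * h))%:E by [].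
  have e0 := @energy_const_gt0 R d M N phi_min _ HN1 hphi_min.
  set E0 := energy_const d M N phi_min in est e0.
  have Ez : K%:R `^ (2 * zeta) = ((K%:R `^ (- zeta)) ^+ 2)^-1.
    by rewrite powRN exprVn invrK mulrC powRrM powR_mulrn ?powR_ge0.
  have h0 : 0 <= h.
    have H0 : forall k : 'rV[int]_d, k \in fset0 -> freq_sq k <= K%:R ^+ 2 :> R by [].
    by have := est fset0 H0; rewrite lee_fin big_nil mulr0 mul0r mulr0.
  rewrite lee_fin; apply: parseval_le cw _ => S.
  rewrite (bigID (fun k => freq_sq k <= K%:R ^+ 2 :> R))/= addrC mulrDr.
  have a1 : 0 <= alpha + 1.
    have : 0 <= d%:R / 2 :> R by rewrite divr_ge0.
    by move: ha; lra.
  apply: lerD.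
    apply: le_trans (fsq_high S cpW cpW0 WK K1 a1 HW0) _.
    by rewrite mulrC ler_wpM2r ?powR_ge0// /C; lra.
  rewrite big_fset_condE; set s1 := \sum_(k <- _) _.
  have est1 : t0 * (q ^+ 2 * s1 / E0) <= h.
    rewrite -lee_fin; apply: est => k; rewrite !inE => /andP[_]; exact.
  have Es : s1 = E0 / c ^+ 2 * (t0^-1 * K%:R `^ (2 * zeta)) * (t0 * (q ^+ 2 * s1 / E0)).
    by rewrite Ez /q; field; rewrite !gt_eqF.
  apply: (@le_trans _ _ (E0 / c ^+ 2 * (t0^-1 * K%:R `^ (2 * zeta)) * h)).
    by rewrite [leLHS]Es ler_wpM2l// mulr_ge0 ?(ltW b0)// divr_ge0 ?(ltW e0)// sqr_ge0.
  rewrite -mulrA ler_wpM2r//; first by rewrite mulr_ge0// ltW.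
  apply: (@le_trans _ _ (ec / c ^+ 2)); last by rewrite /C; lra.
  by rewrite ler_wpM2r ?invr_ge0 ?sqr_ge0// ler_norm.
- by rewrite gt0_muley ?lte_fin// addey// gt0_muley ?lte_fin// leey.
- have H0 : forall k : 'rV[int]_d, k \in fset0 -> freq_sq k <= K%:R ^+ 2 :> R by [].
  by have := est fset0 H0; rewrite leeNy_eq.
Qed.
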